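(* There is an absolute constant $a>0$ such that the following holds. Let $\alpha\ge 0$, $\epsilon\ge 0$ with $\max\{\alpha,\epsilon\}>0$, and let the force be sufficiently smooth and of form (A) or (B) (see context), with associated bound $G$: - in case (A), assume that there exists a scalar function $g(x,s)$, independent of $\Omega$, such that $\frac1\Omega\,\partial_t\big[g(x,\Omega t)\big]=(\mathrm{rot}\,F)(x_1+\Omega t,x_2)$ and $\sup_s\|g(\cdot,s)\|_{C^3(\mathbb{T}^2)}\le G$, where $G$ is independent of $\Omega$; - in case (B), $G$ is a number with $\|\mathrm{rot}\,f\|_{C^3(\mathbb{T}^2)}\le G$. Let $\delta$ satisfy $0<\delta\le \frac14(\alpha+a\epsilon)$. Then there exists $\Omega_0=\Omega_0(\alpha,\epsilon,G,\delta)$ such that for every $\Omega\ge\Omega_0$ the system $$v_t+v\cdot\nabla v-\epsilon\Delta v+\alpha v+\nabla p=F_\Omega,\qquad \mathrm{div}\,v=0,\qquad \int_{\mathbb{T}^2}v\,dx=0$$ has a regular solution $v$ that is periodic in time with period $T_{per}=2\pi/\Omega$ and satisfies $$\|v\|_{L_\infty(T_{per}\mathbb{S}^1;W^1_\infty(\mathbb{T}^2))}\le\delta .$$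
   Context: $\mathbb{T}^2=[0,2\pi]^2$ with periodic boundary conditions, and $x=(x_1,x_2)$. For a vector field $v=(v_1,v_2)$, $\mathrm{rot}\,v=\partial_{x_1}v_2-\partial_{x_2}v_1$. $T_{per}\mathbb{S}^1$ denotes the circle of length $T_{per}$, so functions on $\mathbb{T}^2\times T_{per}\mathbb{S}^1$ are functions that are $T_{per}$-periodic in time. $W^1_\infty$ is the usual Sobolev space of functions bounded together with their first spatial derivatives. The force $F_\Omega(x,t)$, $\Omega>0$, has one of the following two forms. (A) $F_\Omega(x,t)=F(x_1+\Omega t,x_2)$, where $F:\mathbb{T}^2\to\mathbb{R}^2$ is a time-independent vector field with $\int_{\mathbb{T}^2}F\,dx=0$ whose Fourier coefficients satisfy $\hat F_k=0$ for all $k=(0,k_2)$. (This is the system for the perturbation $v-\Omega\hat e_1$ of a constant background flow $\Omega\hat e_1$, after the Galilean change of variables.) (B) $F_\Omega(x,t)=f(x)\sin\Omega t$, where $f:\mathbb{T}^2\to\mathbb{R}^2$ satisfies $\int_{\mathbb{T}^2}f\,dx=0$. ''Sufficiently smooth'' means: there is an absolute integer $m$ such that the result holds for all $F$ (respectively $f$) of class $C^m$. A ''regular'' solution is one for which the equations hold almost everywhere for some pressure $p$; equivalently, with $\omega=\mathrm{rot}\,v$, one has $\omega_t+v\cdot\nabla\omega-\epsilon\Delta\omega+\alpha\omega=\mathrm{rot}\,F_\Omega$. *)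

(* Defs.v *)
From HB Require Import structures.
From mathcomp Require Import all_boot all_order all_algebra.
From mathcomp Require Import complex.
From mathcomp Require Import all_classical all_reals all_analysis.

Set Implicit Arguments.
Unset Strict Implicit.
Unset Printing Implicit Defensive.

Import Order.TTheory GRing.Theory Num.Theory.
Import numFieldNormedType.Exports.

Local Open Scope classical_set_scope.
Local Open Scope ring_scope.

(* Functions on the torus T^2 = [0,2pi]^2 are 2pi-periodic functions on R^2;
   functions on T^2 x (circle of length T) are functions on R^2 x R that are
   moreover T-periodic in the last variable. *)
Notation plane R := (R * R)%type (only parsing).
Notation spacetime R := (R * R * R)%type (only parsing).

Section Torus.
Context (R : realType).
Implicit Types (T : R) (j : 'I_2) (k : nat).

Definition dx j : plane R := if j == 0 then (1, 0) else (0, 1).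
Definition dX j : spacetime R := (dx j, 0).
Definition dT : spacetime R := (0, 1).

Definition torus_fun (S : zmodType) (f : plane R -> S) : Prop :=
  forall j, periodic f ((2 * pi) *: dx j).

Definition torus_time_fun T (S : zmodType) (f : spacetime R -> S) : Prop :=
  (forall j, periodic f ((2 * pi) *: dX j)) /\ periodic f (T *: dT).

Definition torus : set (plane R) :=
  `[0, 2 * pi]%classic `*` `[0, 2 * pi]%classic.
Definition torus_time T : set (spacetime R) := torus `*` `[0, T]%classic.

Local Notation leb := (@lebesgue_measure R).
Local Notation leb2 := (leb \x leb)%E.
Local Notation leb3 := (leb2 \x leb)%E.

(* On a finite-dimensional V this is the usual class C^k: it is enough (and
   necessary) to differentiate along the vectors of a basis. *)
Fixpoint Ck (V : normedModType R) k (f : V -> R) : Prop :=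
  continuous f /\
  if k is k'.+1 then
    forall e : V, (forall x, derivable f x e) /\ Ck k' (fun x => 'D_e f x)
  else True.

Definition smooth (V : normedModType R) (f : V -> R) : Prop :=
  forall k, Ck k f.

Definition partials (a b : nat) (f : plane R -> R) : plane R -> R :=
  iter a (fun h x => 'D_(dx 0) h x) (iter b (fun h x => 'D_(dx 1) h x) f).

Definition Ck_norm k (f : plane R -> R) : \bar R :=
  if `[< Ck k f >] then
    ereal_sup [set y | exists a b x,
      (a + b <= k)%N /\ y = (`|partials a b f x|)%:E]
  else +oo%E.

Definition rot2 (F : plane R -> 'rV[R]_2) (x : plane R) : R :=
  'D_(dx 0) (fun y => F y 0 1) x - 'D_(dx 1) (fun y => F y 0 0) x.

Definition mean_zero (F : plane R -> 'rV[R]_2) : Prop :=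
  forall i, \int[leb2]_(x in torus) F x 0 i = 0.

Definition fourier_coef (f : plane R -> R) (k : int * int) : R[i] :=
  Complex ((2 * pi) ^- 2 * \int[leb2]_(x in torus)
             (f x * cos (k.1%:~R * x.1 + k.2%:~R * x.2)))
          (- ((2 * pi) ^- 2 * \int[leb2]_(x in torus)
             (f x * sin (k.1%:~R * x.1 + k.2%:~R * x.2)))).

(* Distributional derivative on the torus (resp. on torus x circle): g = D f,
   tested against smooth periodic functions; D is a first-order directional
   derivative, hence skew-adjoint. *)
Definition weak_dx j (f g : plane R -> R) : Prop :=
  [/\ torus_fun f, torus_fun g,
      leb2.-integrable torus (EFin \o f),
      leb2.-integrable torus (EFin \o g) &
      forall phi : plane R -> R, smooth phi -> torus_fun phi ->
        \int[leb2]_(x in torus) (f x * 'D_(dx j) phi x) =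
        - \int[leb2]_(x in torus) (g x * phi x)].

Definition weak_deriv T (e : spacetime R) (f g : spacetime R -> R) : Prop :=
  [/\ torus_time_fun T f, torus_time_fun T g,
      leb3.-integrable (torus_time T) (EFin \o f),
      leb3.-integrable (torus_time T) (EFin \o g) &
      forall phi : spacetime R -> R, smooth phi -> torus_time_fun T phi ->
        \int[leb3]_(z in torus_time T) (f z * 'D_e phi z) =
        - \int[leb3]_(z in torus_time T) (g z * phi z)].

(* ||u||_oo + sum_j ||d_j u||_oo.  Weak derivatives are unique almost
   everywhere, so the infimum is over at most one value; it is +oo when u has
   no weak gradient.  By periodicity the essential suprema over R^2 are those
   over the torus. *)
Definition W1oo_norm (u : plane R -> 'rV[R]_2) : \bar R :=
  ereal_inf [set y | exists Du : 'I_2 -> plane R -> 'rV[R]_2,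
    (forall j i, weak_dx j (fun x => u x 0 i) (fun x => Du j x 0 i)) /\
    y = (Lnorm leb2 +oo (fun x => (`|u x|)%:E) +
         \sum_(j < 2) Lnorm leb2 +oo (fun x => (`|Du j x|)%:E))%E].

Definition Loo_W1oo_norm (v : spacetime R -> 'rV[R]_2) : \bar R :=
  Lnorm leb +oo%E (fun t => W1oo_norm (fun x => v (x, t))).

(* All derivatives are weak ones, and the equations hold almost everywhere.
   vt = d_t v, Dv j = d_j v, D2v j = d_j d_j v, Dp 0 j = d_j p.  When
   eps = 0 the viscous term is absent and no second derivative is required. *)
Definition regular_solution (alpha eps T : R) (F v : spacetime R -> 'rV[R]_2)
    : Prop :=
  exists (vt : spacetime R -> 'rV[R]_2) (Dv D2v : 'I_2 -> spacetime R -> 'rV[R]_2)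
         (p : spacetime R -> R) (Dp : spacetime R -> 'rV[R]_2),
  [/\ forall i, weak_deriv T dT (fun z => v z 0 i) (fun z => vt z 0 i),
      forall j i, weak_deriv T (dX j) (fun z => v z 0 i) (fun z => Dv j z 0 i),
      0 < eps -> forall j i,
        weak_deriv T (dX j) (fun z => Dv j z 0 i) (fun z => D2v j z 0 i),
      forall j, weak_deriv T (dX j) p (fun z => Dp z 0 j) &
   [/\ {ae leb3, forall z,
          vt z + \sum_(j < 2) v z 0 j *: Dv j z
          - eps *: (\sum_(j < 2) D2v j z) + alpha *: v z + Dp z = F z},
       {ae leb3, forall z, \sum_(j < 2) Dv j z 0 j = 0} &
       forall t, mean_zero (fun x => v (x, t))]].

Definition force_translated (F : plane R -> 'rV[R]_2) (Omega : R)
    (z : spacetime R) : 'rV[R]_2 :=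
  F (z.1.1 + Omega * z.2, z.1.2).

Definition force_oscillating (f : plane R -> 'rV[R]_2) (Omega : R)
    (z : spacetime R) : 'rV[R]_2 :=
  sin (Omega * z.2) *: f z.1.

Definition torus_field (m : nat) (F : plane R -> 'rV[R]_2) : Prop :=
  [/\ torus_fun F, forall i, Ck m (fun x => F x 0 i) & mean_zero F].

Definition translated_data (m : nat) (G : R) (F : plane R -> 'rV[R]_2) : Prop :=
  [/\ torus_field m F,
      forall (k2 : int) i, fourier_coef (fun x => F x 0 i) (0, k2) = 0 &
      exists g : plane R -> R -> R,
        [/\ forall s, torus_fun (fun x => g x s),
            forall (Omega : R) x (t : R), 0 < Omega ->
              derivable (fun tau : R => g x (Omega * tau)) t 1 /\
              Omega^-1 * derive1 (fun tau : R => g x (Omega * tau)) t =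
                rot2 F (x.1 + Omega * t, x.2) &
            (ereal_sup [set Ck_norm 3 (fun x => g x s) | s in [set: R]]
               <= G%:E)%E]].

Definition oscillating_data (m : nat) (G : R) (f : plane R -> 'rV[R]_2) : Prop :=
  torus_field m f /\ (Ck_norm 3 (rot2 f) <= G%:E)%E.

End Torus.

(* Main.v *)
(* Write [Om] for the frequency. A time-periodic forcing of frequency [Om >> 1] only produces
   a vorticity [w0] of size [G / Om], where [d_t w0 = rot F]; the claim is that the
   whole flow stays this small. Work with the space-time Fourier coefficients of the vorticity,
   whose modes are [k1 x1 + k2 x2 + Om l t].  Galerkin iterates solve, on the modes of
   size at most [4^n], the linear equation
     [d_t w' + u.grad w' + (al - eps Lap) w' = rot F],  [u] the velocity of the previous [w].
   The transport term is skew, so this is coercive.  Testing the equation for [w' - w0] with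
   the weight [(|k| + |l|)^4] gives a bound in a space-time H^2 space with a constant independent
   of [Om], because the commutator of the transport term with the weight is bounded by the size
   of [u], which is small compared with the damping [al + eps]; in three space-time dimensions this space embeds
   in the functions with absolutely summable coefficients, also for [grad u].  The iterates
   converge geometrically in L^2, hence their derived series converge uniformly, and the pressure
   is recovered from [u.grad u = w u^perp + grad (|u|^2 / 2)].

   The size of [w0] comes from Bessel's inequality for third derivatives.  For a translated
   force the identity [g(x,s) - g(x,0) = H(x1 + s) - H(x1)] expresses the coefficients of
   [rot F], divided by [k1] and multiplied by [exp(i k1 s) - 1], through those of [g]; averaging
   [|exp(i k1 s) - 1|^2 = 2 - 2 cos(k1 s)] over [s] removes the last factor. *)

Require Import Defs.
From HB Require Import structures.
From mathcomp Require Import all_boot all_order all_algebra.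
From mathcomp Require Import all_classical all_reals all_analysis.
From mathcomp Require Import measurable_realfun.
From mathcomp Require Import complex ring lra zify.

Set Implicit Arguments.
Unset Strict Implicit.
Unset Printing Implicit Defensive.

Import Order.TTheory GRing.Theory Num.Theory.
Import numFieldNormedType.Exports.
Local Open Scope classical_set_scope.
Local Open Scope ring_scope.

(** * Bounded sums and weights *)

(** The unknown is expanded in modes periodic in [Om t], so time periodicity is built in and no
    initial value problem is solved. [Om] enters the linear equation only through [d_t], which is
    skew and commutes with every weight even in the mode; hence no bound on the size of the iterates
    sees it. The source [rot F] is not small, only its primitive [w0] is: testing with [w'] itself
    would lose this, whereas [w' - w0] has the source [- u.grad w0 - (al - eps Lap) w0]. The
    transport part costs a spatial derivative of [w0], which is why [w0] is measured with an
    additional factor [hw]. On modes with nonzero spatial frequency the damping is at least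
    [al + eps], so vanishing viscosity and vanishing friction are treated together and [a = 1] is
    admissible. The real basis [cos + sin] replaces complex exponentials: a Galerkin step is then a
    real linear system, and reality of the flow needs no symmetry condition. A step contracts only
    in L^2: the transport of [w] by a difference of velocities costs a derivative, which the H^2
    bound pays for. *)

Section BoundedSums.
Variable R : realType.

(* A nonnegative [f] is summable with sum at most [C]: no infinite sum is ever formed. *)
Definition bnd (T : eqType) (f : T -> R) (C : R) :=
  forall s : seq T, uniq s -> \sum_(x <- s) f x <= C.

Lemma bnd_ge0 (T : eqType) (f : T -> R) C : bnd f C -> 0 <= C.
Proof. by move=> /(_ [::] isT); rewrite big_nil. Qed.

Lemma bnd1 (T : eqType) (f : T -> R) C x : bnd f C -> f x <= C.
Proof. by move=> /(_ [:: x] isT); rewrite big_seq1. Qed.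

Lemma bnd_le (T : eqType) (f g : T -> R) C :
  (forall x, f x <= g x) -> bnd g C -> bnd f C.
Proof. by move=> fg gC s us; apply: le_trans (gC s us); apply: ler_sum. Qed.

Lemma bndW (T : eqType) (f : T -> R) C D : C <= D -> bnd f C -> bnd f D.
Proof. by move=> CD fC s us; apply: le_trans CD; exact: fC. Qed.

Lemma bndD (T : eqType) (f g : T -> R) C D :
  bnd f C -> bnd g D -> bnd (fun x => f x + g x) (C + D).
Proof. by move=> fC gD s us; rewrite big_split lerD ?fC ?gD. Qed.

Lemma bndZ (T : eqType) (f : T -> R) C c :
  0 <= c -> bnd f C -> bnd (fun x => c * f x) (c * C).
Proof. by move=> c0 fC s us; rewrite -mulr_sumr ler_wpM2l ?fC. Qed.

Lemma bnd_inj (T U : eqType) (h : T -> U) (f : U -> R) C :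
  injective h -> bnd f C -> bnd (f \o h) C.
Proof.
by move=> hI fC s us; rewrite -(big_map h predT f); apply: fC; rewrite map_inj_uniq.
Qed.

Lemma sum_sub_le (T : eqType) (f : T -> R) (s t : seq T) :
  (forall x, 0 <= f x) -> uniq s -> {subset s <= t} ->
  \sum_(x <- s) f x <= \sum_(x <- t) f x.
Proof.
move=> f0 us st.
have ps : perm_eq s [seq x <- undup t | x \in s].
  apply: uniq_perm => //; first by rewrite filter_uniq ?undup_uniq.
  move=> x; rewrite mem_filter mem_undup.
  by apply/idP/andP => [xs|[]//]; split=> //; exact: st.
rewrite (perm_big _ ps) big_filter big_mkcond /=.
apply: (@le_trans _ _ (\sum_(x <- undup t) f x)).
  by apply: ler_sum => x _; case: ifP.
elim: t {st ps} => [|a t IH] /=; first by rewrite !big_nil.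
case: ifP => _; rewrite !big_cons; last by rewrite lerD.
by apply: le_trans IH _; rewrite lerDr.
Qed.

Lemma bnd_prod (T U : eqType) (f : T -> R) (g : U -> R) A B :
  (forall x, 0 <= f x) -> (forall x, 0 <= g x) -> bnd f A -> bnd g B ->
  bnd (fun x => f x.1 * g x.2) (A * B).
Proof.
move=> f0 g0 fA gB s us.
apply: (@le_trans _ _ (\sum_(x <- allpairs pair (undup (map fst s)) (undup (map snd s)))
   f x.1 * g x.2)).
  apply: sum_sub_le => //; first by move=> x; rewrite mulr_ge0.
  by move=> [x y] xy; apply/allpairsP; exists (x, y); rewrite !mem_undup;
    split=> //=; apply/mapP; exists (x, y).
rewrite big_allpairs /=.
under eq_bigr do rewrite -mulr_sumr.
by rewrite -mulr_suml ler_pM ?sumr_ge0 ?fA ?gB ?undup_uniq.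
Qed.

Lemma bnd_nat (f : nat -> R) C : (forall j, 0 <= f j) ->
  (forall N, \sum_(j < N) f j <= C) -> bnd f C.
Proof.
move=> f0 fC s us; pose N := (\max_(j <- s) j).+1.
apply: le_trans (fC N); rewrite -(big_mkord predT f).
apply: sum_sub_le => // j js; rewrite mem_index_iota /= ltnS.
exact: (@leq_bigmax_seq _ s predT id).
Qed.

Lemma bnd_int (f : nat -> R) C : (forall j, 0 <= f j) -> bnd f C ->
  bnd (fun n : int => f `|n|%N) (C + C).
Proof.
move=> f0 fC s us.
rewrite (bigID (fun n : int => 0 <= n)) /= -big_filter -[X in _ + X]big_filter.
have H (t : seq int) : uniq t -> {in t &, injective (fun n : int => `|n|%N)} ->
    \sum_(n <- t) f `|n|%N <= C.
  move=> ut tI; rewrite -(big_map (fun n : int => `|n|%N) predT f).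
  by apply: fC; rewrite map_inj_in_uniq.
apply: lerD; apply: H; rewrite ?filter_uniq // => x y;
  rewrite !mem_filter => /andP[x0 _] /andP[y0 _]; lia.
Qed.

(** A finite set whose sum comes within [e] of the supremum of all finite sums leaves at most [e]
    for any finite set disjoint from it. *)
Lemma bnd_tail (T : eqType) (f : T -> R) C e : (forall x, 0 <= f x) ->
  bnd f C -> 0 < e ->
  exists S : seq T, uniq S /\ forall s, uniq s -> (forall x, x \in s -> x \notin S) ->
    \sum_(x <- s) f x <= e.
Proof.
move=> f0 fC e0.
pose A : set R := [set y | exists s : seq T, uniq s /\ y = \sum_(x <- s) f x].
have hA : has_sup A.
  split; first by exists 0, [::]; rewrite big_nil.
  by exists C => _ [s [us ->]]; exact: fC.
have [_ [S [uS ->]] lt] := sup_adherent e0 hA.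
exists S; split=> // s us sS.
have : \sum_(x <- S ++ s) f x <= sup A.
  apply: ub_le_sup; first exact: hA.2.
  exists (S ++ s); split=> //; rewrite cat_uniq uS us /= andbT.
  by apply/hasPn => x /sS.
rewrite big_cat /=; lra.
Qed.

(** Shifts such as [k |-> k + q] do not preserve a box of modes. Since the summands vanish outside
    the two ranges, a bijection of the whole index types suffices; with [h = id] this enlarges a
    box. *)
Lemma sum_reindex (T U : eqType) (s : seq T) (t : seq U) (h : T -> U) (h' : U -> T)
    (F : T -> R) (G : U -> R) :
  uniq s -> uniq t -> cancel h h' -> cancel h' h ->
  (forall x, F x = G (h x)) ->
  (forall x, x \notin s -> F x = 0) -> (forall y, y \notin t -> G y = 0) ->
  \sum_(x <- s) F x = \sum_(y <- t) G y.
Proof.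
move=> us ut hK h'K FG F0 G0.
rewrite (bigID (fun x => h x \in t)) /= [X in _ + X]big1 ?addr0; last first.
  by move=> x xt; rewrite FG G0.
rewrite (bigID (fun y => h' y \in s)) /= [X in _ = _ + X]big1 ?addr0; last first.
  by move=> y ys; rewrite -(h'K y) -FG F0.
rewrite -big_filter -[RHS]big_filter (eq_bigr (fun x => G (h x))) // -(big_map h predT G).
apply: perm_big; apply: uniq_perm.
- by rewrite map_inj_uniq ?filter_uniq //; exact: can_inj hK.
- by rewrite filter_uniq.
move=> y; apply/mapP/idP => [[x]|].
  by rewrite !mem_filter => /andP[ht hs] ->; rewrite hK ht hs.
rewrite mem_filter => /andP[hs ht]; exists (h' y); rewrite ?h'K //.
by rewrite mem_filter h'K ht hs.
Qed.

End BoundedSums.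

(** * Space-time modes, their weights, and lattice sums *)

Notation Z3 := (int * int * int)%type.

Section Weights.
Variable R : realType.
Implicit Types (x y : R) (p q k : Z3).

Lemma expr_le x y n : 0 <= x -> x <= y -> x ^+ n <= y ^+ n.
Proof. by move=> x0 xy; rewrite lerXn2r ?nnegrE // (le_trans x0). Qed.

(** Exponents in quarters become integral powers of a fourth root, which ring arithmetic can
    compare. *)
Definition root4 x : R := Num.sqrt (Num.sqrt x).

Lemma root4_ge0 x : 0 <= root4 x.
Proof. exact: sqrtr_ge0. Qed.

Lemma root4K x : 0 <= x -> root4 x ^+ 4 = x.
Proof. by move=> x0; rewrite (exprM _ 2 2) !sqr_sqrtr ?sqrtr_ge0. Qed.

Lemma root4_le x y : x <= y -> root4 x <= root4 y.
Proof. by move=> xy; rewrite !ler_wsqrtr. Qed.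

Lemma root4_ge1 x : 1 <= x -> 1 <= root4 x.
Proof. by move=> x1; rewrite -[1](@sqrtr1 R) -{1}(@sqrtr1 R); exact: root4_le. Qed.

Lemma root4_le2 x y : 0 <= y -> x <= 2 * y -> root4 x <= 2 * root4 y.
Proof.
move=> y0 xy; have -> : 2 * root4 y = root4 (16 * y).
  have S c z : 0 <= c -> Num.sqrt (c ^+ 2 * z) = c * Num.sqrt z.
    by move=> c0; rewrite sqrtrM ?sqr_ge0 // sqrtr_sqr ger0_norm.
  rewrite /root4 (_ : 16 * y = 4 ^+ 2 * y); last by ring.
  by rewrite S // (_ : 4 * _ = 2 ^+ 2 * Num.sqrt y) ?S //; ring.
by apply: root4_le; lra.
Qed.

(* [(n + 1)^(-5/4)] *)
Definition tau (n : nat) : R := (root4 n.+1%:R ^+ 5)^-1.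

Lemma tau_ge0 n : 0 <= tau n.
Proof. by rewrite invr_ge0 exprn_ge0 ?root4_ge0. Qed.

(** Telescoping comparison with [(j + 1)^(-1/4) - (j + 2)^(-1/4)], which is at least an eighth of
    [tau j]. *)
Lemma bnd_tau : bnd tau 8.
Proof.
apply: bnd_nat => [|N]; first exact: tau_ge0.
suff H : \sum_(j < N) tau j <= 8 * (1 - (root4 N.+1%:R)^-1).
  apply: le_trans H _; rewrite -[leRHS]mulr1 ler_wpM2l // gerBl.
  by rewrite invr_ge0 root4_ge0.
elim: N => [|N IH].
  by rewrite big_ord0 /root4 !sqrtr1 invr1 subrr mulr0.
rewrite big_ord_recr /=; apply: le_trans (lerD IH (lexx _)) _.
rewrite /tau; set a := root4 N.+1%:R; set b := root4 N.+2%:R.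
have a1 : 1 <= a by apply: root4_ge1; rewrite ler1n.
have ab : a <= b by apply: root4_le; rewrite ler_nat.
have a4 : a ^+ 4 = N.+1%:R by rewrite root4K.
have b4 : b ^+ 4 = a ^+ 4 + 1 by rewrite a4 root4K // natr1.
have a0 : 0 < a by lra.
have b0 : 0 < b by lra.
have a41 : 1 <= a ^+ 4 by rewrite exprn_ege1.
(* [b ^+ 4 - a ^+ 4 = 1] is factored, which makes the difference the inverse of a product close to
   [4 * a ^+ 5]. *)
have E : a^-1 - b^-1 = (b * a * ((a + b) * (a ^+ 2 + b ^+ 2)))^-1.
  have -> : (b * a * ((a + b) * (a ^+ 2 + b ^+ 2)))^-1 =
            (b ^+ 4 - a ^+ 4) / (b * a * ((a + b) * (a ^+ 2 + b ^+ 2))).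
    by rewrite b4 addrAC subrr add0r mul1r.
  have s0 : a + b != 0 by rewrite gt_eqF ?addr_gt0.
  have t0 : a ^+ 2 + b ^+ 2 != 0 by rewrite gt_eqF ?addr_gt0 ?exprn_gt0.
  by field; rewrite s0 t0 !gt_eqF.
suff : (a ^+ 5)^-1 <= 8 * (a^-1 - b^-1) by lra.
rewrite E -[8]invrK -invfM lef_pV2 ?posrE ?exprn_gt0 //; last first.
  by rewrite !mulr_gt0 ?addr_gt0 ?exprn_gt0 ?invr_gt0.
rewrite ler_pdivrMl //.
have -> : b * a * ((a + b) * (a ^+ 2 + b ^+ 2)) = a * (b * ((a + b) * (a ^+ 2 + b ^+ 2))) by ring.
have H1 : (a + b) * (a ^+ 2 + b ^+ 2) <= (b + b) * (b ^+ 2 + b ^+ 2).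
  apply: ler_pM; rewrite ?addr_ge0 ?exprn_ge0 ?(ltW a0) ?(ltW b0) ?lerD //.
  by rewrite expr_le // ltW.
apply: (@le_trans _ _ (a * (4 * b ^+ 4))).
  rewrite ler_wpM2l ?(ltW a0) //.
  apply: le_trans (ler_wpM2l (ltW b0) H1) _; rewrite le_eqVlt; apply/orP; left; apply/eqP; ring.
rewrite b4 (_ : 8 * a ^+ 5 = a * (8 * a ^+ 4)); last by ring.
by rewrite ler_wpM2l ?(ltW a0) //; lra.
Qed.

(* [k : Z3] stands for the mode [k.1.1 x1 + k.1.2 x2 + Om k.2 t]. *)
Definition hw k : R := `|k.1.1|%:~R + `|k.1.2|%:~R.
Definition rw k : R := hw k + `|k.2|%:~R.

(** Product weights to which the radial ones are compared: decay of order [5/2] in space and [15/4]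
    in space-time suffices for summability. *)
Definition tau2 k : R := tau `|k.1.1|%N * tau `|k.1.2|%N.
Definition tau3 k : R := tau2 k * tau `|k.2|%N.

Lemma tau2_ge0 k : 0 <= tau2 k. Proof. by rewrite mulr_ge0 ?tau_ge0. Qed.
Lemma tau3_ge0 k : 0 <= tau3 k. Proof. by rewrite mulr_ge0 ?tau2_ge0 ?tau_ge0. Qed.

Lemma bnd_tau3 : exists2 C : R, 0 <= C & bnd tau3 C.
Proof.
exists (16 * 16 * 16); first by rewrite !mulr_ge0 ?ler0n.
have b1 : bnd (fun n : int => tau `|n|%N) 16.
  by rewrite (_ : 16 = 8 + 8); [apply: bnd_int bnd_tau; exact: tau_ge0|ring].
have t0 (n : int) : 0 <= tau `|n|%N by exact: tau_ge0.
exact: bnd_prod (fun k : int * int => mulr_ge0 (t0 k.1) (t0 k.2)) t0 (bnd_prod t0 t0 b1 b1) b1.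
Qed.

Lemma hw_ge0 k : 0 <= hw k.
Proof. by rewrite addr_ge0 // ler0z. Qed.

Lemma rw_ge0 k : 0 <= rw k.
Proof. by rewrite addr_ge0 ?hw_ge0 // ler0z. Qed.

Lemma hw_le_rw k : hw k <= rw k.
Proof. by rewrite lerDl ler0z. Qed.

Lemma hw_ge1 k : hw k != 0 -> 1 <= hw k.
Proof.
rewrite /hw -intrD intr_eq0 => k0.
by rewrite (ler_int _ 1) -gtz0_ge1 lt0r k0 addr_ge0.
Qed.

Lemma hw_eq0 k : (hw k == 0) = (k.1 == 0).
Proof.
rewrite /hw paddr_eq0 ?ler0z // !intr_eq0 !normr_eq0.
by case: k => [[a b] c].
Qed.

Lemma hwN k : hw (- k) = hw k.
Proof. by rewrite /hw /= !normrN. Qed.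

Lemma rwN k : rw (- k) = rw k.
Proof. by rewrite /rw hwN /= normrN. Qed.

Lemma hwD k q : hw (k + q) <= hw k + hw q.
Proof.
rewrite /hw /= addrACA lerD // -intrD ler_int; exact: ler_normD.
Qed.

Lemma rwD k q : rw (k + q) <= rw k + rw q.
Proof.
by rewrite /rw addrACA lerD ?hwD // -intrD ler_int; exact: ler_normD.
Qed.

Lemma absz_intr (n : int) : `|n|%:~R = `|n|%N%:R :> R.
Proof. by rewrite -abszE. Qed.

(** Each [root4 (|k_i| + 1)] is at most [2 * root4 (hw k)]; the fifth powers for the two variables
    give the constant [2 ^+ 10]. *)
Lemma tau2_lb : exists2 C : R, 0 <= C &
  forall k, 1 <= hw k -> (root4 (hw k) ^+ 10)^-1 <= C * tau2 k.
Proof.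
exists (2 ^+ 10) => [|k h1]; first by rewrite exprn_ge0 ?ler0n. have h0 : 0 <= hw k by exact: hw_ge0.
have H (n : nat) : n%:R <= hw k -> root4 n.+1%:R <= 2 * root4 (hw k).
  by move=> nh; apply: root4_le2 => //; rewrite -natr1; lra.
have P n : 0 < root4 (n.+1%:R) by apply: lt_le_trans ltr01 _; rewrite root4_ge1 ?ler1n.
have z0 : 0 < root4 (hw k) by apply: lt_le_trans ltr01 _; rewrite root4_ge1.
have A1 : root4 `|k.1.1|.+1%:R <= 2 * root4 (hw k).
  by apply: H; rewrite -absz_intr lerDl ler0z.
have A2 : root4 `|k.1.2|.+1%:R <= 2 * root4 (hw k).
  by apply: H; rewrite -absz_intr lerDr ler0z.
have -> : (root4 (hw k) ^+ 10)^-1 =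
    2 ^+ 10 * (((2 * root4 (hw k)) ^+ 5)^-1 * ((2 * root4 (hw k)) ^+ 5)^-1).
  by field; rewrite gt_eqF.
have I n : root4 n.+1%:R <= 2 * root4 (hw k) -> ((2 * root4 (hw k)) ^+ 5)^-1 <= tau n.
  move=> le; have Pn := P n.
  rewrite /tau lef_pV2 ?posrE; [|by apply: exprn_gt0; lra|by apply: exprn_gt0; lra].
  by apply: expr_le => //; exact: root4_ge0.
have i0 : 0 <= ((2 * root4 (hw k)) ^+ 5)^-1 by rewrite invr_ge0 exprn_ge0 // mulr_ge0 ?root4_ge0.
rewrite /tau2; apply: ler_wpM2l; first by rewrite exprn_ge0 ?ler0n.
apply: ler_pM; [exact: i0|exact: i0|exact: I A1|exact: I A2].
Qed.

Lemma tau_lb k : 1 <= hw k -> (root4 (rw k) ^+ 5)^-1 <= tau `|k.2|.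
Proof.
move=> h1.
have P : 0 < root4 `|k.2|.+1%:R by apply: lt_le_trans ltr01 _; rewrite root4_ge1 ?ler1n.
have le : root4 `|k.2|.+1%:R <= root4 (rw k).
  by apply: root4_le; rewrite -natr1 -absz_intr /rw addrC lerD.
have R0 : 0 < root4 (rw k) by apply: lt_le_trans le.
rewrite /tau lef_pV2 ?posrE ?exprn_gt0 //.
by rewrite expr_le ?root4_ge0.
Qed.

(** The three-dimensional embedding reduces to this sum. As [hw <= rw], the decay [hw^(-2) rw^(-2)]
    is better than [hw^(-5/2) rw^(-5/4)], which separates into summable weights in space and in
    time. Modes with [hw = 0] contribute [0], the inverse of zero being zero. *)
Lemma bnd_rh : exists2 C : R, 0 <= C & bnd (fun k => ((rw k * hw k) ^+ 2)^-1) C.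
Proof.
have [A A0 HA] := tau2_lb; have [B B0 HB] := bnd_tau3.
exists (A * B); first exact: mulr_ge0.
apply: bnd_le (bndZ A0 HB) => k.
have [h0|h0] := eqVneq (hw k) 0.
  by rewrite h0 mulr0 expr0n invr0 mulr_ge0 ?tau3_ge0.
have h1 := hw_ge1 h0; have r1 : 1 <= rw k := le_trans h1 (hw_le_rw k).
apply: le_trans (_ : (root4 (hw k) ^+ 10)^-1 * (root4 (rw k) ^+ 5)^-1 <= _).
  rewrite -invfM -{1}(root4K (rw_ge0 k)) -{1}(root4K (hw_ge0 k)).
  have a1 := root4_ge1 h1; have b1 := root4_ge1 r1.
  have ab := root4_le (hw_le_rw k).
  set a := root4 (hw k) in a1 ab *; set b := root4 (rw k) in b1 ab *.
  have a0 : 0 < a by lra.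
  have b0 : 0 < b by lra.
  rewrite lef_pV2 ?posrE ?mulr_gt0 ?exprn_gt0 //.
  have -> : (b ^+ 4 * a ^+ 4) ^+ 2 = a ^+ 8 * b ^+ 5 * b ^+ 3 by ring.
  have -> : a ^+ 10 * b ^+ 5 = a ^+ 8 * b ^+ 5 * a ^+ 2 by ring.
  rewrite ler_wpM2l ?mulr_ge0 ?exprn_ge0 ?(ltW a0) ?(ltW b0) //.
  apply: (@le_trans _ _ (b ^+ 2)); first by rewrite expr_le // ltW.
  by rewrite (exprS b 2) ler_peMl // exprn_ge0 // ltW.
rewrite /tau3 mulrA; apply: ler_pM; rewrite ?invr_ge0 ?exprn_ge0 ?root4_ge0 //.
  exact: HA.
exact: tau_lb.
Qed.

(* [p] stands for [k + q] or [k - q] with [k] fixed; the exponents sum to a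
   convergent series because [11/4 > 5/2]. *)
Lemma bnd_kernel : exists2 C : R, 0 <= C & forall P : Z3 -> Z3,
  injective (fun q => ((P q).1, q.2)) ->
  bnd (fun q => ((hw (P q) * rw q ^+ 2) ^+ 2)^-1 * hw q ^+ 2) C.
Proof.
have [A A0 HA] := tau2_lb; have [B B0 HB] := bnd_tau3.
exists (A * (B + B)) => [|P PI2]; first by rewrite mulr_ge0 ?addr_ge0.
have H1 : bnd (fun q => tau3 ((P q).1, q.2)) B by exact: (bnd_inj PI2 HB).
apply: bnd_le (bndZ A0 (bndD H1 HB)) => q.
have [h0|h0] := eqVneq (hw q) 0.
  by rewrite h0 expr0n mulr0 mulr_ge0 ?addr_ge0 ?tau3_ge0.
have [p0|p0] := eqVneq (hw (P q)) 0.
  by rewrite p0 mul0r expr0n invr0 mul0r mulr_ge0 ?addr_ge0 ?tau3_ge0.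
have h1 := hw_ge1 h0; have r1 : 1 <= rw q := le_trans h1 (hw_le_rw q).
have p1 := hw_ge1 p0.
have -> : tau3 ((P q).1, q.2) = tau2 (P q) * tau `|q.2| by [].
rewrite /tau3 -mulrDl [leRHS]mulrA.
apply: le_trans (_ : ((root4 (hw (P q)) ^+ 10)^-1 + (root4 (hw q) ^+ 10)^-1)
   * (root4 (rw q) ^+ 5)^-1 <= _); last first.
  apply: ler_pM; rewrite ?addr_ge0 ?invr_ge0 ?exprn_ge0 ?root4_ge0 //.
    by rewrite mulrDr; apply: lerD; exact: HA.
  exact: tau_lb.
rewrite -{1}(root4K (rw_ge0 q)) -{1}(root4K (hw_ge0 q)) -{1}(root4K (hw_ge0 (P q))).
have a1 := root4_ge1 h1; have b1 := root4_ge1 r1; have c1 := root4_ge1 p1.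
have ab := root4_le (hw_le_rw q).
set a := root4 (hw q) in a1 ab *; set b := root4 (rw q) in b1 ab *.
set c := root4 (hw (P q)) in c1 *.
have a0 : 0 < a by lra.
have b0 : 0 < b by lra.
have c0 : 0 < c by lra.
(* In fourth roots the term is [c^-8 b^-16 a^8]. Since [a <= b], eleven powers of [b] are traded for
   powers of [a], and [b^-5] is kept for the sum over time modes. *)
have -> : ((c ^+ 4 * (b ^+ 4) ^+ 2) ^+ 2)^-1 * (a ^+ 4) ^+ 2 =
    ((c ^+ 8)^-1 * (a ^+ 3)^-1) * ((b ^+ 5)^-1 * ((a ^+ 11) / (b ^+ 11))).
  by field; rewrite !gt_eqF.
have q1 : a ^+ 11 / b ^+ 11 <= 1.
  by rewrite ler_pdivrMr ?exprn_gt0 // mul1r expr_le // ltW.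
apply: ler_pM; rewrite ?mulr_ge0 ?invr_ge0 ?exprn_ge0 ?(ltW a0) ?(ltW b0) ?(ltW c0) //; last first.
  by rewrite -[leRHS]mulr1 ler_wpM2l ?invr_ge0 ?exprn_ge0 ?(ltW b0).
have inv11 (z : R) : 1 <= z -> (z ^+ 8)^-1 * (z ^+ 3)^-1 <= (z ^+ 10)^-1.
  move=> z1; have z0 : 0 < z by lra.
  rewrite -invfM -exprD lef_pV2 ?posrE ?exprn_gt0 //.
  by rewrite (exprS z 10) ler_peMl ?exprn_ge0 ?(ltW z0).
(* The smaller of [a] and [c] takes over all eleven powers, so the term is below [c^-10] or [a^-10];
   this is why weights at [P q] and at [q] are added. *)
have [ca|/ltW ac] := leP c a.
  apply: le_trans (_ : (c ^+ 8)^-1 * (c ^+ 3)^-1 <= _).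
    rewrite ler_wpM2l ?invr_ge0 ?exprn_ge0 ?(ltW c0) //.
    by rewrite lef_pV2 ?posrE ?exprn_gt0 // expr_le ?(ltW a0) ?(ltW c0).
  by apply: le_trans (inv11 _ c1) _; rewrite lerDl invr_ge0 exprn_ge0 ?(ltW a0) ?(ltW c0).
apply: le_trans (_ : (a ^+ 8)^-1 * (a ^+ 3)^-1 <= _).
  rewrite ler_wpM2r ?invr_ge0 ?exprn_ge0 ?(ltW a0) //.
  by rewrite lef_pV2 ?posrE ?exprn_gt0 // expr_le ?(ltW a0) ?(ltW c0).
by apply: le_trans (inv11 _ a1) _; rewrite lerDr invr_ge0 exprn_ge0 ?(ltW a0) ?(ltW c0).
Qed.

End Weights.

(** * The transport term *)

Section Trilinear.
Variable R : realType.
Implicit Types (p q k : Z3) (f g y e a b w : Z3 -> R) (s t : seq Z3).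

Lemma ler_mean2 (x y : R) : x * y <= 2^-1 * (x ^+ 2 + y ^+ 2).
Proof. have := sqr_ge0 (x - y); nra. Qed.

(** Schur's test: [x y <= (x^2 + y^2) / 2] splits the form, and with either variable fixed [P k q]
    is injective in the other, so that [f] is summed at most once. *)
Lemma young_l1 (P : Z3 -> Z3 -> Z3) f F g y s t :
  (forall k, injective (P k)) -> (forall q, injective (P ^~ q)) ->
  (forall p, 0 <= f p) -> bnd f F -> uniq s -> uniq t ->
  \sum_(k <- s) \sum_(q <- t) f (P k q) * g q * y k <=
  F / 2 * (\sum_(q <- t) g q ^+ 2 + \sum_(k <- s) y k ^+ 2).
Proof.
move=> P1 P2 f0 fF us ut.
have step : \sum_(k <- s) \sum_(q <- t) f (P k q) * g q * y k <=
    2^-1 * (\sum_(k <- s) \sum_(q <- t) f (P k q) * g q ^+ 2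
          + \sum_(k <- s) \sum_(q <- t) f (P k q) * y k ^+ 2).
  rewrite -big_split /= mulr_sumr; apply: ler_sum => k _.
  rewrite -big_split /= mulr_sumr; apply: ler_sum => q _.
  rewrite -mulrA -mulrDr [leRHS]mulrCA ler_wpM2l //; exact: ler_mean2.
have A1 : \sum_(k <- s) \sum_(q <- t) f (P k q) * g q ^+ 2 <= F * \sum_(q <- t) g q ^+ 2.
  rewrite exchange_big /= mulr_sumr; apply: ler_sum => q _.
  by rewrite -mulr_suml ler_wpM2r ?sqr_ge0 //; apply: (bnd_inj (P2 q) fF).
have A2 : \sum_(k <- s) \sum_(q <- t) f (P k q) * y k ^+ 2 <= F * \sum_(k <- s) y k ^+ 2.
  rewrite mulr_sumr; apply: ler_sum => k _.
  by rewrite -mulr_suml ler_wpM2r ?sqr_ge0 //; apply: (bnd_inj (P1 k) fF).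
by move: step A1 A2; lra.
Qed.

(** The case where both weights fall on the velocity, whose coefficients [a] are then only square
    summable. Cauchy-Schwarz pairs [a * b] with kernel times [y]; the kernel is square summable in
    [q], uniformly in [k], by [bnd_kernel]. The parameter [lam] serves to make both terms
    proportional to the small radius. *)
Lemma young_l2 : exists2 C : R, 0 <= C &
  forall (P : Z3 -> Z3 -> Z3) a A b y s t (lam : R),
  (forall k, injective (fun q => ((P k q).1, q.2))) -> (forall q, injective (P ^~ q)) ->
  bnd (fun p => a p ^+ 2) A -> uniq s -> uniq t -> 0 < lam ->
  \sum_(k <- s) \sum_(q <- t)
    (a (P k q) / hw R (P k q)) * (hw R q / rw R q ^+ 2 * b q) * y k <=
  lam * A * (\sum_(q <- t) b q ^+ 2) + lam^-1 * C * (\sum_(k <- s) y k ^+ 2).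
Proof.
have [C C0 HC] := @bnd_kernel R; exists C => // P a A b y s t l P1 P2 aA us ut l0.
have step : \sum_(k <- s) \sum_(q <- t)
    (a (P k q) / hw R (P k q)) * (hw R q / rw R q ^+ 2 * b q) * y k <=
    l * (\sum_(k <- s) \sum_(q <- t) a (P k q) ^+ 2 * b q ^+ 2)
   + l^-1 * (\sum_(k <- s) \sum_(q <- t)
        (((hw R (P k q) * rw R q ^+ 2) ^+ 2)^-1 * hw R q ^+ 2) * y k ^+ 2).
  rewrite !mulr_sumr -big_split /=; apply: ler_sum => k _.
  rewrite !mulr_sumr -big_split /=; apply: ler_sum => q _.
  set u := a (P k q); set v := (hw R (P k q))^-1.
  set h := hw R q; set r := (rw R q ^+ 2)^-1.
  have -> : ((hw R (P k q) * rw R q ^+ 2) ^+ 2)^-1 = (v * r) ^+ 2.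
    by rewrite -exprVn invfM.
  have := sqr_ge0 (l * (u * b q) - (v * r * h * y k)).
  rewrite sqrrB => H.
  have : 0 <= l^-1 * ((l * (u * b q)) ^+ 2 - l * (u * b q) * (v * r * h * y k) *+ 2 + (v * r * h * y k) ^+ 2).
    by rewrite mulr_ge0 // invr_ge0 ltW.
  have -> : l^-1 * ((l * (u * b q)) ^+ 2 - l * (u * b q) * (v * r * h * y k) *+ 2 + (v * r * h * y k) ^+ 2)
    = l * (u ^+ 2 * b q ^+ 2) - 2 * (u * v * (h * r * b q) * y k)
      + l^-1 * ((v * r) ^+ 2 * h ^+ 2 * y k ^+ 2).
    by field; rewrite gt_eqF.
  have X1 : 0 <= l * (u ^+ 2 * b q ^+ 2).
    exact: mulr_ge0 (ltW l0) (mulr_ge0 (sqr_ge0 _) (sqr_ge0 _)).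
  have X2 : 0 <= l^-1 * ((v * r) ^+ 2 * h ^+ 2 * y k ^+ 2).
    by apply: mulr_ge0; [rewrite invr_ge0 ltW|rewrite -!exprMn sqr_ge0].
  lra.
apply: le_trans step _; rewrite -!mulrA; apply: lerD; apply: ler_wpM2l; rewrite ?invr_ge0 ?(ltW l0) //.
  rewrite exchange_big /= mulr_sumr; apply: ler_sum => q _.
  rewrite -mulr_suml ler_wpM2r ?sqr_ge0 //.
  exact: (bnd_inj (P2 q) aA).
rewrite mulr_sumr; apply: ler_sum => k _.
rewrite -mulr_suml ler_wpM2r ?sqr_ge0 //.
exact: HC.
Qed.

(* Dominates [\sum_(k, q) |brk psi k q * x q * y k|]: see [tri_bound]. *)
Definition tri e g y s t : R :=
  \sum_(k <- s) \sum_(q <- t) 2^-1 * (e (k + q) + e (k - q)) * g q * y k.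

Lemma tri_split e g y s t : tri e g y s t =
  2^-1 * (\sum_(k <- s) \sum_(q <- t) e (k + q) * g q * y k
        + \sum_(k <- s) \sum_(q <- t) e (k - q) * g q * y k).
Proof.
rewrite -big_split mulr_sumr /=; apply: eq_bigr => k _.
rewrite -big_split mulr_sumr /=; apply: eq_bigr => q _; ring.
Qed.

Lemma tri_l1 e F g y s t : (forall p, 0 <= e p) -> bnd e F -> uniq s -> uniq t ->
  tri e g y s t <= F / 2 * (\sum_(q <- t) g q ^+ 2 + \sum_(k <- s) y k ^+ 2).
Proof.
move=> e0 eF us ut; rewrite tri_split.
have H1 := @young_l1 (fun k q => k + q) e F g y s t (@addrI _) (@addIr _) e0 eF us ut.
have sI (k : Z3) : injective (fun q : Z3 => k - q).
  by move=> q q' /addrI /oppr_inj.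
have H2 := @young_l1 (fun k q => k - q) e F g y s t sI (fun q => @addIr _ (- q)) e0 eF us ut.
by rewrite ler_pdivrMl ?ltr0n // mulr_natl mulr2n; exact: lerD H1 H2.
Qed.

(** Dividing [e p * hw p] by [hw p] gives back [e p] only if [e] vanishes together with [hw], as
    [x / 0 = 0]; hence the first hypothesis. *)
Lemma tri_l2 : exists2 C : R, 0 <= C &
  forall e A b y s t (lam : R),
  (forall p, hw R p = 0 -> e p = 0) ->
  bnd (fun p => (e p * hw R p) ^+ 2) A -> uniq s -> uniq t -> 0 < lam ->
  tri e (fun q => hw R q / rw R q ^+ 2 * b q) y s t <=
  lam * A * (\sum_(q <- t) b q ^+ 2) + lam^-1 * C * (\sum_(k <- s) y k ^+ 2).
Proof.
have [C C0 HC] := young_l2; exists C => // e A b y s t l e0 eA us ut l0.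
have E p : e p = e p * hw R p / hw R p.
  by have [/[dup] /e0 -> ->|h0] := eqVneq (hw R p) 0; rewrite ?mulr0 ?mul0r ?mulfK.
have I1 (k : Z3) : injective (fun q : Z3 => ((k + q).1, q.2)).
  by move=> [q1 q2] [q1' q2'] /= [] /addrI a1 /addrI a2 ->; congr (_, _); case: q1 q1' a1 a2 => [? ?] [? ?] /= -> ->.
have I2 (k : Z3) : injective (fun q : Z3 => ((k - q).1, q.2)).
  by move=> [q1 q2] [q1' q2'] /= [] /addrI /oppr_inj a1 /addrI /oppr_inj a2 ->; congr (_, _); case: q1 q1' a1 a2 => [? ?] [? ?] /= -> ->.
have H1 := HC (fun k q => k + q) (fun p => e p * hw R p) A b y s t l I1 (@addIr _) eA us ut l0.
have H2 := HC (fun k q => k - q) (fun p => e p * hw R p) A b y s t l I2 (fun q => @addIr _ (- q)) eA us ut l0.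
rewrite tri_split.
have E1 : \sum_(k <- s) \sum_(q <- t) e (k + q) * (hw R q / rw R q ^+ 2 * b q) * y k =
  \sum_(k <- s) \sum_(q <- t) e (k + q) * hw R (k + q) / hw R (k + q) * (hw R q / rw R q ^+ 2 * b q) * y k.
  by apply: eq_bigr => k _; apply: eq_bigr => q _; rewrite {1}E.
have E2 : \sum_(k <- s) \sum_(q <- t) e (k - q) * (hw R q / rw R q ^+ 2 * b q) * y k =
  \sum_(k <- s) \sum_(q <- t) e (k - q) * hw R (k - q) / hw R (k - q) * (hw R q / rw R q ^+ 2 * b q) * y k.
  by apply: eq_bigr => k _; apply: eq_bigr => q _; rewrite {1}E.
rewrite E1 E2.
by rewrite ler_pdivrMl ?ltr0n // mulr_natl mulr2n; exact: lerD H1 H2.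
Qed.

Definition wedge p q : R := (p.1.1 * q.1.2 - p.1.2 * q.1.1)%:~R.

Lemma wedgeC p q : wedge p q = - wedge q p.
Proof. by rewrite /wedge -mulrNz; congr (_ %:~R); ring. Qed.

Lemma wedge_le p q : `|wedge p q| <= hw R p * hw R q.
Proof.
rewrite /wedge /hw -intr_norm -!intrD -intrM ler_int.
apply: le_trans (ler_normB _ _) _; rewrite !normrM.
have := normr_ge0 p.1.1; have := normr_ge0 p.1.2; have := normr_ge0 q.1.1; have := normr_ge0 q.1.2.
nia.
Qed.

(** The wedge with [q] sees [k] only modulo [q]. The factor of [k] can therefore be charged to the
    frequency [k + q] or [k - q] at which the stream function is evaluated. *)
Lemma wedgeDl k q : wedge (k + q) q = wedge k q.
Proof. by rewrite /wedge; congr (_ %:~R) => /=; ring. Qed.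

Lemma wedgeBl k q : wedge (k - q) q = wedge k q.
Proof. by rewrite /wedge; congr (_ %:~R) => /=; ring. Qed.

(* Matrix of [w |-> dpsi/dx1 * dw/dx2 - dpsi/dx2 * dw/dx1] in the basis
   [cos (k.z) + sin (k.z)] of the trigonometric polynomials. *)
Definition brk (psi : Z3 -> R) k q : R :=
  2^-1 * wedge k q * (psi (k + q) - psi (- (k + q)) - psi (q - k) - psi (k - q)).

(** The factor [wedge] is antisymmetric and the bracket symmetric, for every [psi]: a velocity
    derived from a stream function is divergence free. *)
Lemma brk_skew psi k q : brk psi k q = - brk psi q k.
Proof.
rewrite /brk wedgeC [q + k]addrC mulrN mulNr; congr (- (_ * _)); ring.
Qed.

(** Size of the velocity at the frequencies [p] and [- p] together, which products in the real basis
    always mix. *)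
Definition amp (psi : Z3 -> R) p : R := hw R p * (`|psi p| + `|psi (- p)|).

Lemma amp_ge0 psi p : 0 <= amp psi p.
Proof. by rewrite mulr_ge0 ?hw_ge0 ?addr_ge0. Qed.

Lemma brk_le psi k q :
  `|brk psi k q| <= 2^-1 * (amp psi (k + q) + amp psi (k - q)) * hw R q.
Proof.
rewrite /brk !normrM ger0_norm ?invr_ge0 ?ler0n // -!mulrA ler_wpM2l ?invr_ge0 ?ler0n //.
have W1 := wedge_le (k + q) q; have W2 := wedge_le (k - q) q.
rewrite wedgeDl in W1; rewrite wedgeBl in W2.
apply: le_trans (_ : `|wedge k q| * (`|psi (k + q)| + `|psi (- (k + q))|) +
  `|wedge k q| * (`|psi (k - q)| + `|psi (- (k - q))|) <= _).
  rewrite -mulrDr ler_wpM2l // opprB.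
  apply: le_trans (ler_normB _ _) _; rewrite [leRHS]addrA [leRHS]addrAC lerD2r.
  apply: le_trans (ler_normB _ _) _; rewrite lerD2r.
  exact: ler_normB.
rewrite mulrDl /amp; apply: lerD.
  by rewrite mulrAC ler_wpM2r ?addr_ge0.
by rewrite mulrAC ler_wpM2r ?addr_ge0.
Qed.

Definition ksq k : R := (k.1.1 ^+ 2 + k.1.2 ^+ 2)%:~R.

Lemma hw_ksq k : hw R k ^+ 2 <= 2 * ksq k.
Proof.
rewrite /hw /ksq -intrD -[2]/(2%:~R) -intrM -[_ ^+ 2]intrM ler_int.
have -> : k.1.1 ^+ 2 = `|k.1.1| ^+ 2 by rewrite real_normK ?num_real.
have -> : k.1.2 ^+ 2 = `|k.1.2| ^+ 2 by rewrite real_normK ?num_real.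
have := sqr_ge0 (`|k.1.1| - `|k.1.2|); rewrite !expr2; nia.
Qed.

Lemma ksq_hw k : ksq k <= hw R k ^+ 2.
Proof.
rewrite /hw /ksq -intrD -[leRHS]intrM ler_int.
have -> : k.1.1 ^+ 2 = `|k.1.1| ^+ 2 by rewrite real_normK ?num_real.
have -> : k.1.2 ^+ 2 = `|k.1.2| ^+ 2 by rewrite real_normK ?num_real.
have := mulr_ge0 (normr_ge0 k.1.1) (normr_ge0 k.1.2); rewrite !expr2; nia.
Qed.

Lemma ksq_ge0 k : 0 <= ksq k.
Proof. by rewrite ler0z addr_ge0 ?sqr_ge0. Qed.

Lemma ksqN k : ksq (- k) = ksq k.
Proof. by rewrite /ksq /= !sqrrN. Qed.

Lemma ksq_gt0 k : hw R k != 0 -> 0 < ksq k.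
Proof. by move=> /hw_ge1 h1; have := hw_ksq k; nra. Qed.

Lemma ksq_ge1 k : hw R k != 0 -> 1 <= ksq k.
Proof. by move=> /ksq_gt0; rewrite ltr0z gtz0_ge1 -(ler_int R). Qed.

(** Inverse Laplacian on coefficients; division by zero makes it vanish where [k] has no spatial
    part. *)
Definition stream w k : R := - w k / ksq k.

Lemma amp_stream w p : amp (stream w) p * hw R p <= 2 * (`|w p| + `|w (- p)|).
Proof.
have [h0|h0] := eqVneq (hw R p) 0.
  by rewrite h0 mulr0 mulr_ge0 ?addr_ge0 ?ler0n.
have k0 := ksq_gt0 h0.
rewrite /amp /stream ksqN !normrM !normrN !normfV (gtr0_norm k0) -mulrDl.
rewrite mulrAC -expr2 mulrA ler_pdivrMr //.
by rewrite [leRHS]mulrAC ler_wpM2r ?addr_ge0 // hw_ksq.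
Qed.

Lemma amp0 psi p : hw R p = 0 -> amp psi p = 0.
Proof. by rewrite /amp => ->; rewrite mul0r. Qed.

Lemma sqrD2_le (x y : R) : (x + y) ^+ 2 <= 2 * (x ^+ 2 + y ^+ 2).
Proof. have := sqr_ge0 (x - y); nra. Qed.

Lemma bnd_sym f F : bnd f F -> bnd (fun p => f p + f (- p)) (F + F).
Proof. by move=> fF; apply: bndD => //; exact: (bnd_inj (@oppr_inj _) fF). Qed.

Lemma amp_l2 w X : bnd (fun p => w p ^+ 2) X ->
  bnd (fun p => (amp (stream w) p * hw R p) ^+ 2) (16 * X).
Proof.
move=> wX; have -> : 16 * X = 8 * (X + X) by ring.
apply: bnd_le (bndZ _ (bnd_sym wX)) => // p.
apply: le_trans (_ : (2 * (`|w p| + `|w (- p)|)) ^+ 2 <= _).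
  by rewrite expr_le ?amp_stream ?mulr_ge0 ?amp_ge0 ?hw_ge0.
rewrite exprMn; have := sqrD2_le `|w p| `|w (- p)|.
rewrite !real_normK ?num_real //; lra.
Qed.

Lemma amp_l2w w X : bnd (fun p => (rw R p ^+ 2 * w p) ^+ 2) X ->
  bnd (fun p => (amp (stream w) p * rw R p ^+ 2 * hw R p) ^+ 2) (16 * X).
Proof.
move=> wX; have -> : 16 * X = 8 * (X + X) by ring.
apply: bnd_le (bndZ _ (bnd_sym wX)) => // p.
apply: le_trans (_ : (2 * (`|w p| + `|w (- p)|) * rw R p ^+ 2) ^+ 2 <= _).
  rewrite expr_le ?mulr_ge0 ?amp_ge0 ?hw_ge0 ?rw_ge0 //.
  by rewrite mulrAC ler_wpM2r ?sqr_ge0 // amp_stream.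
rewrite rwN !exprMn; have := sqrD2_le `|w p| `|w (- p)|.
rewrite !real_normK ?num_real // => H.
have := ler_wpM2r (sqr_ge0 (rw R p ^+ 2)) H; lra.
Qed.

(** Sobolev embedding by Cauchy-Schwarz: [rw |w| / hw = (rw^2 |w|) (rw hw)^-1] with the last factor
    square summable. Up to constants the left side dominates the coefficients of the velocity, of
    its spatial gradient and of its time derivative divided by [Om]. *)
Lemma l1_of_l2w : exists2 C : R, 0 <= C & forall w (c : R), 0 < c ->
  bnd (fun p => (rw R p ^+ 2 * w p) ^+ 2) (c ^+ 2) ->
  bnd (fun p => rw R p * (`|w p| / hw R p)) (c * C).
Proof.
have [C C0 HC] := @bnd_rh R.
exists (2^-1 * (1 + C)) => [|w c c0 wc]; first by rewrite mulr_ge0 ?addr_ge0 ?ler0n ?invr_ge0.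
have H p : rw R p * (`|w p| / hw R p) = (rw R p ^+ 2 * `|w p|) * ((rw R p * hw R p)^-1).
  have [->|r0] := eqVneq (rw R p) 0; first by rewrite expr0n !mul0r.
  by rewrite invfM; set h := (hw R p)^-1; field.
have cp : c != 0 by rewrite gt_eqF.
(* The mean inequality is scaled by [c], which makes the bound linear in [c]. *)
have -> : c * (2^-1 * (1 + C)) = (2 * c)^-1 * c ^+ 2 + (c / 2) * C by field; rewrite cp.
apply: bnd_le (bndD (bndZ _ wc) (bndZ _ HC)) => [p||];
  rewrite ?invr_ge0 ?divr_ge0 ?mulr_ge0 ?ler0n ?(ltW c0) //.
rewrite H -[in leRHS]exprVn.
set x := rw R p ^+ 2 * `|w p|; set z := (_ * _)^-1.
have -> : (rw R p ^+ 2 * w p) ^+ 2 = x ^+ 2.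
  by rewrite /x !exprMn real_normK ?num_real.
have := sqr_ge0 (x - c * z); rewrite -[in X in _ -> X]subr_ge0.
have -> : (2 * c)^-1 * x ^+ 2 + c / 2 * z ^+ 2 - x * z = (2 * c)^-1 * ((x - c * z) ^+ 2).
  by field; rewrite cp.
by move=> ?; rewrite mulr_ge0 // invr_ge0 mulr_ge0 ?ler0n ?(ltW c0).
Qed.

Lemma amp_l1 : exists2 C : R, 0 <= C & forall w (c : R), 0 < c ->
  bnd (fun p => (rw R p ^+ 2 * w p) ^+ 2) (c ^+ 2) ->
  bnd (fun p => amp (stream w) p * rw R p) (c * C).
Proof.
have [C C0 HC] := l1_of_l2w; exists (2 * (C + C)) => [|w c c0 wc].
  by rewrite mulr_ge0 ?addr_ge0 ?ler0n.
have -> : c * (2 * (C + C)) = 2 * (c * C + c * C) by ring.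
apply: bnd_le (bndZ _ (bnd_sym (HC w c c0 wc))) => [p|]; rewrite ?ler0n // rwN hwN.
have [h0|h0] := eqVneq (hw R p) 0.
  by rewrite (amp0 _ h0) h0 invr0 !mulr0 mul0r addr0 mulr0.
have hp : 0 < hw R p by rewrite lt0r h0 hw_ge0.
have := amp_stream w p; rewrite -ler_pdivlMr // => /(ler_wpM2r (rw_ge0 R p)) /le_trans; apply.
rewrite le_eqVlt; apply/orP; left; apply/eqP; field; exact: h0.
Qed.

End Trilinear.

(** * Finite symmetric sets of modes *)

Section Boxes.

Definition range (N : nat) : seq int := [seq i%:Z - N%:Z | i <- iota 0 (N + N).+1].

Lemma mem_range N (n : int) : (n \in range N) = (`|n| <= N)%N.
Proof.
apply/mapP/idP => [[j]|nN].
  by rewrite mem_iota => iN ->; lia.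
by exists (absz (n + N%:Z)); [rewrite mem_iota; lia|lia].
Qed.

Lemma range_uniq N : uniq (range N).
Proof. by rewrite map_inj_uniq ?iota_uniq // => i j; lia. Qed.

Definition box2 N : seq (int * int) := [seq (a, b) | a <- range N, b <- range N].
Definition box3 N : seq Z3 := [seq (a, b) | a <- box2 N, b <- range N].
(** Modes constant in space are left out: the vorticity has no such component, and the damping there
    is only [al], which may be zero. *)
Definition modes N : seq Z3 := [seq k <- box3 N | k.1 != 0].

Lemma mem_box2 N (k : int * int) : (k \in box2 N) = (`|k.1| <= N)%N && (`|k.2| <= N)%N.
Proof.
rewrite -!mem_range; apply/allpairsP/andP => [[[a b] /= [aN bN ->]] //|[]].
by case: k => a b; exists (a, b).
Qed.

Lemma mem_box3 N (k : Z3) :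
  (k \in box3 N) = [&& (`|k.1.1| <= N)%N, (`|k.1.2| <= N)%N & (`|k.2| <= N)%N].
Proof.
rewrite andbA -mem_box2 -mem_range; apply/allpairsP/andP => [[[a b] /= [aN bN ->]] //|[]].
by case: k => a b; exists (a, b).
Qed.

Lemma box2_uniq N : uniq (box2 N).
Proof. by apply: allpairs_uniq; rewrite ?range_uniq // => -[? ?] [? ?]. Qed.

Lemma box3_uniq N : uniq (box3 N).
Proof. by apply: allpairs_uniq; rewrite ?range_uniq ?box2_uniq // => -[? ?] [? ?]. Qed.

Lemma modes_uniq N : uniq (modes N).
Proof. by rewrite filter_uniq ?box3_uniq. Qed.

Lemma box3N N k : (- k \in box3 N) = (k \in box3 N).
Proof. by rewrite !mem_box3 /= !abszN. Qed.

Lemma modesN N k : (- k \in modes N) = (k \in modes N).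
Proof. by rewrite !mem_filter box3N /= oppr_eq0. Qed.

Lemma box3_sub N M : (N <= M)%N -> {subset box3 N <= box3 M}.
Proof. by move=> NM k; rewrite !mem_box3 => /and3P[]; lia. Qed.

Lemma modes_sub N M : (N <= M)%N -> {subset modes N <= modes M}.
Proof. by move=> NM k; rewrite !mem_filter => /andP[-> /(box3_sub NM) ->]. Qed.

End Boxes.

(** * Galerkin approximations *)

Section Galerkin.
Variable R : realType.
Implicit Types (p q k : Z3) (f g y e a b w rho psi : Z3 -> R) (s t : seq Z3).

Lemma sum_modesN N f : \sum_(k <- modes N) f (- k) = \sum_(k <- modes N) f k.
Proof.
rewrite -(big_map -%R predT f); apply: perm_big; apply: uniq_perm.
- by rewrite map_inj_uniq ?modes_uniq //; exact: oppr_inj.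
- exact: modes_uniq.
by move=> k; rewrite -{1}(opprK k) mem_map ?modesN //; exact: oppr_inj.
Qed.

Lemma modes_hw N k : k \in modes N -> hw R k != 0.
Proof. by rewrite mem_filter hw_eq0 => /andP[]. Qed.

Lemma notin_modes N k : hw R k != 0 -> k \notin modes N -> N%:R < rw R k.
Proof.
rewrite hw_eq0 mem_filter => -> /=; rewrite mem_box3 /rw /hw.
rewrite -!intrD -[N%:R]/(N%:~R) ltr_int !negb_and => H.
have : (N : int) < `|k.1.1| + `|k.1.2| + `|k.2| by move: H => /or3P[]; lia.
exact.
Qed.

(** A square system with trivial kernel is solvable. [A] is the transpose of [K], since it acts on
    row vectors. *)
Lemma lin_solve (T : eqType) (s : seq T) (K : T -> T -> R) (F : T -> R) : uniq s ->
  (forall x : T -> R, (forall k : T, k \in s -> \sum_(q <- s) K k q * x q = 0) ->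
    forall k : T, k \in s -> x k = 0) ->
  exists x : T -> R, (forall k : T, k \notin s -> x k = 0) /\
    forall k : T, k \in s -> \sum_(q <- s) K k q * x q = F k.
Proof.
move=> us inj; pose t := in_tuple s; pose n := size s.
pose A : 'M[R]_n := \matrix_(i, j) K (tnth t j) (tnth t i).
pose ext (u : 'rV[R]_n) (q : T) := \sum_i (tnth t i == q)%:R * u 0 i.
have extE u i : ext u (tnth t i) = u 0 i.
  rewrite /ext (bigD1 i) //= eqxx mul1r big1 ?addr0 // => j ji.
  by rewrite (inj_eq (elimT (tuple_uniqP t) us)) (negPf ji) mul0r.
have extS u (k : T) : \sum_(q <- s) K k q * ext u q = \sum_i K k (tnth t i) * u 0 i.
  rewrite -[s in LHS]/(tval t) big_tnth.
  by apply: eq_bigr => i _; rewrite extE.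
have Ainv : A \in unitmx.
  rewrite -row_free_unit; apply: inj_row_free => u uA.
  apply/rowP => i; rewrite mxE -extE; apply: (inj (ext u)) => [k|]; last exact: mem_tnth.
  move=> /(tnthP t)[j ->]; rewrite extS.
  have /rowP/(_ j) := uA; rewrite !mxE => E; rewrite -[RHS]E; apply: eq_bigr => i' _.
  by rewrite !mxE mulrC.
pose u := (\row_j F (tnth t j)) *m invmx A.
exists (ext u); split=> [k ks|k].
  rewrite /ext big1 // => i _; case: eqP => [tk|]; last by rewrite mul0r.
  by rewrite -tk mem_tnth in ks.
move=> /(tnthP t)[j ->]; rewrite extS.
have : u *m A = \row_j F (tnth t j) by rewrite /u mulmxKV.
move=> /rowP/(_ j); rewrite !mxE => E; rewrite -[RHS]E; apply: eq_bigr => i _.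
by rewrite !mxE mulrC.
Qed.

Variables (al eps Om : R).
Hypotheses (al0 : 0 <= al) (eps0 : 0 <= eps) (nu0 : 0 < al + eps).
Local Notation nu := (al + eps).

Definition damp k : R := al + eps * ksq R k.

(** The Laplacian on this torus has spectral gap [1] on functions of mean zero, [ksq] being a
    nonzero integer; the constant [a = 1] of the theorem originates here. *)
Lemma damp_ge k : hw R k != 0 -> nu <= damp k.
Proof. by move=> /(@ksq_ge1 R) k1; rewrite /damp lerD2l ler_peMr. Qed.

Lemma damp_ge0 k : 0 <= damp k.
Proof. by rewrite addr_ge0 ?mulr_ge0 ?ksq_ge0. Qed.

(* [d_t w + u.grad w + al w - eps Lap w] on the coefficients, [u] having stream function [psi]. *)
Definition lop N psi w k : R :=
  - Om * k.2%:~R * w (- k) + damp k * w k + \sum_(q <- modes N) brk psi k q * w q.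

(** The reflection [k |-> - k] exchanges the two factors and reverses the time frequency. Any even
    weight [c] may be inserted, in particular powers of [rw]. *)
Lemma skew_time N w (c : Z3 -> R) : (forall k, c (- k) = c k) ->
  \sum_(k <- modes N) c k * w k * (- Om * k.2%:~R * w (- k)) = 0.
Proof.
move=> ce; set S := LHS.
suff : S = - S by move=> ?; lra.
rewrite {1}/S -sum_modesN /S -sumrN; apply: eq_bigr => k _.
by rewrite ce opprK /= mulrNz; ring.
Qed.

Lemma skew_brk s psi w : \sum_(k <- s) \sum_(q <- s) w k * brk psi k q * w q = 0.
Proof.
set S := LHS; suff : S = - S by move=> ?; lra.
rewrite {1}/S exchange_big /S -sumrN; apply: eq_bigr => k _.
rewrite -sumrN; apply: eq_bigr => q _.
by rewrite brk_skew; ring.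
Qed.

Lemma energy N psi w : \sum_(k <- modes N) w k * lop N psi w k =
  \sum_(k <- modes N) damp k * w k ^+ 2.
Proof.
have E : \sum_(k <- modes N) w k * lop N psi w k =
  \sum_(k <- modes N) 1 * w k * (- Om * k.2%:~R * w (- k)) +
  (\sum_(k <- modes N) damp k * w k ^+ 2 +
   \sum_(k <- modes N) \sum_(q <- modes N) w k * brk psi k q * w q).
  rewrite -!big_split /=; apply: eq_bigr => k _.
  under [in RHS]eq_bigr do rewrite -mulrA.
  by rewrite -mulr_sumr /lop; ring.
by rewrite E skew_brk (@skew_time N w (fun=> 1)) // add0r addr0.
Qed.

Lemma sum_pos_eq0 (T : eqType) (s : seq T) (F : T -> R) :
  (forall x, x \in s -> 0 <= F x) -> \sum_(x <- s) F x = 0 -> forall x, x \in s -> F x = 0.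
Proof.
move=> F0 /eqP; rewrite big_seq psumr_eq0 // => /allP H x xs.
by have := H x xs; rewrite xs /= => /eqP.
Qed.

(** By [energy] a solution of the homogeneous system has a vanishing damping sum, so the kernel is
    trivial for every [psi], however large. *)
Lemma galerkin_solve N psi rho : exists w, (forall k, k \notin modes N -> w k = 0) /\
  forall k, k \in modes N -> lop N psi w k = rho k.
Proof.
pose K k q : R := - Om * k.2%:~R * (q == - k)%:R + damp k * (q == k)%:R + brk psi k q.
have KE x k : k \in modes N -> \sum_(q <- modes N) K k q * x q = lop N psi x k.
  move=> kN; rewrite /lop /K.
  under eq_bigr do rewrite mulrDl.
  rewrite big_split /=; congr (_ + _).
  under eq_bigr do rewrite mulrDl.
  rewrite big_split /=; congr (_ + _).
    rewrite (bigD1_seq (- k)) ?modes_uniq ?modesN //= eqxx mulr1 big1 ?addr0 // => q qk.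
    by rewrite (negPf qk) mulr0 mul0r.
  rewrite (bigD1_seq k) ?modes_uniq //= eqxx mulr1 big1 ?addr0 // => q qk.
  by rewrite (negPf qk) mulr0 mul0r.
have [|x [x0 xE]] := @lin_solve _ (modes N) K rho (modes_uniq N).
  move=> x x0 k kN.
  have : \sum_(k <- modes N) damp k * x k ^+ 2 = 0.
    by rewrite -(energy N psi) big_seq big1 // => q qN; rewrite -KE // x0 // mulr0.
  move=> /sum_pos_eq0 H.
  have /eqP : damp k * x k ^+ 2 = 0 by apply: H => // q _; rewrite mulr_ge0 ?damp_ge0 ?sqr_ge0.
  rewrite mulf_eq0 sqrf_eq0 => /orP[|/eqP //].
  by rewrite gt_eqF // (lt_le_trans nu0) // damp_ge // (modes_hw kN).
by exists x; split=> // k kN; rewrite -KE // xE.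
Qed.

End Galerkin.

(** * The weighted a priori bound for one Galerkin step *)

Section Estimates.
Variable R : realType.
Implicit Types (p q k : Z3) (f g y e a b w rho psi x : Z3 -> R) (s t : seq Z3).

Lemma sqr_diff_le (x y u : R) : 0 <= x -> 0 <= y -> `|x - y| <= u ->
  `|x ^+ 2 - y ^+ 2| <= u ^+ 2 + 2 * u * y.
Proof.
move=> x0 y0; rewrite ler_norml => /andP[H1 H2].
have u0 : 0 <= u by lra.
rewrite ler_norml; apply/andP; split; last first.
  have : 0 <= (y + u - x) * (y + u + x) by apply: mulr_ge0; lra.
  by rewrite !expr2; lra.
have : 0 <= (u - (y - x)) * (y + x) by apply: mulr_ge0; lra.
have : 0 <= (y + u - x) * u by apply: mulr_ge0; lra.
by rewrite !expr2; lra.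
Qed.

Lemma rwD_diff k q : `|rw R k - rw R q| <= rw R (k + q).
Proof.
rewrite ler_norml; apply/andP; split.
  have := rwD R (k + q) (- k); rewrite addrAC subrr add0r rwN; lra.
by have := rwD R (k + q) (- q); rewrite addrK rwN; lra.
Qed.

Lemma rwB_diff k q : `|rw R k - rw R q| <= rw R (k - q).
Proof. by have := rwD_diff k (- q); rewrite rwN. Qed.

(** [c k q] is the multiplier that a weight or a commutator puts on the transport term. It is split
    into two products, a factor at the frequency of the velocity times a factor at [q], one product
    for each way of distributing the weight. *)
Lemma tri_bound psi (c : Z3 -> Z3 -> R) e1 g1 e2 g2 x y s t :
  (forall k q, amp psi (k + q) * (hw R q * `|c k q| * `|x q|) <=
               e1 (k + q) * g1 q + e2 (k + q) * g2 q) ->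
  (forall k q, amp psi (k - q) * (hw R q * `|c k q| * `|x q|) <=
               e1 (k - q) * g1 q + e2 (k - q) * g2 q) ->
  `|\sum_(k <- s) \sum_(q <- t) y k * brk psi k q * c k q * x q| <=
    tri e1 g1 (fun k => `|y k|) s t + tri e2 g2 (fun k => `|y k|) s t.
Proof.
move=> H1 H2; rewrite /tri -big_split /=.
apply: le_trans (ler_norm_sum _ _ _) _; apply: ler_sum => k _.
rewrite -big_split /=; apply: le_trans (ler_norm_sum _ _ _) _; apply: ler_sum => q _.
rewrite 3!normrM.
have B := brk_le psi k q.
apply: le_trans (_ : `|y k| * ((2^-1 * (amp psi (k + q) + amp psi (k - q)) * hw R q) * (`|c k q| * `|x q|)) <= _).
  rewrite [leLHS](_ : _ = `|y k| * (`|brk psi k q| * (`|c k q| * `|x q|))); last by ring.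
  by rewrite ler_wpM2l // ler_wpM2r // mulr_ge0.
rewrite [leRHS](_ : _ = `|y k| * (2^-1 * ((e1 (k + q) * g1 q + e2 (k + q) * g2 q)
   + (e1 (k - q) * g1 q + e2 (k - q) * g2 q)))); last by ring.
rewrite ler_wpM2l //.
by have := H1 k q; have := H2 k q; lra.
Qed.

Lemma rw_ge1 k : hw R k != 0 -> 1 <= rw R k.
Proof. by move=> /hw_ge1 /le_trans; apply; exact: hw_le_rw. Qed.

(** Energy estimate for [eta = w' - w0] with the weight [rw^4]. The conclusion keeps [damp] and not
    only its lower bound: for [eps > 0] its part [eps * ksq] provides the derivative that the
    viscous term needs in the limit. The right-hand side contains [g0] and not [r0], which lets a
    ball of radius [r0] be invariant once [g0] is small compared with [r0]. *)
Lemma step_bound : exists2 D : R, 1 <= D &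
  forall (al eps Om : R) rho w0 (r0 g0 : R) N w w',
  0 <= al -> 0 <= eps -> 0 < al + eps -> 0 < r0 -> r0 * D <= al + eps ->
  bnd (fun p => (rw R p ^+ 2 * w p) ^+ 2) (r0 ^+ 2) ->
  (forall k, hw R k = 0 -> w0 k = 0) ->
  (forall k, - Om * k.2%:~R * w0 (- k) = rho k) ->
  bnd (fun p => (hw R p * (rw R p ^+ 2 * w0 p)) ^+ 2) (g0 ^+ 2) ->
  (forall k, k \notin modes N -> w' k = 0) ->
  (forall k, k \in modes N -> lop al eps Om N (stream w) w' k = rho k) ->
  bnd (fun p => damp al eps p * (rw R p ^+ 2 * w' p) ^+ 2) (6 * (al + eps) * g0 ^+ 2).
Proof.
have [C1 C10 HC1] := @amp_l1 R; have [C2 C20 HC2] := @tri_l2 R.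
(* The bounds of [Comm] and [Src] below add up to [r0] times the large bracket; the factor [8] makes
   this at most an eighth of the damping. *)
pose D : R := 8 * (16 + C2 + 5 * C1 + (64 + C2 + 2 * C1)) + 1.
exists D => [|al eps Om rho w0 r0 g0 N w w' al0 eps0 nu0 r00 rD wr w00 w0E w0g w'0 w'E].
  by rewrite /D; lra.
pose V := modes N; have uV : uniq V := modes_uniq N.
pose eta k := w' k - (if k \in V then w0 k else 0).
pose W k := rw R k ^+ 2; have W0 k : 0 <= W k by exact: sqr_ge0.
pose e := amp (stream w); have e0 p : 0 <= e p by exact: amp_ge0.
have r_0 p : 0 <= rw R p by exact: rw_ge0.
pose E2 := \sum_(k <- V) (W k * eta k) ^+ 2.
pose Q := \sum_(k <- V) damp al eps k * (W k * eta k) ^+ 2.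
have nuE : (al + eps) * E2 <= Q.
  rewrite /E2 /Q mulr_sumr !big_seq; apply: ler_sum => k kV.
  by rewrite ler_wpM2r ?sqr_ge0 // damp_ge // (modes_hw R kV).
have E20 : 0 <= E2 by apply: sumr_ge0 => k _; exact: sqr_ge0.
pose G2 := \sum_(k <- V) (hw R k * (W k * w0 k)) ^+ 2.
have G2g : G2 <= g0 ^+ 2 by exact: w0g.
have W0w : \sum_(k <- V) (W k * w0 k) ^+ 2 <= g0 ^+ 2.
  apply: le_trans G2g; apply: ler_sum => k _.
  have [h0|h0] := eqVneq (hw R k) 0; first by rewrite w00 // !mulr0.
  rewrite [leRHS]exprMn ler_peMl ?sqr_ge0 //.
  by rewrite exprn_ege1 // hw_ge1.
have Q0 : \sum_(k <- V) damp al eps k * (W k * w0 k) ^+ 2 <= (al + eps) * g0 ^+ 2.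
  apply: le_trans (ler_wpM2l (ltW nu0) G2g).
  rewrite /G2 mulr_sumr; apply: ler_sum => k _.
  have [h0|h0] := eqVneq (hw R k) 0; first by rewrite w00 // !mulr0 expr0n !mulr0.
  rewrite [in leRHS]exprMn [leRHS]mulrA ler_wpM2r ?sqr_ge0 // /damp mulrDl.
  have h1 : 1 <= hw R k ^+ 2 by rewrite exprn_ege1 // hw_ge1.
  by apply: lerD; [rewrite ler_peMr|rewrite ler_wpM2l // ksq_hw].
have etaN k : k \in V -> eta (- k) = w' (- k) - w0 (- k).
  by move=> kV; rewrite /eta /V modesN -/V kV.
(* [d_t w0] cancels [rho]: what remains of the source contains [w0] without any factor [Om]. *)
have eq1 k : k \in V -> lop al eps Om N (stream w) eta k =
    - (\sum_(q <- V) brk (stream w) k q * w0 q) - damp al eps k * w0 k.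
  move=> kV; have := w'E k kV; rewrite /lop etaN // -[eta k]/(w' k - _) kV -w0E.
  have -> : \sum_(q <- modes N) brk (stream w) k q * eta q =
    \sum_(q <- modes N) brk (stream w) k q * w' q - \sum_(q <- V) brk (stream w) k q * w0 q.
    rewrite -sumrB !big_seq; apply: eq_bigr => q qV.
    by rewrite /eta qV mulrBr.
  lra.
(* The test function is [W^2 * eta]. One factor [W] is moved past the transport operator; the part
   where both arguments carry [W] is skew, and the commutator with [W k - W q] is left. *)
pose Comm := \sum_(k <- V) \sum_(q <- V) (W k * eta k) * brk (stream w) k q * (W k - W q) * eta q.
pose Src := \sum_(k <- V) \sum_(q <- V) (W k * eta k) * brk (stream w) k q * W k * w0 q.
pose Dmp := \sum_(k <- V) W k ^+ 2 * eta k * (damp al eps k * w0 k).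
have main : Q + Comm = - Src - Dmp.
  have T0 : \sum_(k <- V) W k ^+ 2 * eta k * (- Om * k.2%:~R * eta (- k)) = 0.
    by apply: (@skew_time R Om N eta (fun k => W k ^+ 2)) => k; rewrite /W rwN.
  have S0 := @skew_brk R V (stream w) (fun k => W k * eta k).
  have L : \sum_(k <- V) W k ^+ 2 * eta k * lop al eps Om N (stream w) eta k = - Src - Dmp.
    rewrite /Src /Dmp -sumrN -sumrB big_seq [RHS]big_seq; apply: eq_bigr => k kV.
    rewrite eq1 // (_ : \sum_(q <- V) W k * eta k * brk (stream w) k q * W k * w0 q =
      W k ^+ 2 * eta k * \sum_(q <- V) brk (stream w) k q * w0 q); first by ring.
    by rewrite mulr_sumr; apply: eq_bigr => q _; ring.
  rewrite -L; move: T0 S0.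
  set T := LHS => T0; set S := LHS => S0.
  suff : Q + Comm + (S + T) = \sum_(k <- V) W k ^+ 2 * eta k * lop al eps Om N (stream w) eta k.
    by rewrite T0 S0 !addr0.
  rewrite /Q /Comm /S /T -!big_split /=.
  apply: eq_bigr => k _; rewrite /lop -/V.
  rewrite (_ : \sum_(q <- V) W k * eta k * brk (stream w) k q * (W k - W q) * eta q =
    W k ^+ 2 * eta k * \sum_(q <- V) brk (stream w) k q * eta q -
    \sum_(q <- V) W k * eta k * brk (stream w) k q * (W q * eta q)); first by ring.
  by rewrite mulr_sumr -sumrB; apply: eq_bigr => q _; ring.
have F1 : bnd (fun p => e p * rw R p) (r0 * C1) by exact: HC1.
have F1' : bnd e (r0 * C1).
  apply: bnd_le F1 => p; have [h0|h0] := eqVneq (hw R p) 0; first by rewrite /e amp0 // mul0r.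
  by rewrite ler_peMr // rw_ge1.
have F2 : bnd (fun p => (e p * rw R p ^+ 2 * hw R p) ^+ 2) (16 * r0 ^+ 2) by exact: amp_l2w.
have hwW q (c : R) : hw R q * c = hw R q / rw R q ^+ 2 * (W q * c).
  have [h0|h0] := eqVneq (hw R q) 0; first by rewrite h0 !mul0r.
  by rewrite /W mulrA mulfVK // sqrf_eq0 gt_eqF // (lt_le_trans ltr01) // rw_ge1.
have hrW q (c : R) : 0 <= c -> hw R q * rw R q * c <= W q * c.
  by move=> c0; rewrite ler_wpM2r // /W expr2 ler_wpM2r // hw_le_rw.
have nsq (z : R) : `|z| ^+ 2 = z ^+ 2 by rewrite real_normK ?num_real.
have WE k : W k * `|eta k| = `|W k * eta k| by rewrite [RHS]normrM (ger0_norm (W0 k)).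
have E2n : \sum_(q <- V) `|W q * eta q| ^+ 2 = E2 by apply: eq_bigr => q _; exact: nsq.
have CommB : `|Comm| <= r0 * (16 + C2 + 5 * C1) * E2.
  (* With [p] the frequency of the velocity, [|W k - W q| <= rw p^2 + 2 * rw p * rw q]. The first
     part puts the whole weight on the velocity and is estimated by [tri_l2]. The second puts half
     of it there and is estimated by [tri_l1], since [hw q * rw q <= W q]. *)
  pose g1 q := hw R q / rw R q ^+ 2 * `|W q * eta q|.
  pose g2 q := 2 * `|W q * eta q|.
  have TB : `|Comm| <= tri (fun p => e p * rw R p ^+ 2) g1 (fun k => `|W k * eta k|) V V
     + tri (fun p => e p * rw R p) g2 (fun k => `|W k * eta k|) V V.
    suff H p k q : `|rw R k - rw R q| <= rw R p ->
        e p * (hw R q * `|W k - W q| * `|eta q|) <=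
        e p * rw R p ^+ 2 * g1 q + e p * rw R p * g2 q.
      by apply: tri_bound => k q; apply: H; [exact: rwD_diff|exact: rwB_diff].
    move=> /(sqr_diff_le (r_0 k) (r_0 q)) dW.
    rewrite /g1 /g2 -WE -hwW.
    have -> : e p * rw R p ^+ 2 * (hw R q * `|eta q|) + e p * rw R p * (2 * (W q * `|eta q|)) =
      e p * (rw R p ^+ 2 * (hw R q * `|eta q|) + rw R p * (2 * (W q * `|eta q|))) by ring.
    rewrite ler_wpM2l // -mulrA.
    apply: (@le_trans _ _ (hw R q * ((rw R p ^+ 2 + 2 * rw R p * rw R q) * `|eta q|))).
      by rewrite ler_wpM2l ?hw_ge0 // ler_wpM2r.
    have := ler_wpM2l (r_0 p) (hrW q `|eta q| (normr_ge0 _)).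
    by set hr := hw R q * rw R q * `|eta q|; rewrite /hr; lra.
  have B1 : tri (fun p => e p * rw R p ^+ 2) g1 (fun k => `|W k * eta k|) V V <=
      r0 * (16 + C2) * E2.
    have r1 : 0 < r0^-1 by rewrite invr_gt0.
    apply: le_trans (HC2 (fun p => e p * rw R p ^+ 2) _ (fun q => `|W q * eta q|) _ _ _ _ _ F2 uV uV r1) _.
      by move=> p h0; rewrite /e amp0 // mul0r.
    by rewrite invrK E2n le_eqVlt; apply/orP; left; apply/eqP; field; rewrite gt_eqF.
  have B2 : tri (fun p => e p * rw R p) g2 (fun k => `|W k * eta k|) V V <=
      r0 * (5 * C1) * E2.
    apply: le_trans (tri_l1 _ _ _ F1 uV uV) _; first by move=> p; rewrite mulr_ge0.
    rewrite (eq_bigr (fun q => 4 * (W q * eta q) ^+ 2)) => [|q _]; last first.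
      by rewrite /g2 exprMn nsq; ring.
    rewrite E2n -mulr_sumr -/E2.
    have : 0 <= r0 * C1 * E2 by rewrite !mulr_ge0 // ltW.
    lra.
  by lra.
have SrcB : `|Src| <= r0 * (64 + C2 + 2 * C1) * (E2 + g0 ^+ 2).
  (* No difference of weights is available here: [W k <= 2 * rw p^2 + 2 * W q]. In the second part
     the derivative [hw q] stays on [w0], which its hypothesis allows. *)
  pose g1 q := hw R q / rw R q ^+ 2 * (2 * `|W q * w0 q|).
  pose g2 q := 2 * `|hw R q * (W q * w0 q)|.
  have TB : `|Src| <= tri (fun p => e p * rw R p ^+ 2) g1 (fun k => `|W k * eta k|) V V
     + tri e g2 (fun k => `|W k * eta k|) V V.
    suff H p k q : `|rw R k - rw R q| <= rw R p ->
        e p * (hw R q * `|W k| * `|w0 q|) <=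
        e p * rw R p ^+ 2 * g1 q + e p * g2 q.
      by apply: (@tri_bound (stream w) (fun k _ => W k)) => k q; apply: H; [exact: rwD_diff|exact: rwB_diff].
    have n1 : `|W q * w0 q| = W q * `|w0 q| by rewrite normrM (ger0_norm (W0 q)).
    have n2 : `|hw R q * (W q * w0 q)| = hw R q * (W q * `|w0 q|).
      by rewrite normrM n1 (ger0_norm (hw_ge0 R q)).
    move=> dr; rewrite /g1 /g2 n1 n2 (ger0_norm (W0 k)).
    have -> : e p * rw R p ^+ 2 * (hw R q / rw R q ^+ 2 * (2 * (W q * `|w0 q|))) +
        e p * (2 * (hw R q * (W q * `|w0 q|))) =
      e p * ((2 * rw R p ^+ 2 + 2 * W q) * (hw R q * `|w0 q|)).
      by rewrite [hw R q / _ * (2 * _)]mulrCA -hwW; ring.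
    rewrite ler_wpM2l // mulrAC mulrC ler_wpM2r ?mulr_ge0 ?hw_ge0 //.
    rewrite /W; move: dr; rewrite ler_norml => /andP[_ dr].
    have kp : rw R k <= rw R p + rw R q by lra.
    apply: le_trans (expr_le 2 (r_0 k) kp) _.
    by apply: le_trans (sqrD2_le _ _) _; lra.
  have B1 : tri (fun p => e p * rw R p ^+ 2) g1 (fun k => `|W k * eta k|) V V <=
      r0 * (64 * g0 ^+ 2 + C2 * E2).
    have r1 : 0 < r0^-1 by rewrite invr_gt0.
    apply: le_trans (HC2 (fun p => e p * rw R p ^+ 2) _ (fun q => 2 * `|W q * w0 q|) _ _ _ _ _ F2 uV uV r1) _.
      by move=> p h0; rewrite /e amp0 // mul0r.
    rewrite invrK (eq_bigr (fun q => 4 * (W q * w0 q) ^+ 2)) => [|q _]; last first.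
      by rewrite exprMn nsq; ring.
    rewrite E2n -mulr_sumr (_ : r0^-1 * (16 * r0 ^+ 2) = 16 * r0); last by field; rewrite gt_eqF.
    have := ler_wpM2l (ltW r00) W0w; lra.
  have B2 : tri e g2 (fun k => `|W k * eta k|) V V <= r0 * (2 * C1) * (g0 ^+ 2 + E2).
    apply: le_trans (tri_l1 _ _ e0 F1' uV uV) _.
    rewrite (eq_bigr (fun q => 4 * (hw R q * (W q * w0 q)) ^+ 2)) => [|q _]; last first.
      by rewrite /g2 exprMn nsq; ring.
    rewrite E2n -mulr_sumr -/G2.
    have rC : 0 <= r0 * C1 by rewrite mulr_ge0 // ltW.
    have := ler_wpM2l rC G2g; have := mulr_ge0 rC E20; lra.
  have := mulr_ge0 (mulr_ge0 (ltW r00) C20) (sqr_ge0 g0).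
  have := mulr_ge0 (ltW r00) E20.
  by lra.
(* Cauchy-Schwarz in the damping norm; the half of [Q] is absorbed on the left. *)
have DmpB : `|Dmp| <= 2^-1 * Q + 2^-1 * ((al + eps) * g0 ^+ 2).
  apply: le_trans (_ : 2^-1 * Q + 2^-1 * \sum_(k <- V) damp al eps k * (W k * w0 k) ^+ 2 <= _); last first.
    by rewrite lerD2l ler_wpM2l ?invr_ge0.
  rewrite -mulrDr /Q -big_split mulr_sumr; apply: le_trans (ler_norm_sum _ _ _) _.
  apply: ler_sum => k _ /=.
  have -> : W k ^+ 2 * eta k * (damp al eps k * w0 k) = damp al eps k * ((W k * eta k) * (W k * w0 k)) by ring.
  rewrite normrM (ger0_norm (damp_ge0 al0 eps0 _)) -mulrDr [leRHS]mulrCA ler_wpM2l ?damp_ge0 //.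
  by rewrite normrM; apply: le_trans (ler_mean2 _ _) _; rewrite !nsq.
have Qb : Q <= 2 * ((al + eps) * g0 ^+ 2).
  have rDle : r0 * (16 + C2 + 5 * C1 + (64 + C2 + 2 * C1)) <= 8^-1 * (al + eps).
    by move: rD; rewrite /D; lra.
  have QC : Q <= `|Comm| + `|Src| + `|Dmp|.
    have := ler_norm (- Comm); have := ler_norm (- Src); have := ler_norm (- Dmp).
    rewrite !normrN; lra.
  have g20 := sqr_ge0 g0.
  have H1 := ler_wpM2r E20 rDle.
  have H2 := ler_wpM2r g20 rDle.
  have H4 : 0 <= (al + eps) * g0 ^+ 2 by rewrite mulr_ge0 // ltW.
  have H3 : 0 <= r0 * (16 + C2 + 5 * C1) * g0 ^+ 2.
    apply: mulr_ge0 => //; apply: mulr_ge0; [exact: ltW|lra].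
  lra.
have W'le k : k \in V -> damp al eps k * (W k * w' k) ^+ 2 <=
    2 * (damp al eps k * (W k * eta k) ^+ 2) + 2 * (damp al eps k * (W k * w0 k) ^+ 2).
  move=> kV; have -> : W k * w' k = W k * eta k + W k * w0 k by rewrite /eta kV; ring.
  have := ler_wpM2l (damp_ge0 al0 eps0 k) (sqrD2_le (W k * eta k) (W k * w0 k)); lra.
move=> s us; rewrite (bigID (fun k => k \in V)) /= [X in _ + X]big1 ?addr0 => [|k kV]; last first.
  by rewrite w'0 // mulr0 expr0n mulr0.
rewrite -big_filter.
apply: le_trans (_ : \sum_(k <- V) damp al eps k * (W k * w' k) ^+ 2 <= _).
  apply: sum_sub_le; [by move=> k; rewrite mulr_ge0 ?sqr_ge0 ?damp_ge0|exact: filter_uniq|].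
  by move=> k; rewrite mem_filter => /andP[].
rewrite big_seq; apply: le_trans (ler_sum _ W'le) _.
(* [eta] contributes [2 * 2] and [w0] contributes [2 * 1] to the constant [6]. *)
rewrite -big_seq big_split -!mulr_sumr /= -/Q; move: Qb Q0; lra.
Qed.

End Estimates.

(** * Contraction in L^2 and the sequence of iterates *)

Section Iteration.
Variable R : realType.
Implicit Types (p q k : Z3) (f g y e a b w rho psi x : Z3 -> R) (s t : seq Z3).

Lemma brkD psi psi' k q : brk (fun p => psi p + psi' p) k q = brk psi k q + brk psi' k q.
Proof. by rewrite /brk; ring. Qed.

Lemma stream_split w w' : stream w = (fun p => stream w' p + stream (fun p => w p - w' p) p).
Proof. by apply/funext => p; rewrite /stream; ring. Qed.

Lemma lop_widen al eps Om N M psi w k : (N <= M)%N -> (forall k, k \notin modes N -> w k = 0) ->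
  lop al eps Om M psi w k = lop al eps Om N psi w k.
Proof.
move=> NM w0; rewrite /lop; congr (_ + _).
apply: (@sum_reindex R _ _ _ _ id id) => //; rewrite ?modes_uniq // => q qN.
  by rewrite w0 ?mulr0 //; apply: contra qN; exact: modes_sub.
by rewrite w0 ?mulr0.
Qed.

Lemma tri0 y s t : tri (fun=> 0) (fun=> 0) y s t = 0 :> R.
Proof. by rewrite /tri big1 // => k _; rewrite big1 // => q _; rewrite mulr0 mul0r. Qed.

(** The difference [d] of consecutive iterates solves the equation with the velocity of [w1] and two
    sources. Transport of [w1] by the difference of velocities gives the term [De / 16]; the
    residual of [w1] on the modes outside the smaller box gives [B / N1]. [B] may depend on [Om], as
    it affects only the speed of convergence. *)
Lemma step_diff : exists2 D : R, 1 <= D &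
  forall (al eps Om r0 g0 : R), 0 <= al -> 0 <= eps -> 0 < al + eps -> 0 < r0 ->
  r0 * D <= al + eps -> exists2 B : R, 0 <= B &
  forall rho w0 N1 N2 w w1 w2 (De : R), (N1 <= N2)%N -> (0 < N1)%N ->
  (forall k, hw R k = 0 -> w0 k = 0) ->
  (forall k, - Om * k.2%:~R * w0 (- k) = rho k) ->
  bnd (fun p => (hw R p * (rw R p ^+ 2 * w0 p)) ^+ 2) (g0 ^+ 2) ->
  bnd (fun p => (rw R p ^+ 2 * w p) ^+ 2) (r0 ^+ 2) ->
  bnd (fun p => (rw R p ^+ 2 * w1 p) ^+ 2) (r0 ^+ 2) ->
  bnd (fun p => (rw R p ^+ 2 * w2 p) ^+ 2) (r0 ^+ 2) ->
  (forall k, k \notin modes N1 -> w1 k = 0) ->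
  (forall k, k \in modes N1 -> lop al eps Om N1 (stream w) w1 k = rho k) ->
  (forall k, k \notin modes N2 -> w2 k = 0) ->
  (forall k, k \in modes N2 -> lop al eps Om N2 (stream w1) w2 k = rho k) ->
  bnd (fun p => (w1 p - w p) ^+ 2) De ->
  bnd (fun p => (w2 p - w1 p) ^+ 2) (De / 16 + B / N1%:R).
Proof.
have [C1 C10 HC1] := @amp_l1 R; have [C2 C20 HC2] := @tri_l2 R.
(* This yields [16 * r0 <= nu / 32] and [r0 * C2 <= nu / 2]: half of the damping absorbs [Sd], and
   the other half leaves [De / 16]. *)
exists (513 + 2 * C2) => [|al eps Om r0 g0 al0 eps0 nu0 r00 rD]; first by lra.
set nu := al + eps in nu0 rD *.
have r02 : 0 <= r0 ^+ 2 by exact: sqr_ge0.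
pose B0 := 2^-1 * (Om ^+ 2 * g0 ^+ 2 + 4 * r0 ^+ 2) + r0 * C1 * (5 * r0 ^+ 2).
have B00 : 0 <= B0.
  have := mulr_ge0 (sqr_ge0 Om) (sqr_ge0 g0).
  have := mulr_ge0 (mulr_ge0 (ltW r00) C10) r02; rewrite /B0; lra.
exists (2 / nu * B0) => [|rho w0 N1 N2 w w1 w2 De N12 N10 w00 w0E w0g wr w1r w2r w1s w1E w2s w2E dDe].
  by rewrite mulr_ge0 // divr_ge0 // ltW.
pose d k := w2 k - w1 k; pose V := modes N2; have uV : uniq V := modes_uniq N2.
pose de k := w1 k - w k.
have V1 k : k \notin V -> w1 k = 0.
  by move=> kV; apply: w1s; apply: contra kV; exact: modes_sub.
have dV k : k \notin V -> d k = 0 by move=> kV; rewrite /d V1 // w2s // subrr.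
pose Sd := \sum_(k <- V) d k ^+ 2.
have Sd0 : 0 <= Sd by apply: sumr_ge0 => k _; exact: sqr_ge0.
suff main : nu * Sd <= 16 * r0 * De + r0 * C2 * Sd + N1%:R^-1 * B0.
  move=> s us; apply: (@le_trans _ _ Sd).
    rewrite (bigID (fun k => k \in V)) /= [X in _ + X]big1 ?addr0 => [|k kV]; last first.
      by rewrite -/(d k) dV // expr0n.
    rewrite -big_filter; apply: sum_sub_le; [by move=> k; exact: sqr_ge0|exact: filter_uniq|].
    by move=> k; rewrite mem_filter => /andP[].
  have De0 := bnd_ge0 dDe.
  have h1 : 16 * r0 * De <= nu / 32 * De by rewrite ler_wpM2r //; have := mulr_ge0 (ltW r00) C20; lra.
  have h2 : r0 * C2 * Sd <= nu / 2 * Sd by rewrite ler_wpM2r //; lra.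
  have : nu * Sd <= nu * (De / 16 + 2 / nu * B0 / N1%:R).
    rewrite mulrDr (_ : nu * (2 / nu * B0 / N1%:R) = 2 * (N1%:R^-1 * B0)); last first.
      by set z := N1%:R^-1; field; rewrite gt_eqF.
    by lra.
  by rewrite ler_pM2l.
pose res k := rho k - lop al eps Om N2 (stream w) w1 k.
have res1 k : k \in modes N1 -> res k = 0.
  by move=> kN; rewrite /res (lop_widen _ _ _ _ _ N12) // w1E // subrr.
have dE k : k \in V -> lop al eps Om N2 (stream w1) d k =
    res k - \sum_(q <- V) brk (stream de) k q * w1 q.
  move=> kV; rewrite /res -(w2E k kV) /lop /d.
  have -> : \sum_(q <- modes N2) brk (stream w1) k q * (w2 q - w1 q) =
    \sum_(q <- modes N2) brk (stream w1) k q * w2 q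
    - (\sum_(q <- modes N2) brk (stream w) k q * w1 q + \sum_(q <- V) brk (stream de) k q * w1 q).
    rewrite -big_split -sumrB /=; apply: eq_bigr => q _.
    by rewrite -mulrDl -brkD -stream_split mulrBr.
  by ring.
pose T1 := \sum_(k <- V) \sum_(q <- V) d k * brk (stream de) k q * 1 * w1 q.
have En : \sum_(k <- V) damp al eps k * d k ^+ 2 = \sum_(k <- V) d k * res k - T1.
  rewrite -(energy al eps Om N2 (stream w1)) /T1 -sumrB big_seq [RHS]big_seq.
  apply: eq_bigr => k kV; rewrite dE // mulrBr mulr_sumr; congr (_ - _).
  by apply: eq_bigr => q _; rewrite mulr1 mulrA.
have nsq (z : R) : `|z| ^+ 2 = z ^+ 2 by rewrite real_normK ?num_real.
pose W k := rw R k ^+ 2; have W0 k : 0 <= W k by exact: sqr_ge0.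
have W1 k : hw R k != 0 -> 1 <= W k by move=> ?; rewrite exprn_ege1 // rw_ge1.
have hwW q (c : R) : hw R q * c = hw R q / rw R q ^+ 2 * (W q * c).
  have [h0|h0] := eqVneq (hw R q) 0; first by rewrite h0 !mul0r.
  by rewrite /W mulrA mulfVK // sqrf_eq0 gt_eqF // (lt_le_trans ltr01) // rw_ge1.
have T1b : `|T1| <= 16 * r0 * De + r0 * C2 * Sd.
  pose e := amp (stream de); pose g q := hw R q / rw R q ^+ 2 * `|W q * w1 q|.
  have : `|T1| <= tri e g (fun k => `|d k|) V V + tri (fun=> 0) (fun=> 0) (fun k => `|d k|) V V.
    have H p q : e p * (hw R q * `|1| * `|w1 q|) <= e p * g q + 0 * 0.
      by rewrite normr1 mulr1 mulr0 addr0 /g normrM (ger0_norm (W0 q)) -hwW.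
    by apply: (@tri_bound R (stream de) (fun _ _ => 1)) => k q; exact: H.
  rewrite tri0 addr0 => /le_trans; apply.
  have r1 : 0 < r0^-1 by rewrite invr_gt0.
  apply: le_trans (HC2 e _ (fun q => `|W q * w1 q|) _ _ _ _ _ (amp_l2 dDe) uV uV r1) _.
    by move=> p h0; rewrite /e amp0.
  rewrite invrK (eq_bigr (fun q => (W q * w1 q) ^+ 2)) => [|q _]; last exact: nsq.
  have -> : \sum_(k <- V) `|d k| ^+ 2 = Sd by apply: eq_bigr => k _; exact: nsq.
  rewrite lerD2r; apply: (@le_trans _ _ (r0^-1 * (16 * De) * r0 ^+ 2)).
    rewrite ler_wpM2l; [by []| |exact: w1r].
    by rewrite !mulr_ge0 ?ler0n ?(ltW r1) // (bnd_ge0 dDe).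
  by rewrite le_eqVlt; apply/orP; left; apply/eqP; field; rewrite gt_eqF.
(* The residual vanishes on [modes N1], and on the other modes [N1 < rw]. A factor [rw / N1] may
   thus be inserted: smallness in [N1] is bought with one derivative of the residual. *)
pose y k := if k \in modes N1 then 0 else N1%:R * d k / rw R k.
have N1r : 0 < N1%:R :> R by rewrite ltr0n.
have yd k : k \in V -> `|y k| <= `|d k|.
  move=> kV; rewrite /y; case: ifP => [_|/negbT kN]; first by rewrite normr0.
  have k0 := modes_hw R kV; have rk := notin_modes k0 kN.
  have rk0 : 0 < rw R k by apply: lt_trans rk.
  rewrite !normrM (gtr0_norm N1r) normfV (gtr0_norm rk0) ler_pdivrMr // mulrC.
  by rewrite ler_wpM2l // ltW.
have yr k : k \in V -> d k * res k = N1%:R^-1 * (y k * rw R k * (rho k - \sum_(q <- V) brk (stream w) k q * w1 q)).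
  move=> kV; rewrite /y; case: ifP => [kN|/negbT kN]; first by rewrite res1 // !mul0r !mulr0.
  have k0 := modes_hw R kV; have rk : 0 < rw R k := lt_le_trans ltr01 (rw_ge1 k0).
  rewrite /res /lop !w1s // ?modesN // !mulr0 add0r.
  set S := \sum_(q <- modes N2) _; rewrite -/V -/S.
  by set n := N1%:R in N1r *; field; rewrite !gt_eqF.
pose T2 := \sum_(k <- V) y k * (rw R k * rho k).
pose T3 := \sum_(k <- V) \sum_(q <- V) y k * brk (stream w) k q * rw R k * w1 q.
have resE : \sum_(k <- V) d k * res k = N1%:R^-1 * (T2 - T3).
  rewrite /T2 /T3 -sumrB mulr_sumr big_seq [RHS]big_seq; apply: eq_bigr => k kV.
  rewrite yr // (_ : \sum_(q <- V) y k * brk (stream w) k q * rw R k * w1 q =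
   y k * rw R k * \sum_(q <- V) brk (stream w) k q * w1 q); first by ring.
  by rewrite mulr_sumr; apply: eq_bigr => q _; ring.
have Sy : \sum_(k <- V) y k ^+ 2 <= Sd.
  rewrite big_seq [leRHS]big_seq; apply: ler_sum => k kV.
  by rewrite -nsq -(nsq (d k)) expr_le // yd.
have Sd4 : Sd <= 4 * r0 ^+ 2.
  apply: (@le_trans _ _ (\sum_(k <- V) (2 * ((W k * w1 k) ^+ 2 + (W k * w2 k) ^+ 2)))).
    rewrite /Sd big_seq [leRHS]big_seq; apply: ler_sum => k kV.
    have w1k := W1 k (modes_hw R kV).
    have L z : z ^+ 2 <= (W k * z) ^+ 2.
      by rewrite exprMn ler_peMl ?sqr_ge0 // exprn_ege1.
    have := L (w1 k); have := L (w2 k); have := sqr_ge0 (w1 k + w2 k).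
    by rewrite /d !exprMn; nra.
  rewrite -mulr_sumr big_split /=; have := w1r V uV; have := w2r V uV; rewrite /W; lra.
have T2b : `|T2| <= 2^-1 * (Om ^+ 2 * g0 ^+ 2 + Sd).
  apply: (@le_trans _ _ (2^-1 * (\sum_(k <- V) (rw R k * rho k) ^+ 2 + \sum_(k <- V) y k ^+ 2))).
    rewrite addrC -big_split mulr_sumr; apply: le_trans (ler_norm_sum _ _ _) _.
    apply: ler_sum => k _ /=; rewrite normrM; apply: le_trans (ler_mean2 _ _) _.
    by rewrite !nsq.
  rewrite ler_wpM2l ?invr_ge0 //; apply: lerD => //.
  apply: (@le_trans _ _ (Om ^+ 2 * \sum_(k <- V) (hw R (- k) * (rw R (- k) ^+ 2 * w0 (- k))) ^+ 2)).
    rewrite mulr_sumr big_seq [leRHS]big_seq; apply: ler_sum => k kV.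
    have h1 := hw_ge1 (modes_hw R kV).
    rewrite -w0E hwN rwN -exprMn -nsq -(nsq (Om * _)) expr_le //.
    rewrite !normrM normrN (ger0_norm (rw_ge0 R k)) (ger0_norm (hw_ge0 R k)).
    have l1 : `|k.2%:~R| <= rw R k by rewrite -intr_norm /rw lerDr hw_ge0.
    rewrite [leLHS](_ : _ = `|Om| * `|w0 (- k)| * (rw R k * `|k.2%:~R|)); last by ring.
    rewrite [leRHS](_ : _ = `|Om| * `|w0 (- k)| * (hw R k * (rw R k * rw R k))); last by ring.
    rewrite ler_wpM2l ?mulr_ge0 //.
    apply: (@le_trans _ _ (rw R k * rw R k)); first by rewrite ler_wpM2l ?rw_ge0.
    by rewrite ler_peMl // mulr_ge0 ?rw_ge0.
  by rewrite ler_wpM2l ?sqr_ge0 //; exact: (bnd_inj (@oppr_inj _) w0g).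
have F1 : bnd (fun p => amp (stream w) p * rw R p) (r0 * C1) by exact: HC1.
have F1' : bnd (amp (stream w)) (r0 * C1).
  apply: bnd_le F1 => p; have [h0|h0] := eqVneq (hw R p) 0; first by rewrite amp0 // mul0r.
  by rewrite ler_peMr ?amp_ge0 // rw_ge1.
have T3b : `|T3| <= r0 * C1 * (r0 ^+ 2 + Sd).
  pose e := amp (stream w).
  have TB : `|T3| <= tri (fun p => e p * rw R p) (fun q => `|W q * w1 q|) (fun k => `|y k|) V V
     + tri e (fun q => `|W q * w1 q|) (fun k => `|y k|) V V.
    suff H p k q : `|rw R k - rw R q| <= rw R p ->
        e p * (hw R q * `|rw R k| * `|w1 q|) <=
        e p * rw R p * `|W q * w1 q| + e p * `|W q * w1 q|.
      by apply: (@tri_bound R (stream w) (fun k _ => rw R k)) => k q; apply: H; [exact: rwD_diff|exact: rwB_diff].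
    rewrite ler_norml => /andP[_ dr].
    have [h0|h0] := eqVneq (hw R q) 0.
      rewrite h0 !mul0r mulr0.
      exact: (addr_ge0 (mulr_ge0 (mulr_ge0 (amp_ge0 _ _) (rw_ge0 _ _)) (normr_ge0 _))
        (mulr_ge0 (amp_ge0 _ _) (normr_ge0 _))).
    rewrite (ger0_norm (rw_ge0 R k)) normrM (ger0_norm (W0 q)).
    have -> : e p * rw R p * (W q * `|w1 q|) + e p * (W q * `|w1 q|) =
       e p * ((rw R p + 1) * W q * `|w1 q|) by ring.
    rewrite ler_wpM2l ?amp_ge0 // ler_wpM2r //.
    have r1 := rw_ge1 h0; have hr := hw_le_rw R q; have rp0 := rw_ge0 R p.
    have h_0 := hw_ge0 R q.
    apply: (@le_trans _ _ (hw R q * (rw R p + rw R q))); first by rewrite ler_wpM2l //; lra.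
    apply: (@le_trans _ _ (rw R q * (rw R p + rw R q))); first by rewrite ler_wpM2r //; lra.
    have : 0 <= (rw R q * rw R p) * (rw R q - 1) by rewrite !mulr_ge0 ?subr_ge0 ?rw_ge0.
    by rewrite /W expr2; lra.
  have Wsum : \sum_(q <- V) `|W q * w1 q| ^+ 2 <= r0 ^+ 2.
    by apply: le_trans (w1r V uV); apply: ler_sum => q _; rewrite nsq.
  have ysum : \sum_(q <- V) `|y q| ^+ 2 <= Sd.
    by apply: le_trans Sy; apply: ler_sum => q _; rewrite nsq.
  have rC : 0 <= r0 * C1 by rewrite mulr_ge0 // ltW.
  have b1 := tri_l1 (fun q => `|W q * w1 q|) (fun k => `|y k|) (fun p => mulr_ge0 (amp_ge0 (stream w) p) (rw_ge0 R p)) F1 uV uV.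
  have b2 := tri_l1 (fun q => `|W q * w1 q|) (fun k => `|y k|) (fun p => amp_ge0 (stream w) p) F1' uV uV.
  have := ler_wpM2l rC (lerD Wsum ysum).
  by move: TB b1 b2; rewrite /e; lra.
have En2 : nu * Sd <= \sum_(k <- V) damp al eps k * d k ^+ 2.
  rewrite /Sd mulr_sumr !big_seq; apply: ler_sum => k kV.
  by rewrite ler_wpM2r ?sqr_ge0 // damp_ge // (modes_hw R kV).
apply: le_trans En2 _; rewrite En resE.
have tt : T2 - T3 <= B0.
  have := ler_norm T2; have := ler_norm (- T3); rewrite normrN.
  have rC : 0 <= r0 * C1 by rewrite mulr_ge0 // ltW.
  have := ler_wpM2l rC Sd4.
  rewrite /B0; move: T2b T3b; lra.
have := ler_norm (- T1); rewrite normrN => ?.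
have N1i : 0 <= N1%:R^-1 :> R by rewrite invr_ge0.
have := ler_wpM2l N1i tt; lra.
Qed.

(** Starting from zero, the truncation grows like [4 ^ n]. Its error decays more slowly than the
    factor [1/16] of [step_diff] contracts, so it dictates the rate [4 ^ (- n)] of the squared
    differences. *)
Lemma galerkin_seq : exists2 D : R, 1 <= D &
  forall (al eps Om : R) rho w0 (r0 g0 : R),
  0 <= al -> 0 <= eps -> 0 < al + eps -> 0 < r0 -> 0 <= g0 -> 3 * g0 <= r0 ->
  r0 * D <= al + eps ->
  (forall k, hw R k = 0 -> w0 k = 0) ->
  (forall k, - Om * k.2%:~R * w0 (- k) = rho k) ->
  bnd (fun p => (hw R p * (rw R p ^+ 2 * w0 p)) ^+ 2) (g0 ^+ 2) ->
  exists w : nat -> Z3 -> R, exists2 B : R, 0 <= B &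
  [/\ forall n k, k \notin modes (4 ^ n) -> w n.+1 k = 0,
      forall n, bnd (fun p => (rw R p ^+ 2 * w n p) ^+ 2) (r0 ^+ 2),
      forall n, bnd (fun p => damp al eps p * (rw R p ^+ 2 * w n p) ^+ 2)
        (6 * (al + eps) * g0 ^+ 2),
      forall n k, k \in modes (4 ^ n) ->
        lop al eps Om (4 ^ n) (stream (w n)) (w n.+1) k = rho k &
      forall n, bnd (fun p => (w n.+1 p - w n p) ^+ 2) (B / (4 ^ n)%:R)].
Proof.
have [D1 D11 H1] := @step_bound R; have [D2 D21 H2] := step_diff.
exists (D1 + D2) => [|al eps Om rho w0 r0 g0 al0 eps0 nu0 r00 g00 gr rD w00 w0E w0g]; first by lra.
have rD1 : r0 * D1 <= al + eps.
  by apply: le_trans rD; rewrite ler_wpM2l ?(ltW r00) // lerDl; lra.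
have rD2 : r0 * D2 <= al + eps.
  by apply: le_trans rD; rewrite ler_wpM2l ?(ltW r00) // lerDr; lra.
have [B0 B00 HB] := H2 al eps Om r0 g0 al0 eps0 nu0 r00 rD2.
pose nxt N w := sval (cid (galerkin_solve Om al0 eps0 nu0 N (stream w) rho)).
pose w := fix w n := if n is m.+1 then nxt (4 ^ m)%N (w m) else fun=> 0.
have ws n k : k \notin modes (4 ^ n) -> w n.+1 k = 0.
  by move=> kn; rewrite /= /nxt; case: cid => /= x [x0 _]; exact: x0.
have wE n k : k \in modes (4 ^ n) -> lop al eps Om (4 ^ n) (stream (w n)) (w n.+1) k = rho k.
  by move=> kn; rewrite [w n.+1]/= /nxt; case: cid => /= x [_ xE]; exact: xE.
(* [6 * g0^2 <= (3 * g0)^2 <= r0^2]: the iterates do not leave the ball of radius [r0]. *)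
have toX x : (forall k, hw R k = 0 -> x k = 0) ->
   bnd (fun p => damp al eps p * (rw R p ^+ 2 * x p) ^+ 2) (6 * (al + eps) * g0 ^+ 2) ->
   bnd (fun p => (rw R p ^+ 2 * x p) ^+ 2) (r0 ^+ 2).
  move=> x0 xb; apply: (@bndW _ _ _ (6 * g0 ^+ 2)).
    have : (3 * g0) ^+ 2 <= r0 ^+ 2 by rewrite expr_le // mulr_ge0.
    by rewrite exprMn; have := sqr_ge0 g0; lra.
  have E : 6 * g0 ^+ 2 = (al + eps)^-1 * (6 * (al + eps) * g0 ^+ 2) by field; rewrite gt_eqF.
  rewrite E; apply: bnd_le (bndZ _ xb) => [p|]; last by rewrite invr_ge0 ltW.
  have [h0|h0] := eqVneq (hw R p) 0; first by rewrite x0 // !mulr0 expr0n mulr0 mulr0.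
  by rewrite ler_pdivlMl // ler_wpM2r ?sqr_ge0 // damp_ge.
have whw n k : hw R k = 0 -> w n k = 0.
  case: n => // n h0; apply: ws; rewrite mem_filter -(hw_eq0 R) h0 eqxx //.
have wb n : bnd (fun p => (rw R p ^+ 2 * w n p) ^+ 2) (r0 ^+ 2) /\
   bnd (fun p => damp al eps p * (rw R p ^+ 2 * w n p) ^+ 2) (6 * (al + eps) * g0 ^+ 2).
  elim: n => [|n [IH _]].
    split=> s _ /=.
      by rewrite big1 ?sqr_ge0 // => k _; rewrite mulr0 expr0n.
    rewrite big1 ?mulr_ge0 ?sqr_ge0 ?(ltW nu0) // => k _.
    by rewrite mulr0 expr0n mulr0.
  have b : bnd (fun p => damp al eps p * (rw R p ^+ 2 * w n.+1 p) ^+ 2) (6 * (al + eps) * g0 ^+ 2).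
    by apply: (H1 al eps Om rho w0 r0 g0 (4 ^ n)%N (w n)) => //; [exact: ws|exact: wE].
  by split=> //; apply: toX => // k; exact: whw.
(* [4 * r0^2] covers the first difference, and [8 * B0] gives [B / 16 + B0 <= B / 4]. *)
pose B := 4 * r0 ^+ 2 + 8 * B0.
have r02 : 0 <= r0 ^+ 2 by exact: sqr_ge0.
have B_0 : 0 <= B by rewrite /B; lra.
exists w, B => //; split=> //.
- by move=> n; have [] := wb n.
- by move=> n; have [] := wb n.
elim=> [|n IH].
  rewrite expn0 divr1; apply: (@bndW _ _ _ (r0 ^+ 2)); first by rewrite /B; lra.
  have [b _] := wb 1%N; apply: bnd_le b => p; rewrite [w 0%N]/= subr0.
  have [h0|h0] := eqVneq (hw R p) 0; first by rewrite whw // mulr0.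
  by rewrite exprMn ler_peMl ?sqr_ge0 // exprn_ege1 // exprn_ege1 // rw_ge1.
have E := HB rho w0 (4 ^ n)%N (4 ^ n.+1)%N (w n) (w n.+1) (w n.+2) _ _ _ w00 w0E w0g
  (wb n).1 (wb n.+1).1 (wb n.+2).1 (ws n) (wE n) (ws n.+1) (wE n.+1) IH.
apply: bndW (E _ _); last 2 first.
- by rewrite leq_exp2l.
- by rewrite expn_gt0.
rewrite expnS natrM; have p4 : 0 < (4 ^ n)%:R :> R by rewrite ltr0n expn_gt0.
set z := (4 ^ n)%:R in p4 *.
have -> : B / (4 * z) = B / 4 / z by field; rewrite gt_eqF.
rewrite mulrAC -mulrDl ler_wpM2r ?invr_ge0 ?(ltW p4) // /B; lra.
Qed.

End Iteration.

(** * Integration of continuous periodic functions *)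

Section Caratheodory.
Variable R : realType.

Lemma grid_cvg (y : R) :
  ((Num.floor (n.+1%:R * y))%:~R / n.+1%:R : R) @[n --> \oo] --> y.
Proof.
apply/cvgrPdist_le => e e0; near=> n.
have n0 : 0 < n.+1%:R :> R by rewrite ltr0n.
rewrite ger0_norm; last by rewrite subr_ge0 ler_pdivrMr // mulrC floor_le_tmp.
rewrite lerBlDr -lerBlDl ler_pdivlMr // mulrBl.
have /ltW := floorD1_gt (n.+1%:R * y); rewrite intrD => H.
apply: (@le_trans _ _ (n.+1%:R * y - 1)); last by lra.
rewrite mulrC lerD2l lerN2 -ler_pdivrMl // mulr1; apply/ltW.
apply: (@lt_trans _ _ n%:R); last by rewrite ltr_nat.
near: n; exact: nbhs_infty_gtr.
Unshelve. all: by end_near. Qed.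

Lemma measurable_floor_fiber (n : nat) (k : int) :
  measurable [set y : R | Num.floor (n.+1%:R * y) = k].
Proof.
have n0 : 0 < n.+1%:R :> R by rewrite ltr0n.
rewrite (_ : [set y | _] = `[k%:~R / n.+1%:R, (k + 1)%:~R / n.+1%:R[%classic).
  exact: measurable_itv.
apply/seteqP; split=> y /=; rewrite in_itv /=.
  by move=> <-; rewrite ler_pdivrMr // ltr_pdivlMr // mulrC floor_le_tmp floorD1_gt.
rewrite ler_pdivrMr // ltr_pdivlMr // mulrC => H; exact: floor_def.
Qed.

(* The Borel sets of a product type are here by definition the product measurable sets, so
   that measurability of a continuous function of several variables needs a proof. *)
Lemma caratheodory d (T : measurableType d) (f : T * R -> R) :
  (forall y, measurable_fun setT (fun x => f (x, y))) ->
  (forall x, continuous (fun y => f (x, y))) -> measurable_fun setT f.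
Proof.
move=> mf cf.
(* The last variable is rounded down to the grid of mesh [1 / (n + 1)]: [g n] is measurable on each
   of countably many strips and converges pointwise to [f]. *)
pose g n (z : T * R) := f (z.1, (Num.floor (n.+1%:R * z.2))%:~R / n.+1%:R).
apply: (@measurable_fun_cvg _ _ _ _ g) => [n|[x y] _]; last first.
  rewrite /g /=; have H := @grid_cvg y; have F := cf x (y : R).
  apply: (@cvg_comp _ _ _ (fun n : nat => (Num.floor (n.+1%:R * (y : R)))%:~R / n.+1%:R)
    (fun y => f (x, y)) _ _ _ H F).
move=> _ B mB; rewrite setTI.
rewrite (_ : g n @^-1` B = \bigcup_(k in [set: int])
    (((fun x => f (x, k%:~R / n.+1%:R)) @^-1` B) `*` [set y | Num.floor (n.+1%:R * y) = k])).
  apply: countable_bigcupT_measurable => // k.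
  apply: measurableX; last exact: measurable_floor_fiber.
  by rewrite -[X in measurable X]setTI; exact: mf.
apply/seteqP; split=> [[x y] /= Bg|[x y] [k _ [/= Bk kE]]].
  by exists (Num.floor (n.+1%:R * y)).
by rewrite /g /= kE.
Qed.

End Caratheodory.

(** * Continuous integrands on the torus, and integrals of derivatives of periodic functions *)

Section Integration.
Variable R : realType.
Notation leb := (@lebesgue_measure R).
Notation leb2 := (leb \x leb)%E.
Notation leb3 := (leb2 \x leb)%E.

Lemma cont_pairl (U V : topologicalType) (y : V) : continuous (fun x : U => (x, y)).
Proof. by move=> x; apply: (cvg_pair (f := fun x : U => x) (g := fun _ => y)) => //; exact: cvg_cst. Qed.

Lemma cont_pairr (U V : topologicalType) (x : U) : continuous (fun y : V => (x, y)).
Proof. by move=> y; apply: (cvg_pair (f := fun _ => x) (g := fun y : V => y)) => //; exact: cvg_cst. Qed.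

Lemma cont_measurable2 (f : plane R -> R) : continuous f -> measurable_fun setT f.
Proof.
move=> cf; apply: caratheodory => [y|x].
  apply: continuous_measurable_fun => x.
  apply: (@continuous_comp _ _ _ (fun x : R => (x, y)) f); last exact: cf.
  exact: cont_pairl.
move=> y; apply: (@continuous_comp _ _ _ (fun y : R => (x, y)) f); last exact: cf.
exact: cont_pairr.
Qed.

Lemma cont_measurable3 (f : spacetime R -> R) : continuous f -> measurable_fun setT f.
Proof.
move=> cf; apply: caratheodory => [t|x].
  apply: cont_measurable2 => x.
  apply: (@continuous_comp _ _ _ (fun x : plane R => (x, t)) f); last exact: cf.
  exact: cont_pairl.
move=> y; apply: (@continuous_comp _ _ _ (fun t : R => (x, t)) f); last exact: cf.
exact: cont_pairr.
Qed.

Lemma measurable_torus : measurable (@torus R).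
Proof. by apply: measurableX; exact: measurable_itv. Qed.

Lemma measurable_torus_time (T : R) : measurable (torus_time T).
Proof. by apply: measurableX; [exact: measurable_torus|exact: measurable_itv]. Qed.

Lemma leb_itv_fin (a b : R) : (leb `[a, b]%classic < +oo)%E.
Proof. by rewrite lebesgue_measure_itv /=; case: ifP => // _; rewrite -EFinB ltry. Qed.

Lemma leb2_torus_fin : (leb2 (@torus R) < +oo)%E.
Proof.
rewrite product_measure1E; [|exact: measurable_itv|exact: measurable_itv].
by rewrite lte_mul_pinfty ?measure_ge0 ?fin_num_fun_lty ?leb_itv_fin //
  ge0_fin_numE ?leb_itv_fin.
Qed.

Lemma leb3_torus_fin (T : R) : (leb3 (torus_time T) < +oo)%E.
Proof.
rewrite product_measure1E; [|exact: measurable_torus|exact: measurable_itv].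
by rewrite lte_mul_pinfty ?measure_ge0 ?leb_itv_fin // ge0_fin_numE ?leb2_torus_fin.
Qed.

Lemma compact_torus : compact (@torus R).
Proof. by apply: compact_setX; exact: segment_compact. Qed.

Lemma compact_torus_time (T : R) : compact (torus_time T).
Proof. by apply: compact_setX; [exact: compact_torus|exact: segment_compact]. Qed.

Lemma cont_compact_bounded (V : topologicalType) (f : V -> R) (A : set V) :
  compact A -> continuous f -> exists M, forall x, A x -> `|f x| <= M.
Proof.
move=> cA cf.
have /compact_bounded[M [_ HM]] := continuous_compact (continuous_subspaceT cf) cA.
exists (M + 1) => x Ax; apply: (HM (M + 1)); first by rewrite ltrDl.
by exists x.
Qed.

Lemma cont_integrable2 (f : plane R -> R) : continuous f ->
  leb2.-integrable (@torus R) (EFin \o f).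
Proof.
move=> cf; apply: measurable_bounded_integrable.
- exact: measurable_torus.
- exact: leb2_torus_fin.
- by apply: measurable_funS (cont_measurable2 cf).
have [M HM] := cont_compact_bounded compact_torus cf.
exists M; split; first exact: num_real.
by move=> x Mx y Ty /=; apply: le_trans (HM y Ty) _; exact: ltW.
Qed.

Lemma cont_integrable3 (T : R) (f : spacetime R -> R) : continuous f ->
  leb3.-integrable (torus_time T) (EFin \o f).
Proof.
move=> cf; apply: measurable_bounded_integrable.
- exact: measurable_torus_time.
- exact: leb3_torus_fin.
- by apply: measurable_funS (cont_measurable3 cf).
have [M HM] := cont_compact_bounded (@compact_torus_time T) cf.
exists M; split; first exact: num_real.
by move=> x Mx y Ty /=; apply: le_trans (HM y Ty) _; exact: ltW.
Qed.

Section SigmaFiniteProduct.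
Context d1 d2 (T1 : measurableType d1) (T2 : measurableType d2).
Variables (m1 : {sigma_finite_measure set T1 -> \bar R})
  (m2 : {sigma_finite_measure set T2 -> \bar R}).

(* The canonical structure of the library is shadowed by that of the products of
   subprobabilities. *)
Definition sfprod : {sigma_finite_measure set (T1 * T2)%type -> \bar R} :=
  HB.pack (m1 \x m2)%E
   (lebesgue_integral_fubini.measure_function_Measure_isSigmaFinite__to__measure_function_isSFinite m1 m2)
   (lebesgue_integral_fubini.measure_function_Measure_isSigmaFinite__to__measure_function_isSigmaFinite m1 m2).

End SigmaFiniteProduct.

Section Fubini.
Context d1 d2 (T1 : measurableType d1) (T2 : measurableType d2).
Variables (m1 : {sigma_finite_measure set T1 -> \bar R})
  (m2 : {sigma_finite_measure set T2 -> \bar R}).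
Variables (A : set T1) (B : set T2) (f : T1 * T2 -> R).
Hypotheses (mA : measurable A) (mB : measurable B)
  (fi : (m1 \x m2)%E.-integrable (A `*` B) (EFin \o f)).

Let F := (EFin \o f) \_ (A `*` B).

Let Fi : (m1 \x m2)%E.-integrable setT F.
Proof. exact: ((integrable_mkcond (EFin \o f) (measurableX mA mB)).1 fi). Qed.

Lemma fubini_eq0_1 : (forall x, A x -> \int[m2]_(y in B) (f (x, y))%:E = 0)%E ->
  (\int[(m1 \x m2)%E]_(z in A `*` B) (f z)%:E = 0)%E.
Proof.
move=> H; rewrite integral_mkcond /= -(integral12_prod_meas1 Fi).
apply: integral0_eq => x _; rewrite /F.
have [Ax|Ax] := pselect (A x); last first.
  by apply: integral0_eq => y _; rewrite patchE memNset // => -[].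
rewrite -[RHS](H x Ax) [RHS]integral_mkcond; apply: eq_integral => y _.
rewrite !patchE; have [By|By] := pselect (B y).
  by rewrite !mem_set.
by rewrite !memNset // => -[].
Qed.

Lemma fubini_eq0_2 : (forall y, B y -> \int[m1]_(x in A) (f (x, y))%:E = 0)%E ->
  (\int[(m1 \x m2)%E]_(z in A `*` B) (f z)%:E = 0)%E.
Proof.
move=> H; rewrite integral_mkcond /= -(integral21_prod_meas1 Fi).
apply: integral0_eq => y _; rewrite /F.
have [By|By] := pselect (B y); last first.
  by apply: integral0_eq => x _; rewrite patchE memNset // => -[].
rewrite -[RHS](H y By) [RHS]integral_mkcond; apply: eq_integral => x _.
rewrite !patchE; have [Ax|Ax] := pselect (A x).
  by rewrite !mem_set.
by rewrite !memNset // => -[].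
Qed.

End Fubini.

Lemma is_derive_line (V : normedModType R) (f : V -> R) (a e : V) (t d : R) :
  is_derive (a + t *: e) e f d -> is_derive t 1 (fun s : R => f (a + s *: e)) d.
Proof.
move=> [df <-].
have E : (fun h : R => h^-1 *: (f (a + (h *: (1 : R) + t) *: e) - f (a + t *: e))) =
  (fun h : R => h^-1 *: (f (h *: e + (a + t *: e)) - f (a + t *: e))).
  apply/funext => h; congr (_ *: (f _ - _)).
  by rewrite scalerDl addrCA [h *: 1]mulr1.
by split; rewrite /derivable /derive /= ?E.
Qed.

Lemma ftc_periodic (F g : R -> R) (L : R) : 0 < L -> continuous g ->
  (forall x : R, is_derive x 1 F (g x)) -> F L = F 0 ->
  (\int[leb]_(x in `[0%R, L]) (g x)%:E = 0)%E.
Proof.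
move=> L0 cg dF FL.
have cF (x : R) : {for x, continuous F}.
  by apply/differentiable_continuous/derivable1_diffP; have [] := dF x.
rewrite (@continuous_FTC2 _ g F) //.
- by rewrite FL subee.
- exact: continuous_subspaceT.
- split.
  + by move=> x _; have [] := dF x.
  + by apply: cvg_at_right_filter; exact: cF.
  + by apply: cvg_at_left_filter; exact: cF.
by move=> x _; rewrite derive1E; have [_ ->] := dF x.
Qed.

(** Integrate along [dx j] first: the inner integral is the increment of a periodic function over
    its period. *)
Lemma int_dx0 j (psi g : plane R -> R) : continuous g -> torus_fun psi ->
  (forall x, is_derive x (dx R j) psi (g x)) ->
  (\int[leb2]_(x in @torus R) (g x)%:E = 0)%E.
Proof.
move=> cg pp dpsi.
have pi2 : 0 < 2 * pi :> R by rewrite mulr_gt0 ?pi_gt0.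
have gi := cont_integrable2 cg.
have pj := pp j; move: dpsi pj; rewrite /dx; case: eqP => _ dpsi pj.
  apply: (@fubini_eq0_2 _ _ _ _ leb leb `[0, 2 * pi]%classic `[0, 2 * pi]%classic g (measurable_itv _) (measurable_itv _) gi) => y _.
  apply: (@ftc_periodic (fun x => psi (x, y))) => //.
  - move=> x; apply: (@continuous_comp _ _ _ (fun x : R => (x, y)) g); last exact: cg.
    exact: cont_pairl.
  - move=> x; have E (s : R) : (s, y) = (0, y) + s *: (1, 0) :> plane R.
      by congr (_, _) => /=; rewrite ?add0r ?[s *: 1]mulr1 // scaler0 addr0.
    rewrite (_ : (fun _ => _) = fun s => psi ((0, y) + s *: (1, 0))); last first.
      by apply/funext => s; rewrite -E.
    by apply: is_derive_line; rewrite -E; exact: dpsi.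
  have := pj (0, y); rewrite (_ : (0, y) + _ = (2 * pi, y)) //.
  by congr (_, _) => /=; rewrite ?add0r ?[_ *: 1]mulr1 // scaler0 addr0.
apply: (@fubini_eq0_1 _ _ _ _ leb leb `[0, 2 * pi]%classic `[0, 2 * pi]%classic g (measurable_itv _) (measurable_itv _) gi) => y _.
apply: (@ftc_periodic (fun x => psi (y, x))) => //.
- move=> x; apply: (@continuous_comp _ _ _ (fun x : R => (y, x)) g); last exact: cg.
  exact: cont_pairr.
- move=> x; have E (s : R) : (y, s) = (y, 0) + s *: (0, 1) :> plane R.
    by congr (_, _) => /=; rewrite ?add0r ?[s *: 1]mulr1 // scaler0 addr0.
  rewrite (_ : (fun _ => _) = fun s => psi ((y, 0) + s *: (0, 1))); last first.
    by apply/funext => s; rewrite -E.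
  by apply: is_derive_line; rewrite -E; exact: dpsi.
have := pj (y, 0); rewrite (_ : (y, 0) + _ = (y, 2 * pi)) //.
by congr (_, _) => /=; rewrite ?add0r ?[_ *: 1]mulr1 // scaler0 addr0.
Qed.

Lemma int_dX0 T j (psi g : spacetime R -> R) : continuous g -> torus_time_fun T psi ->
  (forall x, is_derive x (dX R j) psi (g x)) ->
  (\int[leb3]_(x in torus_time T) (g x)%:E = 0)%E.
Proof.
move=> cg [pp _] dpsi.
apply: (@fubini_eq0_2 _ _ _ _ (@sfprod _ _ _ _ leb leb) leb (@torus R) `[0, T]%classic g measurable_torus (measurable_itv _) (@cont_integrable3 T g cg)) => t _.
apply: (@int_dx0 j (fun x => psi (x, t))).
- move=> x; apply: (@continuous_comp _ _ _ (fun x : plane R => (x, t)) g); last exact: cg.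
  exact: cont_pairl.
- move=> i x; have := pp i (x, t).
  rewrite (_ : (x, t) + _ = (x + (2 * pi) *: dx R i, t)) //.
  by congr (_, _) => /=; rewrite scaler0 addr0.
move=> x; have [dd <-] := dpsi (x, t).
have E : (fun h : R => h^-1 *: (psi (h *: dx R j + x, t) - psi (x, t))) =
  (fun h : R => h^-1 *: (psi (h *: dX R j + (x, t)) - psi (x, t))).
  apply/funext => h; congr (_ *: (psi _ - _)).
  by congr (_, _) => /=; rewrite scaler0 add0r.
by split; rewrite /derivable /derive /= ?E.
Qed.

Lemma int_dT0 T (psi g : spacetime R -> R) : 0 < T -> continuous g -> torus_time_fun T psi ->
  (forall x, is_derive x (dT R) psi (g x)) ->
  (\int[leb3]_(x in torus_time T) (g x)%:E = 0)%E.
Proof.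
move=> T0 cg [_ pT] dpsi.
apply: (@fubini_eq0_1 _ _ _ _ (@sfprod _ _ _ _ leb leb) leb (@torus R) `[0, T]%classic g measurable_torus (measurable_itv _) (@cont_integrable3 T g cg)) => y _.
apply: (@ftc_periodic (fun x => psi (y, x))) => //.
- move=> x; apply: (@continuous_comp _ _ _ (fun x : R => (y, x)) g); last exact: cg.
  exact: cont_pairr.
- move=> x; have E (s : R) : (y, s) = (y, 0) + s *: dT R :> spacetime R.
    by congr (_, _) => /=; rewrite ?add0r ?[s *: 1]mulr1 // scaler0 addr0.
  rewrite (_ : (fun _ => _) = fun s => psi ((y, 0) + s *: dT R)); last first.
    by apply/funext => s; rewrite -E.
  by apply: is_derive_line; rewrite -E; exact: dpsi.
have := pT (y, 0); rewrite (_ : (y, 0) + _ = (y, T)) //.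
by congr (_, _) => /=; rewrite ?add0r ?[_ *: 1]mulr1 // scaler0 addr0.
Qed.

End Integration.

(** * Uniform limits and weak derivatives *)

Section UniformLimits.
Variable R : realType.

(** Uniform on the whole space and not just on a cell, so that limits inherit periodicity. *)
Definition ulim (V : Type) (u : nat -> V -> R) (f : V -> R) : Prop :=
  forall e : R, 0 < e -> exists n0 : nat, forall n, (n0 <= n)%N -> forall z, `|u n z - f z| <= e.

Lemma ulim_ext (V : Type) (u u' : nat -> V -> R) f :
  (forall n z, u n z = u' n z) -> ulim u f -> ulim u' f.
Proof. by move=> uu uf e /uf[n0 H]; exists n0 => n nn z; rewrite -uu; exact: H. Qed.

Lemma ulim_cst (V : Type) (f : V -> R) : ulim (fun=> f) f.
Proof. by move=> e e0; exists 0%N => n _ z; rewrite subrr normr0 ltW. Qed.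

Lemma ulimD (V : Type) (u v : nat -> V -> R) f g :
  ulim u f -> ulim v g -> ulim (fun n z => u n z + v n z) (fun z => f z + g z).
Proof.
move=> uf vg e e0; have e2 : 0 < e / 2 by rewrite divr_gt0.
have [n1 H1] := uf _ e2; have [n2 H2] := vg _ e2.
exists (maxn n1 n2) => n; rewrite geq_max => /andP[/H1 H3 /H2 H4] z.
rewrite opprD addrACA; apply: le_trans (ler_normD _ _) _.
by have := H3 z; have := H4 z; lra.
Qed.

Lemma ulimM (V : Type) (u v : nat -> V -> R) f g (A B : R) :
  (forall z, `|f z| <= A) -> (forall z, `|g z| <= B) ->
  ulim u f -> ulim v g -> ulim (fun n z => u n z * v n z) (fun z => f z * g z).
Proof.
move=> fA gB uf vg e e0.
pose A' := `|A| + 1; pose B' := `|B| + 1.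
have A0 : 0 < A' by rewrite ltr_pwDr.
have B0 : 0 < B' by rewrite ltr_pwDr.
pose d := Num.min 1 (e / (A' + B')).
have AB : 0 < A' + B' by rewrite addr_gt0.
have d0 : 0 < d by rewrite lt_min ltr01 divr_gt0.
have [n1 H1] := uf _ d0; have [n2 H2] := vg _ d0.
exists (maxn n1 n2) => n; rewrite geq_max => /andP[/H1 H3 /H2 H4] z.
have -> : u n z * v n z - f z * g z = (u n z - f z) * g z + u n z * (v n z - g z) by ring.
apply: le_trans (ler_normD _ _) _; rewrite !normrM.
have d1 : d <= 1 by rewrite ge_min lexx.
have de : d * (A' + B') <= e by rewrite -ler_pdivlMr // ge_min lexx orbT.
have gB' : `|g z| <= B' by apply: le_trans (gB z) _; rewrite /B'; have := ler_norm B; lra.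
have uA' : `|u n z| <= A'.
  have -> : u n z = (u n z - f z) + f z by ring.
  apply: le_trans (ler_normD _ _) _; have := H3 z; have := fA z; have := ler_norm A; rewrite /A'; lra.
apply: (@le_trans _ _ (d * B' + A' * d)); last by rewrite [A' * d]mulrC -mulrDr addrC.
by apply: lerD; apply: ler_pM.
Qed.

Lemma ulimZ (V : Type) (u : nat -> V -> R) f (c : R) :
  ulim u f -> ulim (fun n z => c * u n z) (fun z => c * f z).
Proof.
move=> uf e e0; pose c' := `|c| + 1; have c0 : 0 < c' by rewrite ltr_pwDr.
have [n0 H] := uf _ (divr_gt0 e0 c0); exists n0 => n nn z.
rewrite -mulrBr normrM; apply: (@le_trans _ _ (c' * `|u n z - f z|)).
  by rewrite ler_wpM2r // lerDl.
by rewrite mulrC -ler_pdivlMr //; exact: H.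
Qed.

Lemma ulim_unique (V : Type) (u : nat -> V -> R) f g : ulim u f -> ulim u g -> f =1 g.
Proof.
move=> uf ug z; apply/eqP; rewrite -subr_eq0 -normr_le0.
apply/ler_addgt0Pr => e e0; rewrite add0r.
have e2 : 0 < e / 2 by rewrite divr_gt0.
have [n1 H1] := uf _ e2; have [n2 H2] := ug _ e2.
have := H1 (maxn n1 n2) (leq_maxl _ _) z; have := H2 (maxn n1 n2) (leq_maxr _ _) z.
rewrite distrC => a b.
have -> : f z - g z = (f z - u (maxn n1 n2) z) - (g z - u (maxn n1 n2) z) by ring.
apply: le_trans (ler_normB _ _) _; rewrite (distrC (f z)) ; lra.
Qed.

Lemma ulim_comp (V W : Type) (h : W -> V) (u : nat -> V -> R) f :
  ulim u f -> ulim (fun n => u n \o h) (f \o h).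
Proof. by move=> uf e /uf[n0 H]; exists n0 => n nn z; exact: H. Qed.

Lemma ulim_bound (V : Type) (u : nat -> V -> R) f (C : R) :
  ulim u f -> (forall n z, `|u n z| <= C) -> forall z, `|f z| <= C.
Proof.
move=> uf uC z; apply/ler_addgt0Pr => e e0.
have [n0 /(_ n0 (leqnn _) z)] := uf _ e0; rewrite distrC => H.
have -> : f z = (f z - u n0 z) + u n0 z by ring.
apply: le_trans (ler_normD _ _) _; have := uC n0 z; lra.
Qed.

Lemma ulim_continuous (V : topologicalType) (u : nat -> V -> R) f :
  ulim u f -> (forall n, continuous (u n)) -> continuous f.
Proof.
move=> uf cu z; apply/cvgrPdist_le => e e0.
have e3 : 0 < e / 3 by rewrite divr_gt0.
have [n0 /(_ n0 (leqnn _)) H] := uf _ e3.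
have /cvgrPdist_le/(_ _ e3) := cu n0 z; apply: filterS => y uy.
have -> : f z - f y = (u n0 z - u n0 y) - (u n0 z - f z) + (u n0 y - f y) by ring.
apply: le_trans (ler_normD _ _) _; apply: le_trans (lerD (ler_normB _ _) (lexx _)) _.
have := H z; have := H y; lra.
Qed.

Lemma ulim_periodic (V : zmodType) (u : nat -> V -> R) f p :
  ulim u f -> (forall n, periodic (u n) p) -> periodic f p.
Proof.
move=> uf up z; have H := @ulim_comp V V (fun z => z + p) u f uf.
have H' : ulim u (f \o +%R^~ p) by apply: ulim_ext H => n y /=; exact: up.
exact: (ulim_unique H' uf z).
Qed.

Lemma Rint_approx0 d (T : measurableType d) (mu : {measure set T -> \bar R}) (D : set T)
    (h : T -> R) : measurable D -> (mu D < +oo)%E -> mu.-integrable D (EFin \o h) ->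
  (forall e : R, 0 < e -> exists k : T -> R, [/\ mu.-integrable D (EFin \o k),
     \int[mu]_(x in D) k x = 0 & forall x, D x -> `|h x - k x| <= e]) ->
  \int[mu]_(x in D) h x = 0.
Proof.
move=> mD fD hi H; apply/eqP; rewrite -normr_le0; apply/ler_addgt0Pr => e e0; rewrite add0r.
(* [+ 1] keeps [M] positive when [D] is a null set. *)
pose M := fine (mu D) + 1.
have M0 : 0 < M by rewrite /M ltr_pwDr // fine_ge0.
have [k [ki k0 hk]] := H _ (divr_gt0 e0 M0).
have hki : mu.-integrable D (EFin \o (fun x => h x - k x)) by have := integrableB mD hi ki; apply: eq_integrable.
rewrite -[X in `|X|]subr0 -k0 -RintegralB //.
apply: le_trans (le_normr_Rintegral mD hki) _.
apply: (@le_trans _ _ (\int[mu]_(x in D) (cst (e / M) x))).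
  apply: le_Rintegral => //.
    exact: integrable_norm hki.
  apply: measurable_bounded_integrable => //; exists (e / M); split; first exact: num_real.
  by move=> x ex y _ /=; rewrite gtr0_norm ?divr_gt0 // ltW.
rewrite Rintegral_cst // -mulrA ger_pMr // mulrC ler_pdivrMr // mul1r /M lerDl //.
Qed.

End UniformLimits.

Section WeakDerivatives.
Variable R : realType.
Notation leb := (@lebesgue_measure R).
Notation leb2 := (leb \x leb)%E.
Notation leb3 := (leb2 \x leb)%E.

Lemma continuousM_ (V : topologicalType) (f g : V -> R) :
  continuous f -> continuous g -> continuous (fun z => f z * g z).
Proof. by move=> cf cg z; apply: continuousM; [exact: cf|exact: cg]. Qed.

Lemma continuousD_ (V : topologicalType) (f g : V -> R) :
  continuous f -> continuous g -> continuous (fun z => f z + g z).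
Proof. by move=> cf cg z; apply: continuousD; [exact: cf|exact: cg]. Qed.

Lemma approx_product (V : topologicalType) (D : set V) (u du : nat -> V -> R) f g phi dphi :
  compact D -> continuous phi -> continuous dphi -> ulim u f -> ulim du g ->
  forall e : R, 0 < e -> exists n, forall x, D x ->
    `|(f x * dphi x + g x * phi x) - (u n x * dphi x + du n x * phi x)| <= e.
Proof.
move=> cD cp cdp uf ug e e0.
have [A HA] := cont_compact_bounded cD cp; have [B HB] := cont_compact_bounded cD cdp.
pose M := `|A| + `|B| + 1; have M0 : 0 < M by rewrite ltr_pwDr // addr_ge0.
have [n1 H1] := uf _ (divr_gt0 e0 M0); have [n2 H2] := ug _ (divr_gt0 e0 M0).
exists (maxn n1 n2) => x Dx; set n := maxn _ _.
have -> : (f x * dphi x + g x * phi x) - (u n x * dphi x + du n x * phi x) =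
  - ((u n x - f x) * dphi x + (du n x - g x) * phi x) by ring.
rewrite normrN; apply: le_trans (ler_normD _ _) _; rewrite !normrM.
apply: (@le_trans _ _ (e / M * `|B| + e / M * `|A|)).
  apply: lerD; apply: ler_pM => //.
  - by apply: H1; exact: leq_maxl.
  - exact: le_trans (HB x Dx) (ler_norm _).
  - by apply: H2; exact: leq_maxr.
  - exact: le_trans (HA x Dx) (ler_norm _).
rewrite -mulrDr mulrAC ler_pdivrMr // ler_pM2l // /M; lra.
Qed.

Lemma smooth_derive (V : normedModType R) (phi : V -> R) (e : V) : smooth phi ->
  [/\ continuous phi, continuous (fun x => 'D_e phi x) &
   forall x, is_derive x e phi ('D_e phi x)].
Proof.
move=> sp; have [cp _] := sp 0%N; have [_ /(_ e)[dp [cdp _]]] := sp 1%N.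
by split=> // x; split=> //; exact: dp.
Qed.

Lemma is_deriveM_ (V : normedModType R) (f g : V -> R) (x e : V) (a b : R) :
  is_derive x e f a -> is_derive x e g b ->
  is_derive x e (fun z => f z * g z) (f x * b + a * g x).
Proof.
move=> fa gb; have H := is_deriveM fa gb.
by apply: is_derive_eq; rewrite [X in _ + X]mulrC.
Qed.

Lemma periodicM (V : zmodType) (f g : V -> R) p :
  periodic f p -> periodic g p -> periodic (fun z => f z * g z) p.
Proof. by move=> fp gp z; rewrite fp gp. Qed.

(** The claim is that [f * D phi + g * phi] has integral zero. On the torus it is a uniform limit of
    the derivatives of the periodic functions [u n * phi]. *)
Lemma weak_dx_ulim j (u du : nat -> plane R -> R) f g :
  (forall n, continuous (u n)) -> (forall n, continuous (du n)) ->
  (forall n, torus_fun (u n)) -> (forall n, torus_fun (du n)) ->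
  (forall n x, is_derive x (dx R j) (u n) (du n x)) ->
  ulim u f -> ulim du g -> weak_dx j f g.
Proof.
move=> cu cdu pu pdu dudu uf dug.
have cf := ulim_continuous uf cu; have cg := ulim_continuous dug cdu.
split.
- by move=> i; apply: ulim_periodic uf _ => n; exact: pu.
- by move=> i; apply: ulim_periodic dug _ => n; exact: pdu.
- exact: cont_integrable2.
- exact: cont_integrable2.
move=> phi sphi pphi; have [cp cdp dp] := smooth_derive (dx R j) sphi.
apply/eqP; rewrite -subr_eq0 opprK -RintegralD; first last.
- by apply: cont_integrable2; exact: continuousM_.
- by apply: cont_integrable2; exact: continuousM_.
- exact: measurable_torus.
apply/eqP; apply: Rint_approx0.
- exact: measurable_torus.
- exact: leb2_torus_fin.
- by apply: cont_integrable2; apply: continuousD_; exact: continuousM_.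
move=> e e0; have [n Hn] := approx_product (@compact_torus R) cp cdp uf dug e0.
exists (fun x => u n x * 'D_(dx R j) phi x + du n x * phi x).
have ck : continuous (fun x => u n x * 'D_(dx R j) phi x + du n x * phi x).
  by apply: continuousD_; exact: continuousM_.
split=> //; first exact: cont_integrable2.
have pM : torus_fun (fun x => u n x * phi x).
  by move=> i; apply: periodicM; [exact: pu|exact: pphi].
by rewrite /Rintegral (int_dx0 ck pM (fun x => is_deriveM_ (dudu n x) (dp x))).
Qed.

(** The vanishing of integrals of derivatives along [e] is assumed, so that space and time
    directions share one proof. *)
Lemma weak_deriv_ulim T (e : spacetime R) (u du : nat -> spacetime R -> R) f g :
  (forall psi h : spacetime R -> R, continuous h -> torus_time_fun T psi ->
    (forall x, is_derive x e psi (h x)) ->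
    (\int[leb3]_(x in torus_time T) (h x)%:E = 0)%E) ->
  (forall n, continuous (u n)) -> (forall n, continuous (du n)) ->
  (forall n, torus_time_fun T (u n)) -> (forall n, torus_time_fun T (du n)) ->
  (forall n x, is_derive x e (u n) (du n x)) ->
  ulim u f -> ulim du g -> weak_deriv T e f g.
Proof.
move=> Hint cu cdu pu pdu dudu uf dug.
have cf := ulim_continuous uf cu; have cg := ulim_continuous dug cdu.
have per (v : nat -> spacetime R -> R) h : ulim v h ->
    (forall n, torus_time_fun T (v n)) -> torus_time_fun T h.
  by move=> vh pv; split=> [i|]; apply: ulim_periodic vh _ => n; have [] := pv n.
split.
- exact: per uf pu.
- exact: per dug pdu.
- exact: cont_integrable3.
- exact: cont_integrable3.
move=> phi sphi pphi; have [cp cdp dp] := smooth_derive e sphi.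
apply/eqP; rewrite -subr_eq0 opprK -RintegralD; first last.
- by apply: cont_integrable3; exact: continuousM_.
- by apply: cont_integrable3; exact: continuousM_.
- exact: measurable_torus_time.
apply/eqP; apply: Rint_approx0.
- exact: measurable_torus_time.
- exact: leb3_torus_fin.
- by apply: cont_integrable3; apply: continuousD_; exact: continuousM_.
move=> d d0; have [n Hn] := approx_product (@compact_torus_time R T) cp cdp uf dug d0.
exists (fun x => u n x * 'D_e phi x + du n x * phi x).
have ck : continuous (fun x => u n x * 'D_e phi x + du n x * phi x).
  by apply: continuousD_; exact: continuousM_.
split=> //; first exact: cont_integrable3.
have pM : torus_time_fun T (fun x => u n x * phi x).
  by have [pu1 pu2] := pu n; have [pp1 pp2] := pphi; split=> [i|]; apply: periodicM.
by rewrite /Rintegral (Hint _ _ ck pM (fun x => is_deriveM_ (dudu n x) (dp x))).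
Qed.

End WeakDerivatives.

(** * Trigonometric polynomials *)

Section TrigonometricPolynomials.
Variables (R : realType) (Om : R).
Implicit Types (p q k : Z3) (a b : Z3 -> R) (z e : spacetime R).

Definition phase k z : R := k.1.1%:~R * z.1.1 + k.1.2%:~R * z.1.2 + Om * k.2%:~R * z.2.
(* Hartley's real basis: [d cas_k = phase k * cas_(-k)]. *)
Definition cas k z : R := cos (phase k z) + sin (phase k z).

Lemma phaseD k q z : phase (k + q) z = phase k z + phase q z.
Proof. by rewrite /phase /= !intrD; ring. Qed.

Lemma phaseN k z : phase (- k) z = - phase k z.
Proof. by rewrite /phase /= !mulrNz; ring. Qed.

Lemma phase_line k z e (s : R) : phase k (z + s *: e) = phase k z + s * phase k e.
Proof. by rewrite /phase /= -![_ *: _]/(_ * _); ring. Qed.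

(** Four basis functions appear, one with a minus sign; the signs in [conv] and [brk] come from
    here. *)
Lemma cas_mul p q z : cas p z * cas q z =
  2^-1 * (cas (p - q) z + cas (q - p) z + cas (p + q) z - cas (- p - q) z).
Proof.
rewrite /cas !(phaseD, phaseN); move: (phase p z) (phase q z) => A B.
by rewrite !(cosD, sinD) !cosN !sinN; field.
Qed.

Lemma cas_le2 k z : `|cas k z| <= 2.
Proof.
by rewrite /cas; apply: le_trans (ler_normD _ _) _; have := cos_max (phase k z);
  have := sin_max (phase k z); lra.
Qed.

Lemma is_derive_of_line (V : normedModType R) (f : V -> R) (z e : V) (d : R) :
  is_derive (0 : R) 1 (fun s : R => f (z + s *: e)) d -> is_derive z e f d.
Proof.
move=> [df <-].
have E : (fun h : R => h^-1 *: (f (h *: e + z) - f z)) =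
  (fun h : R => h^-1 *: (f (z + (h *: (1 : R) + 0) *: e) - f (z + 0 *: e))).
  apply/funext => h; congr (_ *: (f _ - f _)); first by rewrite addr0 [h *: 1]mulr1 addrC.
  by rewrite scale0r addr0.
by split; rewrite /derivable /derive /= ?E.
Qed.

Lemma cas_derive k z e : is_derive z e (cas k) (phase k e * cas (- k) z).
Proof.
apply: is_derive_of_line; rewrite /cas.
rewrite (_ : (fun s => _) = (cos \o (fun s : R => phase k z + s * phase k e)) +
   (sin \o (fun s : R => phase k z + s * phase k e))); last first.
  by apply/funext => s /=; rewrite phase_line.
have D : is_derive (0 : R) 1 (fun s : R => phase k z + s * phase k e) (phase k e).
  have := @is_derive_id R R (0 : R) 1 => H.
  have H2 := is_deriveM H (@is_derive_cst R R R (phase k e) (0 : R) 1).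
  have H3 := is_deriveD (@is_derive_cst R R R (phase k z) (0 : R) 1) H2.
  by apply: is_derive_eq; rewrite scaler0 !add0r [_ *: 1]mulr1.
have C := @is_derive1_comp R cos (fun s : R => phase k z + s * phase k e) 0 _ _ (is_derive_cos _) D.
have S := @is_derive1_comp R sin (fun s : R => phase k z + s * phase k e) 0 _ _ (is_derive_sin _) D.
have H := is_deriveD C S.
by apply: is_derive_eq; rewrite phaseN cosN sinN mul0r addr0; ring.
Qed.

Lemma cas_continuous k : continuous (cas k).
Proof.
have cp : continuous (phase k).
  move=> z; rewrite /phase.
  apply: cvgD; last by apply: cvgM; [exact: cvg_cst|exact: cvg_snd].
  apply: cvgD; apply: cvgM; try exact: cvg_cst.
    apply: (@cvg_comp _ _ _ fst fst); [exact: cvg_fst|exact: cvg_fst].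
  apply: (@cvg_comp _ _ _ fst snd); [exact: cvg_fst|exact: cvg_snd].
move=> z; apply: cvgD.
  by apply: continuous_comp; [exact: cp|exact: continuous_cos].
by apply: continuous_comp; [exact: cp|exact: continuous_sin].
Qed.

Lemma trig_periodz (f : R -> R) (x : R) (n : int) :
  periodic f (pi *+ 2) -> f (x + n%:~R * (2 * pi)) = f x.
Proof.
move=> fp; have E : 2 * pi = pi *+ 2 :> R by rewrite mulr_natl.
rewrite E; case: n => n; first by rewrite mulr_natl periodicn.
rewrite NegzE mulrNz mulNr mulr_natl -[LHS](periodicn fp n.+1).
by rewrite subrK.
Qed.

Lemma cas_shift k z e (n : int) : phase k e = n%:~R * (2 * pi) -> cas k (z + e) = cas k z.
Proof.
move=> H; have := phase_line k z e 1; rewrite scale1r mul1r /cas => ->.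
by rewrite H !trig_periodz //; [exact: sinD2pi|exact: cosD2pi].
Qed.

Lemma cas_periodic k : Om != 0 -> torus_time_fun (2 * pi / Om) (cas k).
Proof.
move=> O0; split=> [j|] z.
  apply: (@cas_shift k _ _ (if j == 0 then k.1.1 else k.1.2)).
  by rewrite /phase /dX /dx; case: ifP => _ /=; rewrite -![_ *: _]/(_ * _); ring.
apply: (@cas_shift k _ _ k.2).
by rewrite /phase /dT /= -![_ *: _]/(_ * _); field.
Qed.

Definition ev N a z : R := \sum_(k <- box3 N) a k * cas k z.
Definition supp N a : Prop := forall k, k \notin box3 N -> a k = 0.
(** Differentiation sends [cas k] to a multiple of [cas (- k)], so the coefficient at [k] comes from
    [- k], whence the sign. *)
Definition dcoef e a k : R := - phase k e * a (- k).

Lemma supp_dcoef N e a : supp N a -> supp N (dcoef e a).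
Proof. by move=> sa k kN; rewrite /dcoef sa ?mulr0 // box3N. Qed.

Lemma ev_widen N M a z : (N <= M)%N -> supp N a -> ev M a z = ev N a z.
Proof.
move=> NM sa; apply: (@sum_reindex R _ _ _ _ id id) => //; rewrite ?box3_uniq // => k kN.
  by rewrite sa ?mul0r //; apply: contra kN; exact: box3_sub.
by rewrite sa ?mul0r.
Qed.

Lemma is_derive_sum_ (V : normedModType R) (T : Type) (s : seq T) (f : T -> V -> R)
    (df : T -> R) (x v : V) : (forall i, is_derive x v (f i) (df i)) ->
  is_derive x v (fun y => \sum_(i <- s) f i y) (\sum_(i <- s) df i).
Proof.
move=> H; elim: s => [|i s IH].
  rewrite big_nil (_ : (fun _ => _) = cst 0); last by apply/funext => y; rewrite big_nil.
  exact: is_derive_cst.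
rewrite big_cons (_ : (fun _ => _) = f i + (fun y => \sum_(j <- s) f j y)); last first.
  by apply/funext => y; rewrite big_cons.
exact: is_deriveD.
Qed.

Lemma sum_boxN N (f : Z3 -> R) : \sum_(k <- box3 N) f (- k) = \sum_(k <- box3 N) f k.
Proof.
rewrite -(big_map -%R predT f); apply: perm_big; apply: uniq_perm.
- by rewrite map_inj_uniq ?box3_uniq //; exact: oppr_inj.
- exact: box3_uniq.
by move=> k; rewrite -{1}(opprK k) mem_map ?box3N //; exact: oppr_inj.
Qed.

Lemma ev_derive N a z e : is_derive z e (ev N a) (ev N (dcoef e a) z).
Proof.
have -> : ev N (dcoef e a) z = \sum_(k <- box3 N) a k * (phase k e * cas (- k) z).
  rewrite /ev -sum_boxN; apply: eq_bigr => k _.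
  by rewrite /dcoef phaseN !opprK; ring.
apply: is_derive_sum_ => k.
have H := is_deriveM (@is_derive_cst R _ _ (a k) z e) (cas_derive k z e).
by apply: is_derive_eq; rewrite scaler0 addr0.
Qed.

Lemma ev_continuous N a : continuous (ev N a).
Proof.
rewrite /ev; elim: (box3 N) => [|k s IH] z.
  rewrite (_ : (fun _ => _) = cst 0); last by apply/funext => y; rewrite big_nil.
  exact: cvg_cst.
rewrite (_ : (fun _ => _) = fun y => a k * cas k y + \sum_(j <- s) a j * cas j y).
  by apply: cvgD; [apply: cvgM; [exact: cvg_cst|exact: cas_continuous]|exact: IH].
by apply/funext => y; rewrite big_cons.
Qed.

Lemma ev_periodic N a : Om != 0 -> torus_time_fun (2 * pi / Om) (ev N a).
Proof.
by move=> O0; split=> [j|] z; apply: eq_bigr => k _;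
  have [c1 c2] := cas_periodic k O0; rewrite ?c1 ?c2.
Qed.

Lemma ev_le N a C z : bnd (fun k => `|a k|) C -> `|ev N a z| <= 2 * C.
Proof.
move=> aC; apply: le_trans (ler_norm_sum _ _ _) _.
apply: (@le_trans _ _ (\sum_(k <- box3 N) 2 * `|a k|)).
  by apply: ler_sum => k _; rewrite normrM mulrC ler_wpM2r // cas_le2.
by rewrite -mulr_sumr ler_wpM2l // aC // box3_uniq.
Qed.

Lemma evD N a b z : ev N (fun k => a k + b k) z = ev N a z + ev N b z.
Proof. by rewrite /ev -big_split; apply: eq_bigr => k _; rewrite mulrDl. Qed.

Lemma evZ N a (c : R) z : ev N (fun k => c * a k) z = c * ev N a z.
Proof. by rewrite /ev mulr_sumr; apply: eq_bigr => k _; rewrite mulrA. Qed.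

Lemma evB N a b z : ev N (fun k => a k - b k) z = ev N a z - ev N b z.
Proof. by rewrite /ev -sumrB; apply: eq_bigr => k _; rewrite mulrBl. Qed.

Definition conv N a b k : R :=
  \sum_(q <- box3 N) 2^-1 * (a (k + q) + a (q - k) + a (k - q) - a (- (k + q))) * b q.

Lemma box3D N p q : p \in box3 N -> q \in box3 N -> p + q \in box3 (N + N).
Proof. by rewrite !mem_box3 /= => /and3P[? ? ?] /and3P[? ? ?]; apply/and3P; split; lia. Qed.

Lemma supp_conv N a b : supp N a -> supp (N + N) (conv N a b).
Proof.
move=> sa k kN; rewrite /conv big_seq big1 // => q qN.
have H p : p \in box3 N -> k != p + q /\ k != p - q /\ k != q - p /\ k != - p - q.
  move=> pN; have H (x : Z3) : x \in box3 (N + N) -> k != x.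
    by move=> xN; apply: contraNneq kN => ->.
  by do !split; apply: H; apply: box3D; rewrite ?box3N.
rewrite !sa ?addr0 ?subr0 ?mulr0 ?mul0r //; apply/negP => /H [h1 [h2 [h3 h4]]].
- by case/eqP: h4; rewrite opprK addrK.
- by case/eqP: h1; rewrite subrK.
- by case/eqP: h3; rewrite opprB addrC subrK.
- by case/eqP: h2; rewrite addrK.
Qed.

Lemma ev_mul N a b z : supp N a -> supp N b ->
  ev N a z * ev N b z = ev (N + N) (conv N a b) z.
Proof.
move=> sa sb.
(* For fixed [q] each of the four index maps in [conv] is a bijection of the lattice, and the
   doubled box contains the preimage of the small one. *)
have R1 (q : Z3) (h h' : Z3 -> Z3) : q \in box3 N -> cancel h h' -> cancel h' h ->
    (forall p, p \in box3 N -> h' p \in box3 (N + N)) ->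
    \sum_(k <- box3 (N + N)) a (h k) * cas k z = \sum_(p <- box3 N) a p * cas (h' p) z.
  move=> qN hK h'K hN; apply: (@sum_reindex R _ _ _ _ h h'); rewrite ?box3_uniq //.
  - by move=> k; rewrite hK.
  - move=> k kN; rewrite sa ?mul0r //; apply: contra kN => /hN; by rewrite hK.
  by move=> p pN; rewrite sa ?mul0r.
rewrite [RHS](_ : _ = \sum_(q <- box3 N) \sum_(p <- box3 N) a p * b q *
   (2^-1 * (cas (p - q) z + cas (q - p) z + cas (p + q) z - cas (- p - q) z))); last first.
  rewrite /ev /conv; under eq_bigr do rewrite mulr_suml.
  rewrite exchange_big /= big_seq [RHS]big_seq; apply: eq_bigr => q qN.
  rewrite [LHS](_ : _ = 2^-1 * b q * (\sum_(k <- box3 (N + N)) a (k + q) * cas k z +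
     \sum_(k <- box3 (N + N)) a (q - k) * cas k z + \sum_(k <- box3 (N + N)) a (k - q) * cas k z
     - \sum_(k <- box3 (N + N)) a (- (k + q)) * cas k z)).
    rewrite (R1 q (fun k => k + q) (fun p => p - q)) //; first last.
    - by move=> p pN; apply: box3D; rewrite ?box3N.
    - by move=> p; rewrite subrK.
    - by move=> p; rewrite addrK.
    rewrite (R1 q (fun k => q - k) (fun p => q - p)) //; first last.
    - by move=> p pN; apply: box3D; rewrite ?box3N.
    - by move=> p; rewrite opprB addrC subrK.
    - by move=> p; rewrite opprB addrC subrK.
    rewrite (R1 q (fun k => k - q) (fun p => p + q)) //; first last.
    - by move=> p pN; apply: box3D; rewrite ?box3N.
    - by move=> p; rewrite addrK.
    - by move=> p; rewrite subrK.
    rewrite (R1 q (fun k => - (k + q)) (fun p => - p - q)) //; first last.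
    - by move=> p pN; apply: box3D; rewrite ?box3N.
    - by move=> p; rewrite subrK opprK.
    - by move=> p; rewrite opprK addrK.
    rewrite -!big_split -sumrB /= mulr_sumr; apply: eq_bigr => p _; ring.
  rewrite -!big_split -sumrB /= mulr_sumr; apply: eq_bigr => p _; ring.
rewrite /ev mulr_suml exchange_big /=; apply: eq_bigr => p _.
rewrite mulr_sumr; apply: eq_bigr => q _; rewrite -cas_mul; ring.
Qed.

Lemma conv_l1 N a b A B : bnd (fun k => `|a k|) A -> bnd (fun k => `|b k|) B ->
  bnd (fun k => `|conv N a b k|) (2 * A * B).
Proof.
move=> aA bB s us.
have nI (q : Z3) : injective (fun k : Z3 => q - k) by move=> x y /addrI /oppr_inj.
have oI (q : Z3) : injective (fun k : Z3 => - (k + q)) by move=> x y /oppr_inj /addIr.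
apply: (@le_trans _ _ (\sum_(k <- s) \sum_(q <- box3 N) 2^-1 *
   (`|a (k + q)| + `|a (q - k)| + `|a (k - q)| + `|a (- (k + q))|) * `|b q|)).
  apply: ler_sum => k _; apply: le_trans (ler_norm_sum _ _ _) _.
  apply: ler_sum => q _; rewrite !normrM ler_wpM2r // ger0_norm ?invr_ge0 // ler_wpM2l ?invr_ge0 //.
  apply: le_trans (ler_normB _ _) _; rewrite lerD2r.
  apply: le_trans (ler_normD _ _) _; rewrite lerD2r; exact: ler_normD.
rewrite exchange_big /=.
apply: (@le_trans _ _ (\sum_(q <- box3 N) 2 * A * `|b q|)).
  apply: ler_sum => q _; rewrite -mulr_suml ler_wpM2r // -mulr_sumr !big_split /=.
  have h1 : \sum_(k <- s) `|a (k + q)| <= A by exact: (bnd_inj (@addIr _ q) aA).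
  have h2 : \sum_(k <- s) `|a (q - k)| <= A by exact: (bnd_inj (nI q) aA).
  have h3 : \sum_(k <- s) `|a (k - q)| <= A by exact: (bnd_inj (@addIr _ (- q)) aA).
  have h4 : \sum_(k <- s) `|a (- (k + q))| <= A by exact: (bnd_inj (oI q) aA).
  lra.
rewrite -mulr_sumr ler_wpM2l ?mulr_ge0 ?(bnd_ge0 aA) //.
by apply: bB; exact: box3_uniq.
Qed.

Lemma conv_widen N M a b k : (N <= M)%N -> supp N b -> conv M a b k = conv N a b k.
Proof.
move=> NM sb; apply: (@sum_reindex R _ _ _ _ id id) => //; rewrite ?box3_uniq // => q qN.
  by rewrite sb ?mulr0 //; apply: contra qN; exact: box3_sub.
by rewrite sb ?mulr0.
Qed.

End TrigonometricPolynomials.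

(** * Limits of sums with absolutely summable coefficients *)

Section SummableLimits.
Variables (R : realType) (Om : R).
Implicit Types (k q p : Z3) (A B : nat -> Z3 -> R) (S : nat -> nat) (z : spacetime R).

(** Cauchy in l^1 without naming a limit: the limits of interest are the functions, not their
    coefficients. *)
Definition l1c A : Prop := forall e : R, 0 < e -> exists n0 : nat,
  forall n m, (n0 <= n)%N -> (n0 <= m)%N -> bnd (fun k => `|A n k - A m k|) e.

Lemma ucauchy_ulim (V : Type) (u : nat -> V -> R) :
  (forall e : R, 0 < e -> exists n0 : nat, forall n m, (n0 <= n)%N -> (n0 <= m)%N ->
    forall v, `|u n v - u m v| <= e) -> exists f, ulim u f.
Proof.
move=> uc.
have cv (z : V) : cvgn (u ^~ z).
  apply/cauchy_cvgP/cauchy_exP => e e0.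
  have [n0 H] := uc _ (divr_gt0 e0 (ltr0Sn R 1)).
  exists (u n0 z); exists n0 => // n /= nn; rewrite /ball /=.
  apply: le_lt_trans (H n0 n (leqnn _) nn z) _.
  by rewrite ltr_pdivrMr // ltr_pMr // ltr1n.
exists (fun z : V => limn (u ^~ z)) => e e0; have [n0 H] := uc _ e0.
exists n0 => n nn z.
have /cvgrPdist_le C := cv z.
apply/ler_addgt0Pr => d d0; have [N _ HN] := C _ d0.
pose m := maxn n0 N.
have -> : u n z - limn (u ^~ z) = (u n z - u m z) - (limn (u ^~ z) - u m z) by ring.
apply: le_trans (ler_normB _ _) _; apply: lerD.
  by apply: H => //; exact: leq_maxl.
by apply: HN; exact: leq_maxr.
Qed.

Lemma l1c_ulim S A : l1c A -> (forall n, supp (S n) (A n)) ->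
  exists f, ulim (fun n => ev Om (S n) (A n)) f.
Proof.
move=> cA sA; apply: ucauchy_ulim => e e0.
have [n0 H] := cA _ (divr_gt0 e0 (ltr0Sn R 1)); exists n0 => n m nn mm z.
rewrite -(ev_widen Om z (leq_maxl (S n) (S m)) (sA n)) -(ev_widen Om z (leq_maxr (S n) (S m)) (sA m)).
by rewrite -evB; apply: le_trans (ev_le Om _ z (H n m nn mm)) _; rewrite mulrC divfK.
Qed.

Lemma fin_small (s : seq Z3) A :
  (forall k (e : R), 0 < e -> exists n0 : nat, forall n, (n0 <= n)%N -> `|A n k| <= e) ->
  forall e : R, 0 < e -> exists n0 : nat, forall n, (n0 <= n)%N -> \sum_(k <- s) `|A n k| <= e.
Proof.
move=> A0; elim: s => [|k s IH] e e0; first by exists 0%N => n _; rewrite big_nil ltW.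
have e2 : 0 < e / 2 by rewrite divr_gt0.
have [n1 H1] := A0 k _ e2; have [n2 H2] := IH _ e2.
exists (maxn n1 n2) => n; rewrite geq_max => /andP[/H1 a /H2 b].
by rewrite big_cons; lra.
Qed.

(** Coefficientwise limits identify the uniform limit: on a given finite set of modes, the Cauchy
    property compares [A n] with a later [A m] that is already small there. *)
Lemma l1c_zero S A : l1c A ->
  (forall k (e : R), 0 < e -> exists n0 : nat, forall n, (n0 <= n)%N -> `|A n k| <= e) ->
  ulim (fun n => ev Om (S n) (A n)) (fun=> 0).
Proof.
move=> cA A0 e e0; have e4 : 0 < e / 4 by rewrite divr_gt0.
have [n0 H] := cA _ e4; exists n0 => n nn z; rewrite subr0.
suff b : bnd (fun k => `|A n k|) (e / 2).
  by apply: le_trans (ev_le Om _ z b) _; rewrite mulrC divfK.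
move=> s us.
have [m mm Hm] : exists2 m, (n0 <= m)%N & \sum_(k <- s) `|A m k| <= e / 4.
  have [m Hm] := fin_small s A0 e4.
  by exists (maxn n0 m); [exact: leq_maxl|apply: Hm; exact: leq_maxr].
apply: (@le_trans _ _ (\sum_(k <- s) (`|A n k - A m k| + `|A m k|))).
  by apply: ler_sum => k _; rewrite -{1}(subrK (A m k) (A n k)) ler_normD.
rewrite big_split /=; have := H n m nn mm s us; lra.
Qed.

Lemma l1c_ext A B : (forall n k, A n k = B n k) -> l1c A -> l1c B.
Proof.
move=> AB cA e e0; have [n0 H] := cA _ e0; exists n0 => n m nn mm.
by apply: bnd_le (H n m nn mm) => k; rewrite !AB.
Qed.

Lemma l1cD A B : l1c A -> l1c B -> l1c (fun n k => A n k + B n k).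
Proof.
move=> cA cB e e0; have e2 : 0 < e / 2 by rewrite divr_gt0.
have [n1 H1] := cA _ e2; have [n2 H2] := cB _ e2.
exists (maxn n1 n2) => n m; rewrite !geq_max => /andP[a b] /andP[c d].
have -> : e = e / 2 + e / 2 by field.
apply: bnd_le (bndD (H1 n m a c) (H2 n m b d)) => k.
by rewrite opprD addrACA ler_normD.
Qed.

Lemma l1c_cst a : l1c (fun=> a).
Proof.
by move=> e e0; exists 0%N => n m _ _ s us; rewrite big1 ?ltW // => k _; rewrite subrr normr0.
Qed.

Lemma l1c_mult (g G : Z3 -> R) (h : Z3 -> Z3) (c : R) A :
  injective h -> 0 <= c -> (forall k, `|g k| <= c * `|G (h k)|) ->
  l1c (fun n k => G k * A n k) -> l1c (fun n k => g k * A n (h k)).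
Proof.
move=> hI c0 gG cA e e0; have d0 : 0 < e / (c + 1) by rewrite divr_gt0 // ltr_wpDl.
have [n0 H] := cA _ d0; exists n0 => n m nn mm.
have E : c * (e / (c + 1)) <= e.
  rewrite mulrCA ger_pMr // ler_pdivrMr; first by rewrite mul1r lerDl.
  by rewrite ltr_wpDl.
apply: bndW E _; apply: bnd_le (bndZ c0 (bnd_inj hI (H n m nn mm))) => k /=.
by rewrite -!mulrBr !normrM mulrA ler_wpM2r.
Qed.

Lemma l1c_conv (N : nat -> nat) A B (a b : R) : {homo N : n m / (n <= m)%N} ->
  (forall n, supp (N n) (A n)) -> (forall n, supp (N n) (B n)) ->
  (forall n, bnd (fun k => `|A n k|) a) -> (forall n, bnd (fun k => `|B n k|) b) ->
  l1c A -> l1c B -> l1c (fun n => conv (N n) (A n) (B n)).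
Proof.
move=> Nm sA sB bA bB cA cB e e0.
have a0 := bnd_ge0 (bA 0%N); have b0 := bnd_ge0 (bB 0%N).
have M0 : 0 < 2 * (a + b) + 1 by lra.
have [n1 H1] := cA _ (divr_gt0 e0 M0); have [n2 H2] := cB _ (divr_gt0 e0 M0).
exists (maxn n1 n2) => n m; rewrite !geq_max => /andP[na nb] /andP[ma mb].
pose d := e / (2 * (a + b) + 1).
have E : 2 * d * b + 2 * a * d <= e.
  have -> : 2 * d * b + 2 * a * d = e * (2 * (a + b) / (2 * (a + b) + 1)) by rewrite /d; ring.
  by rewrite ger_pMr // ler_pdivrMr // mul1r lerDl.
apply: bndW E _; pose M := maxn (N n) (N m).
have h1 := conv_l1 M (H1 n m na ma) (bB n).
have h2 := conv_l1 M (bA m) (H2 n m nb mb).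
apply: bnd_le (bndD h1 h2) => k.
rewrite -(conv_widen (A n) k (leq_maxl _ _ : (N n <= M)%N) (sB n)).
rewrite -(conv_widen (A m) k (leq_maxr _ _ : (N m <= M)%N) (sB m)).
apply: le_trans (ler_normD _ _); rewrite le_eqVlt; apply/orP; left; apply/eqP; congr (`|_|).
rewrite /conv -sumrB -big_split /=; apply: eq_bigr => q _; ring.
Qed.

(** Squares bounded by [C / 4 ^ n] give increments of order [2 ^ (- n)], uniformly in the mode;
    [C + 1] serves as a bound for the square root of [C]. *)
Lemma geom_cauchy (w : nat -> Z3 -> R) (C : R) : 0 <= C ->
  (forall n, bnd (fun p => (w n.+1 p - w n p) ^+ 2) (C / (4 ^ n)%:R)) ->
  forall e : R, 0 < e -> exists n0 : nat, forall n m, (n0 <= n)%N -> (n0 <= m)%N ->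
    forall p, `|w n p - w m p| <= e.
Proof.
move=> C0 wb.
have p2 n : 0 < (2 ^ n)%:R :> R by rewrite ltr0n expn_gt0.
have st n p : `|w n.+1 p - w n p| <= (C + 1) / (2 ^ n)%:R.
  rewrite -(@ler_pXn2r _ 2) ?nnegrE ?divr_ge0 ?addr_ge0 //.
  rewrite real_normK ?num_real //; move: (bnd1 p (wb n)) => /le_trans; apply.
  rewrite expr_div_n -natrX -expnM mulnC expnM ler_wpM2r ?invr_ge0 //.
  by rewrite sqrrD; have := sqr_ge0 C; lra.
have tel n i p : `|w (n + i)%N p - w n p| <= 2 * (C + 1) / (2 ^ n)%:R - 2 * (C + 1) / (2 ^ (n + i))%:R.
  elim: i => [|i IH]; first by rewrite addn0 !subrr normr0.
  rewrite addnS; set m := (n + i)%N in IH *.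
  have -> : w m.+1 p - w n p = (w m.+1 p - w m p) + (w m p - w n p) by ring.
  apply: le_trans (ler_normD _ _) _; apply: le_trans (lerD (st m p) IH) _.
  rewrite expnS natrM; set z := (2 ^ m)%:R; have z0 : 0 < z by exact: p2.
  have -> : 2 * (C + 1) / (2 * z) = (C + 1) / z by field; rewrite gt_eqF.
  lra.
move=> e e0; have M0 : 0 < 4 * (C + 1) / e by rewrite divr_gt0 // mulr_gt0 // ltr_wpDl.
have [n0 Hn0] : exists n0 : nat, 4 * (C + 1) / e <= (2 ^ n0)%:R.
  exists (Num.bound (4 * (C + 1) / e)); apply: le_trans (ltW (archi_boundP (ltW M0))) _.
  by rewrite ler_nat ltnW // ltn_expl.
have bd n p : (n0 <= n)%N -> `|w n p - w n0 p| <= e / 2.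
  move=> nn; rewrite -(subnKC nn); apply: le_trans (tel _ _ _) _.
  apply: (@le_trans _ _ (2 * (C + 1) / (2 ^ n0)%:R)).
    by rewrite gerBl divr_ge0 ?mulr_ge0 ?addr_ge0 // ltW.
  rewrite ler_pdivrMr //; move: Hn0; rewrite ler_pdivrMr //; lra.
exists n0 => n m nn mm p.
have -> : w n p - w m p = (w n p - w n0 p) - (w m p - w n0 p) by ring.
by apply: le_trans (ler_normB _ _) _; have := bd n p nn; have := bd m p mm; lra.
Qed.

(** Boundedness in the weighted l^2 norm and convergence of single coefficients upgrade to
    convergence in l^1. Outside a finite [T] the sum is small by Cauchy-Schwarz, [mu] being square
    summable; on [T] the convergence of each coefficient is enough. *)
Lemma l1c_weight (mu W : Z3 -> R) (w : nat -> Z3 -> R) (K C : R) :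
  bnd (fun k => mu k ^+ 2) K -> (forall n, bnd (fun k => (W k * w n k) ^+ 2) C) ->
  (forall e : R, 0 < e -> exists n0 : nat, forall n m, (n0 <= n)%N -> (n0 <= m)%N ->
    forall p, `|w n p - w m p| <= e) ->
  l1c (fun n k => mu k * W k * w n k).
Proof.
move=> muK wC wc e e0.
have C0 := bnd_ge0 (wC 0%N).
(* Parameter of the mean inequality: the tail of [mu^2] is taken below [t * (e / 2)], while the
   bounded factors cost [t * (4 * C) <= e / 2]. *)
pose t := e / (4 * C + 1) / 2; have C1 : 0 < 4 * C + 1 by lra.
have t0 : 0 < t by rewrite /t !divr_gt0.
have tC : t * (4 * C) <= e / 2.
  by rewrite /t mulrAC ler_wpM2r ?invr_ge0 // mulrAC ler_pdivrMr // ler_wpM2l ?ltW //; lra.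
have [T [uT HT]] := bnd_tail (fun k => sqr_ge0 (mu k)) muK (mulr_gt0 t0 (divr_gt0 e0 (ltr0Sn R 1))).
pose L := \sum_(k <- T) `|mu k * W k| + 1.
have L0 : 0 < L by rewrite ltr_wpDl // sumr_ge0.
have [n0 Hn0] := wc _ (divr_gt0 (divr_gt0 e0 (ltr0Sn R 3)) L0).
exists n0 => n m nn mm s us.
rewrite (bigID (fun k => k \in T)) /= -big_filter -[X in _ + X]big_filter.
have P1 : \sum_(k <- [seq k <- s | k \in T]) `|mu k * W k * w n k - mu k * W k * w m k| <= e / 4.
  apply: (@le_trans _ _ (\sum_(k <- [seq k <- s | k \in T]) `|mu k * W k| * (e / 4 / L))).
    by apply: ler_sum => k _; rewrite -mulrBr normrM ler_wpM2l //; exact: Hn0.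
  have SL : \sum_(k <- [seq k <- s | k \in T]) `|mu k * W k| <= L.
    apply: le_trans (_ : \sum_(k <- T) `|mu k * W k| <= _); last by rewrite lerDl.
    apply: sum_sub_le => [k||k]; [exact: normr_ge0|exact: filter_uniq|].
    by rewrite mem_filter => /andP[].
  rewrite -mulr_suml; apply: le_trans (ler_wpM2r _ SL) _.
    by rewrite !divr_ge0 ?(ltW e0) ?(ltW L0).
  by rewrite mulrC divfK // gt_eqF.
pose s' := [seq k <- s | k \notin T]; have us' : uniq s' by exact: filter_uniq.
have P2 : \sum_(k <- s') `|mu k * W k * w n k - mu k * W k * w m k| <= e / 2.
  have Hs : \sum_(k <- s') mu k ^+ 2 <= t * (e / 2).
    by apply: HT => // k; rewrite mem_filter => /andP[].
  apply: (@le_trans _ _ (\sum_(k <- s') 2^-1 * (t^-1 * mu k ^+ 2 +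
      t * (2 * ((W k * w n k) ^+ 2 + (W k * w m k) ^+ 2))))).
    apply: ler_sum => k _.
    have -> : mu k * W k * w n k - mu k * W k * w m k = mu k * (W k * w n k - W k * w m k) by ring.
    rewrite normrM; set u := W k * w n k; set v := W k * w m k.
    apply: (@le_trans _ _ (2^-1 * (t^-1 * mu k ^+ 2 + t * `|u - v| ^+ 2))).
      rewrite -(real_normK (num_real (mu k))); set a := `|mu k|; set b := `|u - v|.
      have : 0 <= t^-1 * (a - t * b) ^+ 2 by rewrite mulr_ge0 ?sqr_ge0 // invr_ge0 ltW.
      have -> : t^-1 * (a - t * b) ^+ 2 = t^-1 * a ^+ 2 - 2 * (a * b) + t * b ^+ 2.
        by field; rewrite gt_eqF.
      lra.
    rewrite ler_wpM2l ?invr_ge0 // lerD2l ler_wpM2l ?(ltW t0) // real_normK ?num_real //.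
    by have := sqrD2_le u (- v); rewrite sqrrN.
  rewrite -mulr_sumr big_split /= -!mulr_sumr big_split /=.
  have h1 := wC n s' us'; have h2 := wC m s' us'.
  have h3 : t^-1 * \sum_(k <- s') mu k ^+ 2 <= e / 2.
    by rewrite ler_pdivrMl.
  have h4 := ler_wpM2l (ltW t0) (lerD h1 h2); lra.
have -> : e = e / 4 + e / 2 + e / 4 by field.
by rewrite -[leLHS]addr0 lerD ?lerD // divr_ge0 // ltW.
Qed.

End SummableLimits.

(** * Velocity and pressure *)

Section Velocity.
Variables (R : realType) (Om : R).
Implicit Types (k q p : Z3) (x a b : Z3 -> R).
Local Notation k1 k := ((k : Z3).1.1%:~R : R).
Local Notation k2 k := ((k : Z3).1.2%:~R : R).

(** The velocity is [(- d_2 psi, d_1 psi)]; the reflection of [k] comes from differentiating in the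
    real basis. *)
Definition vel1 x k : R := k2 k * stream x (- k).
Definition vel2 x k : R := - k1 k * stream x (- k).

Lemma k1N k : k1 (- k) = - k1 k. Proof. exact: mulrNz. Qed.
Lemma k2N k : k2 (- k) = - k2 k. Proof. exact: mulrNz. Qed.

Lemma ksqE k : ksq R k = k1 k ^+ 2 + k2 k ^+ 2.
Proof. by rewrite /ksq intrD !rmorphXn. Qed.

Lemma k1_hw k : `|k1 k| <= hw R k.
Proof. by rewrite -intr_norm /hw lerDl ler0z. Qed.

Lemma k2_hw k : `|k2 k| <= hw R k.
Proof. by rewrite -intr_norm /hw lerDr ler0z. Qed.

Lemma l_rw k : `|k.2%:~R| <= rw R k.
Proof. by rewrite -intr_norm /rw lerDr hw_ge0. Qed.

Lemma hw0_k k : hw R k = 0 -> k1 k = 0 /\ k2 k = 0.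
Proof. by move=> /eqP; rewrite hw_eq0 => /eqP ->. Qed.

Lemma hw_ksqV k : hw R k != 0 -> hw R k / ksq R k <= 2 / hw R k.
Proof.
move=> h0; have kp := ksq_gt0 h0; have hp : 0 < hw R k by rewrite lt0r h0 hw_ge0.
by rewrite ler_pdivrMr // mulrAC ler_pdivlMr // -expr2 hw_ksq.
Qed.

(** [rot (w u^perp) = div (w u) = u.grad w]: the curl of the nonlinearity of the momentum equation
    is the transport term of the vorticity equation. *)
Lemma rot_conv N x k :
  - k1 k * conv N (vel1 x) x (- k) - k2 k * conv N (vel2 x) x (- k) =
  \sum_(q <- box3 N) brk (stream x) k q * x q.
Proof.
rewrite /conv !mulr_sumr -sumrB; apply: eq_bigr => q _.
rewrite mulrA [k2 k * (_ * _)]mulrA -mulrBl; congr (_ * _).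
have i1 (p r : Z3) : k1 (p + r) = k1 p + k1 r by exact: intrD.
have i2 (p r : Z3) : k2 (p + r) = k2 p + k2 r by exact: intrD.
have wE : wedge R k q = k1 k * k2 q - k2 k * k1 q by rewrite /wedge intrB !intrM.
rewrite /brk wE /vel1 /vel2 !(i1, i2, k1N, k2N).
have -> : - (- k + q) = k - q by rewrite opprD opprK.
have -> : - (q - - k) = - (k + q) by rewrite opprK addrC.
have -> : - (- k - q) = k + q by rewrite -opprD opprK.
by rewrite opprB; field.
Qed.

Lemma sum_box_anti N (f : Z3 -> R) (h : Z3 -> Z3) : involutive h ->
  (forall q, f (h q) = - f q) -> supp N f -> \sum_(q <- box3 N) f q = 0.
Proof.
move=> hh fh sf.
have : \sum_(q <- box3 N) f q = \sum_(q <- box3 N) - f q.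
  apply: (@sum_reindex R _ _ _ _ h h) => //; rewrite ?box3_uniq //.
  - by move=> q; rewrite fh opprK.
  - by move=> q qN; rewrite sf // oppr0.
by rewrite sumrN; lra.
Qed.

(* [w u_j] has zero mean in space: [w u^perp = div (u * u) - grad (|u|^2 / 2)]. *)
Lemma conv_mean N (c : Z3 -> R) x (l : int) : supp N x ->
  (forall k q, k.1 = - q.1 -> c k = - c q) ->
  conv N (fun k => c k * x (- k)) x (0, l) = 0.
Proof.
move=> sx cN; pose k : Z3 := (0, l).
have cE p q : p.1 = q.1 -> c p = c q.
  by move=> pq; rewrite (cN p (- q)) ?(cN (- q) q) ?opprK.
have xx p q : p \notin box3 N -> c q * (x p * x q) = 0 by move=> /sx ->; rewrite mul0r mulr0.
have xq p q : q \notin box3 N -> c q * (x p * x q) = 0 by move=> /sx ->; rewrite !mulr0.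
(* Under [q |-> - (k + q)] the product of the two values of [x] is symmetric and [c] changes sign,
   since [k] has no spatial part; likewise for [q |-> k - q] in [T3]. The two remaining sums are
   exchanged by the shift by [k]. *)
have T1 : \sum_(q <- box3 N) c q * (x (- (k + q)) * x q) = 0.
  apply: (@sum_box_anti N _ (fun q => - (k + q))) => [q|q|q qN].
  - by rewrite opprB addrC addKr.
  - rewrite [X in x X](_ : _ = q); last by rewrite opprB addrC addKr.
    by rewrite (cN _ q) /= ?opprD ?oppr0 ?add0r //; ring.
  exact: xq.
have T3 : \sum_(q <- box3 N) c q * (x (k - q) * x q) = 0.
  apply: (@sum_box_anti N _ (fun q => k - q)) => [q|q|q qN].
  - by rewrite opprB addrC subrK.
  - rewrite [X in x X](_ : _ = q); last by rewrite opprB addrC subrK.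
    by rewrite (cN _ q) /= ?add0r //; ring.
  exact: xq.
have T24 : \sum_(q <- box3 N) c q * (x (k + q) * x q) = \sum_(q <- box3 N) c q * (x (q - k) * x q).
  apply: (@sum_reindex R _ _ _ _ (fun q => k + q) (fun q => q - k)); rewrite ?box3_uniq //.
  - by move=> q; rewrite addrAC subrr add0r.
  - by move=> q; rewrite addrC subrK.
  - by move=> q; rewrite (cE (k + q) q) /= ?add0r // addrAC subrr add0r; ring.
  - by move=> q; exact: xq.
  - by move=> q; exact: xq.
rewrite /conv.
rewrite (_ : \sum_(q <- box3 N) _ = 2^-1 * (\sum_(q <- box3 N) c q * (x (- (k + q)) * x q)
  + \sum_(q <- box3 N) c q * (x (k - q) * x q)
  - \sum_(q <- box3 N) c q * (x (q - k) * x q)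
  + \sum_(q <- box3 N) c q * (x (k + q) * x q))); last first.
  rewrite -!big_split -sumrN -!big_split mulr_sumr /=; apply: eq_bigr => q _.
  rewrite -/k (cE (k + q) q) /= ?add0r // (cE (q - k) q) /= ?subr0 // (cN (k - q) q) /= ?add0r //.
  rewrite (cN (- (k + q)) q) /= ?add0r // opprK !opprB; ring.
by rewrite T1 T3 T24; ring.
Qed.

Definition trunc N a k : R := if k \in box3 N then a k else 0.

Lemma supp_trunc N a : supp N (trunc N a).
Proof. by move=> k kN; rewrite /trunc (negPf kN). Qed.

Lemma ev_trunc N a z : ev Om N (trunc N a) z = ev Om N a z.
Proof. by rewrite /ev big_seq [RHS]big_seq; apply: eq_bigr => k kN; rewrite /trunc kN. Qed.

Lemma seq_box (s : seq Z3) : exists N, {subset s <= box3 N}.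
Proof.
elim: s => [|k s [N HN]]; first by exists 0%N.
exists (N + (`|k.1.1| + `|k.1.2| + `|k.2|))%N => p; rewrite inE => /orP[/eqP ->|ps].
  by rewrite mem_box3; apply/and3P; split; lia.
by apply: (box3_sub (N := N)); [exact: leq_addr|exact: HN].
Qed.

Lemma l1c_trunc (S : nat -> nat) a C : (forall n, (n <= S n)%N) ->
  bnd (fun k => `|a k|) C -> l1c (fun n => trunc (S n) a).
Proof.
move=> nS aC e e0.
have [T [uT HT]] := bnd_tail (fun k => normr_ge0 (a k)) aC e0.
have [N HN] := seq_box T; exists N => n m nn mm s us.
rewrite (bigID (fun k => k \in T)) /= [X in X + _]big1 ?add0r => [|k kT]; last first.
  have kb : k \in box3 N by exact: HN.
  rewrite /trunc (box3_sub (leq_trans nn (nS n)) kb) (box3_sub (leq_trans mm (nS m)) kb).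
  by rewrite subrr normr0.
rewrite -big_filter; apply: le_trans (HT _ (filter_uniq _ us) _) => [|k].
  apply: ler_sum => k _; rewrite /trunc.
  by case: ifP; case: ifP; rewrite ?subrr ?subr0 ?sub0r ?normrN ?normr0.
by rewrite mem_filter => /andP[].
Qed.

End Velocity.

(** * Time slices and the W^1_oo norm *)

Section Slices.
Variables (R : realType) (Om : R).
Local Notation leb := (@lebesgue_measure R).
Local Notation leb2 := (leb \x leb)%E.

Lemma slice_continuous (V W : topologicalType) (f : V * W -> R) (t : W) :
  continuous f -> continuous (fun x => f (x, t)).
Proof.
move=> cf x; apply: (@continuous_comp _ _ _ (fun x : V => (x, t)) f); last exact: cf.
exact: cont_pairl.
Qed.

Lemma slice_is_derive (f : spacetime R -> R) (e x : plane R) (t d : R) :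
  is_derive (x, t) (e, 0) f d -> is_derive x e (fun y => f (y, t)) d.
Proof.
move=> H; apply: is_derive_of_line.
have := @is_derive_line R _ f (x, t) (e, 0) 0 d.
rewrite scale0r addr0 => /(_ H).
by rewrite (_ : (fun s : R => f ((x, t) + s *: (e, 0))) = (fun s : R => f (x + s *: e, t))) //;
   apply/funext => s; congr f; congr pair; rewrite /= scaler0 addr0.
Qed.

Lemma slice_torus T (f : spacetime R -> R) (t : R) : torus_time_fun T f ->
  torus_fun (fun x => f (x, t)).
Proof.
move=> [pf _] j x; rewrite -(pf j (x, t)); congr f; congr pair.
by rewrite /= scaler0 addr0.
Qed.

Lemma ess_le d (T : measurableType d) (mu : {measure set T -> \bar R}) (f : T -> \bar R) (c : R) :
  0 <= c -> (forall z, (`|f z| <= c%:E)%E) -> (Lnorm mu +oo f <= c%:E)%E.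
Proof.
move=> c0 fc; rewrite unlock; case: ifP => _; last by rewrite lee_fin.
by apply/ess_sup_inf.ess_supP; apply: nearW => z; exact: fc.
Qed.

Lemma row_norm_le (u : 'rV[R]_2) (c : R) : 0 <= c -> (forall i, `|u 0 i| <= c) -> `|u| <= c.
Proof.
move=> c0 uc; rewrite /Num.Def.normr /= mx_normrE.
by apply: bigmax_le => // -[i j] _ /=; rewrite (ord1 i).
Qed.

(** [W1oo_norm] is an infimum over gradients, so a single gradient bounds it. The absolute value is
    the one taken by the outer essential supremum, and [3] counts the field and its two
    derivatives. *)
Lemma W1oo_le (u : plane R -> 'rV[R]_2) (Du : 'I_2 -> plane R -> 'rV[R]_2) (c : R) :
  0 <= c -> (forall j i, weak_dx j (fun x => u x 0 i) (fun x => Du j x 0 i)) ->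
  (forall x i, `|u x 0 i| <= c) -> (forall j x i, `|Du j x 0 i| <= c) ->
  (`|W1oo_norm u| <= (3 * c)%:E)%E.
Proof.
move=> c0 wD uc Dc; have g0 : (0 <= W1oo_norm u)%E.
  apply: le_ereal_inf_tmp => _ [D [_ ->]].
  by rewrite adde_ge0 ?sume_ge0 // => *; rewrite Lnorm_ge0.
rewrite gee0_abs //; apply: ge_ereal_inf.
exists (Lnorm leb2 +oo (fun x => (`|u x|)%:E) +
         \sum_(j < 2) Lnorm leb2 +oo (fun x => (`|Du j x|)%:E))%E; first by exists Du.
have b (f : plane R -> 'rV[R]_2) : (forall x i, `|f x 0 i| <= c) ->
    (Lnorm leb2 +oo (fun x => (`|f x|)%:E) <= c%:E)%E.
  by move=> fc; apply: ess_le => // z; rewrite /= normr_id lee_fin row_norm_le.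
have -> : 3 * c = c + (c + (c + 0)) by ring.
rewrite !EFinD !big_ord_recl big_ord0 !leeD ?b //.
Qed.

End Slices.

(** * Fourier multipliers of order zero and minus one *)

Section Multipliers.
Variable R : realType.
Implicit Types (k q p : Z3) (x : Z3 -> R).
Local Notation k1 k := ((k : Z3).1.1%:~R : R).
Local Notation k2 k := ((k : Z3).1.2%:~R : R).

Lemma hwksq_mult (a b : R) k : `|a| <= hw R k -> `|b| <= hw R k ->
  `|a * b / ksq R k| <= 2.
Proof.
move=> ah bh; have [h0|h0] := eqVneq (hw R k) 0.
  have -> : a = 0 by apply/eqP; rewrite -normr_le0 -h0.
  by rewrite !mul0r normr0.
have k0 := ksq_gt0 h0.
rewrite !normrM normfV (gtr0_norm k0) ler_pdivrMr //.
apply: le_trans (hw_ksq R k); rewrite expr2.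
by apply: ler_pM.
Qed.

Lemma rh_ge1 k : hw R k != 0 -> 1 <= rw R k / hw R k.
Proof.
move=> h0; rewrite ler_pdivlMr ?mul1r ?hw_le_rw //.
by rewrite lt0r h0 hw_ge0.
Qed.

Lemma mult_vel (a : R) k : `|a| <= hw R k -> `|a / ksq R k| <= 2 * (hw R k)^-1.
Proof.
move=> ah; have [h0|h0] := eqVneq (hw R k) 0.
  have -> : a = 0 by apply/eqP; rewrite -normr_le0 -h0.
  by rewrite mul0r normr0 h0 invr0 mulr0.
apply: le_trans (hw_ksqV h0).
by rewrite normrM normfV (gtr0_norm (ksq_gt0 h0)) ler_wpM2r // invr_ge0 ksq_ge0.
Qed.

Lemma mult_one (a : R) k : `|a| <= hw R k -> `|a / ksq R k| <= 2.
Proof.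
move=> ah; have [h0|h0] := eqVneq (hw R k) 0.
  have -> : a = 0 by apply/eqP; rewrite -normr_le0 -h0.
  by rewrite mul0r normr0.
apply: le_trans (mult_vel ah) _.
by rewrite ler_piMr // invf_le1 ?hw_ge1 // lt0r h0 hw_ge0.
Qed.

End Multipliers.

Lemma l1c_scale (R : realType) (g : Z3 -> R) (h : Z3 -> Z3) (c : R) (A : nat -> Z3 -> R) :
  injective h -> 0 <= c -> (forall k, `|g k| <= c) -> l1c A -> l1c (fun n k => g k * A n (h k)).
Proof.
move=> hI c0 gc HA; apply: (l1c_mult (G := fun=> 1) hI c0) => [k|]; first by rewrite normr1 mulr1.
by apply: l1c_ext HA => n k; rewrite mul1r.
Qed.

Lemma ulim_congr (R : realType) (V : Type) (u u' : nat -> V -> R) (f g : V -> R) :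
  (forall n z, u n z = u' n z) -> (forall z, f z = g z) -> ulim u f -> ulim u' g.
Proof. by move=> uu' /funext <-; exact: ulim_ext. Qed.

Lemma is_deriveDZ_ (R : realType) (V : normedModType R) (f g : V -> R) (x e : V) (a b c : R) :
  is_derive x e f a -> is_derive x e g b -> is_derive x e (fun z => f z + c * g z) (a + c * b).
Proof.
move=> fa gb; have -> : (fun z => f z + c * g z) = f + c *: g by apply/funext.
exact: is_deriveD.
Qed.

Lemma sum2 (V : nmodType) (f : 'I_2 -> V) : \sum_(j < 2) f j = f 0 + f 1.
Proof. by rewrite !big_ord_recl big_ord0 addr0; congr (f _ + f _); exact: val_inj. Qed.

(** * Passage to the limit in the iterates *)

Section Limit.
Variables (R : realType) (al eps Om r0 B E M FM : R) (w : nat -> Z3 -> R) (Fc1 Fc2 : Z3 -> R).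
Implicit Types (k q p : Z3) (A : nat -> Z3 -> R) (n : nat).
Local Notation k1 k := ((k : Z3).1.1%:~R : R).
Local Notation k2 k := ((k : Z3).1.2%:~R : R).
Let x n := w n.+1.
(** Size of a box that contains all products of two fields of the [n]-th iterate. *)
Let S n := (4 ^ n + 4 ^ n)%N.
Hypothesis al0 : 0 <= al.
Hypothesis e0 : 0 <= eps.
Hypothesis B0 : 0 <= B.
Hypothesis xsupp : forall n k, k \notin modes (4 ^ n) -> w n.+1 k = 0.
Hypothesis xb : forall n, bnd (fun k => (rw R k ^+ 2 * w n k) ^+ 2) (r0 ^+ 2).
Hypothesis xd : forall n, bnd (fun k => damp al eps k * (rw R k ^+ 2 * w n k) ^+ 2) E.
Hypothesis xe : forall n k, k \in modes (4 ^ n) ->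
  lop al eps Om (4 ^ n) (stream (w n)) (w n.+1) k = k2 k * Fc1 (- k) - k1 k * Fc2 (- k).
Hypothesis xc : forall n, bnd (fun k => (w n.+1 k - w n k) ^+ 2) (B / (4 ^ n)%:R).
Hypothesis xl : forall n, bnd (fun k => rw R k * (`|w n k| / hw R k)) M.
Hypothesis F1b : bnd (fun k => `|Fc1 k|) FM.
Hypothesis F2b : bnd (fun k => `|Fc2 k|) FM.
Hypothesis F10 : forall k, k.1 = 0 -> Fc1 k = 0.
Hypothesis F20 : forall k, k.1 = 0 -> Fc2 k = 0.

Let u1 n := vel1 (x n).
Let u2 n := vel2 (x n).

Lemma lim_hw0 n k : hw R k = 0 -> x n k = 0.
Proof. by move=> h0; apply: xsupp; apply/negP => /(@modes_hw R); rewrite h0 eqxx. Qed.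

Lemma lim_supp n : supp (4 ^ n) (x n).
Proof. by move=> k kN; apply: xsupp; rewrite mem_filter (negPf kN) andbF. Qed.

Lemma lim_cauchy (e : R) : 0 < e -> exists n0 : nat, forall n m, (n0 <= n)%N -> (n0 <= m)%N ->
    forall p, `|w n p - w m p| <= e.
Proof. exact: (geom_cauchy B0 xc). Qed.

Lemma lim_cauchyS (e : R) : 0 < e -> exists n0 : nat, forall n m, (n0 <= n)%N -> (n0 <= m)%N ->
    forall p, `|x n p - x m p| <= e.
Proof.
move=> /lim_cauchy[n0 H]; exists n0 => n m nn mm p.
by apply: H; exact: leqW.
Qed.

(** The multiplier [rw / hw] dominates, up to constants, those of the velocity, of its first
    derivatives in space and time, and of the vorticity; [lim_l1] transfers the convergence to all
    of them. *)
Lemma lim_base : l1c (fun n k => (rw R k / hw R k) * x n k).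
Proof.
have [C _ HC] := @bnd_rh R.
have H : l1c (fun n k => (rw R k * hw R k)^-1 * rw R k ^+ 2 * x n k).
  apply: l1c_weight (fun n => xb n.+1) lim_cauchyS.
  by apply: bnd_le HC => k; rewrite exprVn.
apply: l1c_ext H => n k; congr (_ * _).
have [r00|r00] := eqVneq (rw R k) 0; first by rewrite r00 expr0n !mul0r mulr0.
have [->|h0] := eqVneq (hw R k) 0; first by rewrite mulr0 invr0 mulr0 mul0r.
by field; rewrite r00 h0.
Qed.

(** The part [eps * ksq] of [damp] controls [hw * rw^2 * w] in l^2. This is one spatial derivative
    more than in [lim_base], as second derivatives of the velocity require. *)
Lemma lim_base_visc : 0 < eps -> l1c (fun n k => rw R k * x n k).
Proof.
move=> ep; have [C _ HC] := @bnd_rh R.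
have H : l1c (fun n k => (rw R k * hw R k)^-1 * (hw R k * rw R k ^+ 2) * x n k).
  apply: (l1c_weight (K := C) (C := 2 / eps * E)) lim_cauchyS.
    by apply: bnd_le HC => k; rewrite exprVn.
  move=> n; have c0 : 0 <= 2 / eps by apply: divr_ge0 => //; exact: ltW.
  apply: bnd_le (bndZ c0 (xd n.+1)) => k; rewrite -/(x n) -mulrA exprMn [leRHS]mulrA.
  apply: ler_wpM2r; first exact: sqr_ge0.
  apply: le_trans (hw_ksq R k) _; rewrite /damp mulrDr mulrA divfK ?gt_eqF //.
  by rewrite lerDr mulr_ge0.
apply: l1c_ext H => n k.
have [h0|h0] := eqVneq (hw R k) 0; first by rewrite lim_hw0 // !mulr0.
have r1 : rw R k != 0.
  apply: contraNneq h0 => r1; have := hw_le_rw R k; rewrite r1 => h1.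
  by rewrite eq_le h1 hw_ge0.
congr (_ * _); field; by rewrite h0 r1.
Qed.

Lemma lim_l1 (g : Z3 -> R) (h : Z3 -> Z3) (c : R) : injective h -> 0 <= c ->
  (forall k, `|g k| <= c * (rw R (h k) / hw R (h k))) -> l1c (fun n k => g k * x n (h k)).
Proof.
move=> hI c0 gc; apply: (l1c_mult hI c0) lim_base => k.
by apply: le_trans (gc k) _; rewrite ler_wpM2l // ler_norm.
Qed.

Lemma lim_l1_visc (g : Z3 -> R) (h : Z3 -> Z3) (c : R) : 0 < eps -> injective h -> 0 <= c ->
  (forall k, `|g k| <= c * rw R (h k)) -> l1c (fun n k => g k * x n (h k)).
Proof.
move=> ep hI c0 gc; apply: (l1c_mult hI c0) (lim_base_visc ep) => k.
by apply: le_trans (gc k) _; rewrite ler_wpM2l // ler_norm.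
Qed.

Lemma lim_bnd (g : Z3 -> R) (h : Z3 -> Z3) (c : R) n : injective h -> 0 <= c ->
  (forall k, `|g k| <= c * (rw R (h k) / hw R (h k))) ->
  bnd (fun k => `|g k * x n (h k)|) (c * M).
Proof.
move=> hI c0 gc; have := bnd_inj hI (xl n.+1) => /(bndZ c0); apply: bnd_le => k /=.
rewrite normrM; apply: le_trans (ler_wpM2r _ (gc k)) _ => //.
by rewrite -mulrA (mulrAC (rw _ _)) -mulrA.
Qed.

Lemma vel1E n k : u1 n k = - k2 k / ksq R k * x n (- k).
Proof. by rewrite /u1 /vel1 /stream ksqN; ring. Qed.

Lemma vel2E n k : u2 n k = k1 k / ksq R k * x n (- k).
Proof. by rewrite /u2 /vel2 /stream ksqN; ring. Qed.

Let vj (j : 'I_2) := if j == 0 then u1 else u2.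
Let kj (j : 'I_2) k : R := if j == 0 then k1 k else k2 k.
Let vm (j : 'I_2) k : R := if j == 0 then - k2 k else k1 k.

Lemma vjE j n k : vj j n k = vm j k / ksq R k * x n (- k).
Proof. by rewrite /vj /vm; case: ifP => _; [exact: vel1E|exact: vel2E]. Qed.

Lemma kj_hw j k : `|kj j k| <= hw R k.
Proof. by rewrite /kj; case: ifP => _; [exact: k1_hw|exact: k2_hw]. Qed.

Lemma vm_hw j k : `|vm j k| <= hw R k.
Proof. by rewrite /vm; case: ifP => _; rewrite ?normrN; [exact: k2_hw|exact: k1_hw]. Qed.

Lemma vjN j k : vm j (- k) = - vm j k.
Proof. by rewrite /vm; case: ifP => _; rewrite ?k1N ?k2N. Qed.

Lemma phase_dX j k : phase Om k (dX R j) = kj j k.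
Proof. by rewrite /phase /dX /dx /kj; case: ifP => _ /=; ring. Qed.

Lemma phase_dT k : phase Om k (dT R) = Om * k.2%:~R.
Proof. by rewrite /phase /dT /=; ring. Qed.

Lemma kjN j k : kj j (- k) = - kj j k.
Proof. by rewrite /kj; case: ifP => _; rewrite ?k1N ?k2N. Qed.

Lemma dXE i j n k : dcoef Om (dX R i) (vj j n) k = kj i k * vm j k / ksq R k * x n k.
Proof. by rewrite /dcoef phase_dX vjE vjN ksqN opprK; ring. Qed.

Lemma dTE j n k : dcoef Om (dT R) (vj j n) k = Om * (k.2%:~R * (vm j k / ksq R k)) * x n k.
Proof. by rewrite /dcoef phase_dT vjE vjN ksqN opprK; ring. Qed.

Lemma d2XE i j n k : dcoef Om (dX R i) (dcoef Om (dX R i) (vj j n)) k =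
  - (kj i k * kj i k * vm j k / ksq R k) * x n (- k).
Proof. 
rewrite /dcoef !phase_dX vjE.
by rewrite kjN [- - k]opprK; ring.
Qed.

Let cv (j : 'I_2) n k : R :=
  if j == 0 then - 1 * conv (4 ^ n) (u2 n) (x n) k else conv (4 ^ n) (u1 n) (x n) k.
Let Fj (j : 'I_2) k : R := if j == 0 then Fc1 k else Fc2 k.

(* Coefficients of [d_t u + w u^perp - eps Lap u + al u - F]. *)
Let y (j : 'I_2) n k : R := dcoef Om (dT R) (vj j n) k + cv j n k
  + eps * ksq R k * vj j n k + al * vj j n k + - 1 * trunc (S n) (Fj j) k.
(* Divergence of the above divided by [|k|^2], so that only the rotational part, which
   tends to [0], is left in [y + grad pc]. *)
Let pc n k : R := - (k1 k * y 0 n (- k) + k2 k * y 1 n (- k)) / ksq R k.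

Lemma pow4_homo : {homo (fun n => (4 ^ n)%N) : n m / (n <= m)%N}.
Proof. by move=> n m nm; rewrite leq_pexp2l. Qed.

Lemma S_ge n : (n <= S n)%N.
Proof. by apply: leq_trans (leq_addr _ _); exact: ltnW (ltn_expl _ _). Qed.

Lemma pow4_S n : (4 ^ n <= S n)%N. Proof. exact: leq_addr. Qed.

Lemma vm_mult j k : `|vm j k / ksq R k| <= 2 * (rw R (- k) / hw R (- k)).
Proof.
apply: le_trans (mult_vel (vm_hw j k)) _; rewrite rwN hwN ler_wpM2l //.
have [->|h0] := eqVneq (hw R k) 0; first by rewrite invr0 mulr0.
by rewrite ler_peMl ?invr_ge0 ?hw_ge0 //; apply: le_trans (hw_ge1 h0) (hw_le_rw R k).
Qed.

Lemma rh_ge0 k : 0 <= rw R k / hw R k.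
Proof. by rewrite divr_ge0 ?rw_ge0 ?hw_ge0. Qed.

Lemma dX_mult i j k : `|kj i k * vm j k / ksq R k| <= 2 * (rw R k / hw R k).
Proof.
have [h0|h0] := eqVneq (hw R k) 0.
  have -> : vm j k = 0 by apply/eqP; rewrite -normr_le0 -h0 vm_hw.
  by rewrite mulr0 mul0r normr0 mulr_ge0 ?rh_ge0.
apply: le_trans (hwksq_mult (kj_hw i k) (vm_hw j k)) _.
by rewrite ler_peMr // rh_ge1.
Qed.

Lemma dT_mult j k : `|Om * (k.2%:~R * (vm j k / ksq R k))| <= `|Om| * 2 * (rw R k / hw R k).
Proof.
rewrite normrM -mulrA; apply: ler_wpM2l => //; rewrite normrM mulrCA.
apply: ler_pM => //; first exact: l_rw.
exact: mult_vel (vm_hw j k).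
Qed.

Lemma opp_I : injective (-%R : Z3 -> Z3). Proof. exact: oppr_inj. Qed.

Lemma lim_vj j : l1c (vj j).
Proof. by apply: l1c_ext (lim_l1 opp_I _ (vm_mult j)) => // n k; rewrite vjE. Qed.

Lemma bnd_vj j n : bnd (fun k => `|vj j n k|) (2 * M).
Proof. by apply: bnd_le (lim_bnd n opp_I _ (vm_mult j)) => // k; rewrite vjE. Qed.

Lemma lim_dX i j : l1c (fun n => dcoef Om (dX R i) (vj j n)).
Proof. by apply: l1c_ext (lim_l1 (h := id) _ _ (dX_mult i j)) => // n k; rewrite dXE. Qed.

Lemma bnd_dX i j n : bnd (fun k => `|dcoef Om (dX R i) (vj j n) k|) (2 * M).
Proof. by apply: bnd_le (lim_bnd (h := id) n _ _ (dX_mult i j)) => // k; rewrite dXE. Qed.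

Lemma lim_dT j : l1c (fun n => dcoef Om (dT R) (vj j n)).
Proof.
have c0 : 0 <= `|Om| * 2 by rewrite mulr_ge0.
by apply: l1c_ext (lim_l1 (h := id) _ c0 (dT_mult j)) => // n k; rewrite dTE.
Qed.

(** [ksq / ksq] is [0] on modes constant in space and [1] elsewhere; in this form the vorticity
    falls under [lim_l1]. *)
Lemma x_mult n k : x n k = ksq R k / ksq R k * x n k.
Proof.
have [h0|h0] := eqVneq (hw R k) 0; first by rewrite lim_hw0 // mulr0.
by rewrite divff ?mul1r // gt_eqF // ksq_gt0.
Qed.

Lemma one_mult k : `|ksq R k / ksq R k| <= 1 * (rw R k / hw R k).
Proof.
have [h0|h0] := eqVneq (hw R k) 0.
  suff -> : ksq R k = 0 by rewrite mul0r normr0 mul1r rh_ge0.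
  by have [k10 k20] := hw0_k h0; rewrite ksqE k10 k20 expr0n addr0.
by rewrite mul1r divff ?normr1 ?rh_ge1 // gt_eqF // ksq_gt0.
Qed.

Lemma lim_x : l1c x.
Proof. by apply: l1c_ext (lim_l1 (h := id) _ _ one_mult) => // n k; rewrite -x_mult. Qed.

Lemma bnd_x n : bnd (fun k => `|x n k|) M.
Proof.
rewrite -[M]mul1r.
by apply: bnd_le (lim_bnd (h := id) n _ _ one_mult) => // k; rewrite -x_mult.
Qed.

Lemma lim_visc j : l1c (fun n k => eps * ksq R k * vj j n k).
Proof.
have [->|ne] := eqVneq eps 0.
  by apply: l1c_ext (l1c_cst (fun=> 0)) => n k; rewrite !mul0r.
have ep : 0 < eps by rewrite lt0r ne.
apply: l1c_ext (lim_l1_visc (g := fun k => eps * ksq R k * (vm j k / ksq R k)) ep opp_I e0 _) => [n k|k].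
  by rewrite vjE; ring.
rewrite rwN -mulrA normrM ger0_norm // ler_wpM2l //; apply: le_trans (hw_le_rw R k).
have [h0|h0] := eqVneq (hw R k) 0.
  have [k10 k20] := hw0_k h0.
  by rewrite ksqE k10 k20 expr0n addr0 mul0r normr0 hw_ge0.
by rewrite mulrC divfK ?vm_hw // gt_eqF // ksq_gt0.
Qed.

Lemma supp_vj j n : supp (4 ^ n) (vj j n).
Proof. by move=> k kN; rewrite vjE lim_supp ?mulr0 // box3N. Qed.

Lemma lim_cv j : l1c (cv j).
Proof.
have H i : l1c (fun n => conv (4 ^ n) (vj i n) (x n)).
  exact: (l1c_conv pow4_homo (supp_vj i) lim_supp (bnd_vj i) bnd_x (lim_vj i) lim_x).
rewrite /cv; case: (j == 0); last exact: (H 0).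
by apply: (l1c_scale (g := fun=> - 1) (h := id) (c := 1)) (H 1) => // k; rewrite normrN normr1.
Qed.

Lemma F_bnd j : bnd (fun k => `|Fj j k|) FM.
Proof. by rewrite /Fj; case: (j == 0). Qed.

Lemma lim_y j : l1c (y j).
Proof.
apply: l1cD; last first.
  apply: (l1c_scale (g := fun=> - 1) (h := id) (c := 1)) (l1c_trunc S_ge (F_bnd j)) => // k.
  by rewrite normrN normr1.
apply: l1cD; last by apply: (l1c_scale (g := fun=> al) (h := id) _ al0) (lim_vj j) => // k; rewrite ger0_norm.
apply: l1cD; last exact: lim_visc.
by apply: l1cD; [exact: lim_dT|exact: lim_cv].
Qed.

Lemma supp_y j n : supp (S n) (y j n).
Proof.
move=> k kN; have kN' : k \notin box3 (4 ^ n) by apply: contra kN => /(box3_sub (pow4_S n)).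
have sd : supp (4 ^ n) (dcoef Om (dT R) (vj j n)) by apply: supp_dcoef; exact: supp_vj.
have sc i : supp (S n) (conv (4 ^ n) (vj i n) (x n)) by apply: supp_conv; exact: supp_vj.
rewrite /y supp_trunc // sd // supp_vj // !mulr0 !addr0 add0r.
rewrite /cv; case: ifP => _; last exact: (sc 0).
by rewrite (sc 1) ?mulr0.
Qed.

Lemma lim_pc : l1c pc.
Proof.
have H := l1cD (l1c_scale opp_I _ (fun k => mult_one (k1_hw R k)) (lim_y 0))
  (l1c_scale opp_I _ (fun k => mult_one (k2_hw R k)) (lim_y 1)).
apply: (l1c_ext _ (l1c_scale (h := id) (g := fun=> - 1) (c := 1) _ _ _ (H _ _))) => // [n k|k].
  by rewrite /pc; ring.
by rewrite normrN normr1.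
Qed.

Lemma supp_pc n : supp (S n) (pc n).
Proof. by move=> k kN; rewrite /pc !supp_y ?box3N // !mulr0 addr0 oppr0 mul0r. Qed.

Lemma lim_dpc j : l1c (fun n => dcoef Om (dX R j) (pc n)).
Proof.
have m (a b : Z3 -> R) : (forall k, `|a k| <= hw R k) -> (forall k, `|b k| <= hw R k) ->
    forall k, `|- 1 * (a k * b k / ksq R k)| <= 2.
  by move=> ah bh k; rewrite normrM normrN normr1 mul1r hwksq_mult.
have H := l1cD (l1c_scale (h := id) _ _ (m _ _ (kj_hw j) (k1_hw R)) (lim_y 0))
  (l1c_scale (h := id) _ _ (m _ _ (kj_hw j) (k2_hw R)) (lim_y 1)).
apply: l1c_ext (H _ _ _ _) => // n k.
by rewrite /dcoef phase_dX /pc ksqN k1N k2N opprK; ring.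
Qed.

Lemma yE j n k : k \in box3 (S n) -> y j n k = Om * (k.2%:~R * (vm j k / ksq R k)) * x n k
  + cv j n k + (eps * ksq R k + al) * (vm j k / ksq R k * x n (- k)) - Fj j k.
Proof. by move=> kb; rewrite /y dTE vjE /trunc kb; ring. Qed.

(** The curl of the residual of the momentum equation. The Galerkin equation transports the iterate
    by the velocity of the previous one, while [y] uses its own; the transport by the difference is
    what remains. *)
Lemma rot_y n k : k \in modes (4 ^ n) -> - k1 k * y 1 n (- k) + k2 k * y 0 n (- k) =
  \sum_(q <- modes (4 ^ n)) brk (stream (fun p => x n p - w n p)) k q * x n q.
Proof.
move=> km; have h0 := modes_hw R km; have kp := ksq_gt0 h0.
have kb : - k \in box3 (S n).
  by rewrite box3N (box3_sub (pow4_S n)) //; move: km; rewrite mem_filter => /andP[].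
have := xe km; rewrite /lop -/(x n) => E1.
have E2 := rot_conv (4 ^ n) (x n) k.
have E3 : \sum_(q <- box3 (4 ^ n)) brk (stream (x n)) k q * x n q =
    \sum_(q <- modes (4 ^ n)) brk (stream (x n)) k q * x n q.
  rewrite /modes big_filter [RHS]big_mkcond /=; apply: eq_bigr => q _.
  by case: ifP => // /negbFE; rewrite -(hw_eq0 R) => /eqP q0; rewrite lim_hw0 ?mulr0.
have E4 : \sum_(q <- modes (4 ^ n)) brk (stream (fun p => x n p - w n p)) k q * x n q =
    \sum_(q <- modes (4 ^ n)) brk (stream (x n)) k q * x n q -
    \sum_(q <- modes (4 ^ n)) brk (stream (w n)) k q * x n q.
  by rewrite -sumrB; apply: eq_bigr => q _; rewrite -mulrBl; congr (_ * _); rewrite /brk /stream; ring.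
rewrite E4 -E3 -E2.
have lN : (- k).2%:~R = - k.2%:~R :> R by exact: mulrNz.
have y0E : y 0 n (- k) = Om * k.2%:~R * (- k2 k / ksq R k) * x n (- k)
    - conv (4 ^ n) (u2 n) (x n) (- k) + (eps * ksq R k + al) * (k2 k / ksq R k) * x n k - Fc1 (- k).
  by rewrite yE // vjN ksqN lN /cv /Fj /vm /= [- - k]opprK; ring.
have y1E : y 1 n (- k) = Om * k.2%:~R * (k1 k / ksq R k) * x n (- k)
    + conv (4 ^ n) (u1 n) (x n) (- k) + (eps * ksq R k + al) * (- k1 k / ksq R k) * x n k - Fc2 (- k).
  by rewrite yE // vjN ksqN lN /cv /Fj /vm /= [- - k]opprK; ring.
rewrite y0E y1E.
have -> : \sum_(q <- modes (4 ^ n)) brk (stream (w n)) k q * x n q =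
   k2 k * Fc1 (- k) - k1 k * Fc2 (- k) + Om * k.2%:~R * x n (- k) - damp al eps k * x n k.
  by rewrite -E1; ring.
rewrite -/(u1 n) -/(u2 n) /damp ksqE; field.
by rewrite -ksqE gt_eqF.
Qed.

(** The difference of the velocities is small mode by mode, and [x] is bounded in l^1. Skewness of
    [brk] puts the derivative on the fixed [k] instead of the summed [q]. *)
Lemma rot_y_small k (e : R) : hw R k != 0 -> 0 < e -> exists n0 : nat,
  forall n, (n0 <= n)%N -> `|- k1 k * y 1 n (- k) + k2 k * y 0 n (- k)| <= e.
Proof.
move=> h0 ee; have M0 : 0 <= M by apply: bnd_ge0 (bnd_x 0%N).
pose d := e / (8 * (hw R k * M) + 1).
have c1 : 0 < 8 * (hw R k * M) + 1 by have := mulr_ge0 (hw_ge0 R k) M0; lra.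
have d0 : 0 < d by rewrite divr_gt0.
have [n0 Hn] := lim_cauchy d0; have [N HN] := seq_box [:: k].
exists (maxn n0 N) => n; rewrite geq_max => /andP[nn nN].
have km : k \in modes (4 ^ n).
  rewrite mem_filter -(hw_eq0 R) h0 /=; apply: (box3_sub (N := N)); last by apply: HN; rewrite inE.
  by apply: leq_trans nN _; exact: ltnW (ltn_expl _ _).
pose dd (p : Z3) := x n p - w n p; rewrite rot_y // -/dd.
have dle p : `|dd p| <= d by apply: Hn => //; exact: leqW.
have ale p : amp (stream dd) p <= 4 * d.
  have [p0|p0] := eqVneq (hw R p) 0; first by rewrite amp0 // mulr_ge0 // ltW.
  have := amp_stream dd p; have := dle p; have := dle (- p) => d1 d2 d3.
  have : amp (stream dd) p <= amp (stream dd) p * hw R p.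
    by rewrite ler_peMr ?amp_ge0 // hw_ge1.
  lra.
have ble q : `|brk (stream dd) k q| <= 4 * d * hw R k.
  rewrite brk_skew normrN; apply: le_trans (brk_le _ _ _) _.
  apply: ler_wpM2r; first exact: hw_ge0.
  by have := ale (q + k); have := ale (q - k); lra.
apply: le_trans (ler_norm_sum _ _ _) _.
apply: (@le_trans _ _ (\sum_(q <- modes (4 ^ n)) 4 * d * hw R k * `|x n q|)).
  by apply: ler_sum => q _; rewrite normrM ler_wpM2r.
rewrite -mulr_sumr; apply: (@le_trans _ _ (4 * d * hw R k * M)).
  apply: ler_wpM2l; last by apply: bnd_x; exact: modes_uniq.
  by apply: mulr_ge0; [apply: mulr_ge0 => //; exact: ltW|exact: hw_ge0].
rewrite /d (_ : 4 * _ * _ * _ = e * (4 * (hw R k * M)) / (8 * (hw R k * M) + 1)); last first.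
  by field; rewrite gt_eqF.
rewrite ler_pdivrMr // ler_wpM2l ?(ltW ee) //.
by have := mulr_ge0 (hw_ge0 R k) M0; lra.
Qed.

(** A mode constant in space cannot be compensated by a pressure gradient. The linear multipliers
    and the force vanish there, and the nonlinear term does so by [conv_mean]. *)
Lemma y_mean j n k : hw R k = 0 -> y j n k = 0.
Proof.
move=> h0; have [k10 k20] := hw0_k h0.
have kq0 : ksq R k = 0 by rewrite ksqE k10 k20 expr0n addr0.
have k0 : k.1 = 0 by apply/eqP; rewrite -(hw_eq0 R) h0.
have v0 : vm j k = 0 by rewrite /vm k10 k20 oppr0; case: ifP.
have F0 : Fj j k = 0 by rewrite /Fj; case: ifP => _; rewrite ?F10 ?F20.
rewrite /y dTE vjE v0 !mul0r !mulr0 !mul0r !addr0 add0r.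
have -> : trunc (S n) (Fj j) k = 0 by rewrite /trunc F0; case: ifP.
rewrite mulr0 addr0.
have cm (i : 'I_2) : conv (4 ^ n) (vj i n) (x n) k = 0.
  have -> : vj i n = fun k => vm i k / ksq R k * x n (- k) by apply/funext => p; exact: vjE.
  have [l ->] : exists l : int, k = (0, l) by exists k.2; rewrite -k0; case: (k).
  apply: (@conv_mean R (4 ^ n) (fun p => vm i p / ksq R p)); first exact: lim_supp.
  move=> p q pq; rewrite /vm /ksq pq /= !sqrrN !mulrNz.
  by case: ifP => _; ring.
by rewrite /cv; case: ifP => _; [rewrite (cm 1) mulr0|exact: (cm 0)].
Qed.

(** Hodge decomposition of a single coefficient: adding [grad pc] to [y] leaves [vm / ksq] times the
    curl. *)
Lemma resid_small j k (e : R) : 0 < e -> exists n0 : nat, forall n, (n0 <= n)%N ->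
  `|y j n k + dcoef Om (dX R j) (pc n) k| <= e.
Proof.
move=> ee; have [h0|h0] := eqVneq (hw R k) 0.
  exists 0%N => n _; rewrite y_mean // /dcoef phase_dX.
  have -> : kj j k = 0 by apply/eqP; rewrite -normr_le0 -h0 kj_hw.
  by rewrite oppr0 mul0r addr0 normr0 ltW.
have kp := ksq_gt0 h0.
have hN : hw R (- k) != 0 by rewrite hwN.
have [n0 Hn] := rot_y_small hN (divr_gt0 ee (ltr0Sn R 1)); exists n0 => n nn.
have := Hn n nn; rewrite k1N k2N [- - k]opprK.
set r := - - _ * _ + _ => rle.
have -> : y j n k + dcoef Om (dX R j) (pc n) k = vm j k / ksq R k * r.
  have jE : y j n k = if j == 0 then y 0 n k else y 1 n k.
    by move: j => [[|[|//]] lj]; congr (y _ n k); exact/val_inj.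
  rewrite /dcoef phase_dX /pc ksqN k1N k2N [- - k]opprK /r jE /kj /vm ksqE.
  by case: ifP => _; field; rewrite -ksqE gt_eqF.
rewrite normrM; apply: le_trans (ler_pM _ _ (mult_one (vm_hw j k)) rle) _ => //.
by rewrite mulrC divfK.
Qed.

Lemma resid_lim j : ulim (fun n z => ev Om (S n) (fun k => y j n k + dcoef Om (dX R j) (pc n) k) z)
  (fun=> 0).
Proof. by apply: l1c_zero (resid_small j); apply: l1cD; [exact: lim_y|exact: lim_dpc]. Qed.

Variable F : spacetime R -> 'rV[R]_2.
Hypothesis Om0 : 0 < Om.
Hypothesis F1u : ulim (fun n => ev Om n Fc1) (fun z => F z 0 0).
Hypothesis F2u : ulim (fun n => ev Om n Fc2) (fun z => F z 0 1).
Local Notation T := (2 * pi / Om).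
Local Notation leb := (@lebesgue_measure R).
Local Notation leb2 := (leb \x leb)%E.
Local Notation leb3 := (leb2 \x leb)%E.

Lemma lim_per N a : torus_time_fun T (ev Om N a).
Proof. by apply: ev_periodic; rewrite gt_eqF. Qed.

Lemma weak_lim (e : spacetime R) (N : nat -> nat) A f g :
  (forall psi h : spacetime R -> R, continuous h -> torus_time_fun T psi ->
    (forall x, is_derive x e psi (h x)) ->
    (\int[leb3]_(x in torus_time T) (h x)%:E = 0)%E) ->
  ulim (fun n => ev Om (N n) (A n)) f -> ulim (fun n => ev Om (N n) (dcoef Om e (A n))) g ->
  weak_deriv T e f g.
Proof.
move=> Hint; apply: weak_deriv_ulim Hint _ _ _ _ _ => n; try exact: ev_continuous.
- exact: lim_per.
- exact: lim_per.
- by move=> z; exact: ev_derive.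
Qed.

Lemma intX j psi h : continuous h -> torus_time_fun T psi ->
  (forall x, is_derive x (dX R j) psi (h x)) ->
  (\int[leb3]_(x in torus_time T) (h x)%:E = 0)%E.
Proof. exact: int_dX0. Qed.

Lemma intT psi h : continuous h -> torus_time_fun T psi ->
  (forall x, is_derive x (dT R) psi (h x)) ->
  (\int[leb3]_(x in torus_time T) (h x)%:E = 0)%E.
Proof. by apply: int_dT0; rewrite divr_gt0 // mulr_gt0 // pi_gt0. Qed.

Lemma ord2P (P : 'I_2 -> Prop) : P 0 -> P 1 -> forall j, P j.
Proof.
move=> P0 P1 [[|[|//]] lj].
- by rewrite (_ : Ordinal lj = 0) //; exact: val_inj.
- by rewrite (_ : Ordinal lj = 1) //; exact: val_inj.
Qed.

Lemma F_lim j : ulim (fun n => ev Om (S n) (Fj j)) (fun z => F z 0 j).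
Proof.
have H (a : Z3 -> R) f : ulim (fun n => ev Om n a) f -> ulim (fun n => ev Om (S n) a) f.
  move=> ul e ee; have [n0 Hn] := ul e ee; exists n0 => n nn z.
  by apply: Hn; apply: leq_trans nn (S_ge n).
by move: j; apply: ord2P; apply: H.
Qed.

Lemma ev_y j n z : ev Om (S n) (fun k => y j n k + dcoef Om (dX R j) (pc n) k) z =
  ev Om (4 ^ n) (dcoef Om (dT R) (vj j n)) z
  + (if j == 0 then - (ev Om (4 ^ n) (vj 1 n) z * ev Om (4 ^ n) (x n) z)
     else ev Om (4 ^ n) (vj 0 n) z * ev Om (4 ^ n) (x n) z)
  + eps * ev Om (4 ^ n) (fun k => ksq R k * vj j n k) z
  + al * ev Om (4 ^ n) (vj j n) z + - 1 * ev Om (S n) (Fj j) z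
  + ev Om (S n) (dcoef Om (dX R j) (pc n)) z.
Proof.
have W a : supp (4 ^ n) a -> ev Om (4 ^ n) a z = ev Om (S n) a z.
  by move=> sa; rewrite (ev_widen _ _ (pow4_S n) sa).
have -> : (if j == 0 then - (ev Om (4 ^ n) (vj 1 n) z * ev Om (4 ^ n) (x n) z)
     else ev Om (4 ^ n) (vj 0 n) z * ev Om (4 ^ n) (x n) z) = ev Om (S n) (cv j n) z.
  rewrite !(ev_mul _ _ (@supp_vj _ n) (@lim_supp n)) -/(S n) /cv; case: (j == 0) => //.
  by rewrite evZ mulN1r.
rewrite (W _ (supp_dcoef _ _ (@supp_vj j n))) (W _ (@supp_vj j n)) -(ev_trunc Om (S n) (Fj j)).
rewrite (W (fun k => ksq R k * vj j n k)); last by move=> k kN; rewrite supp_vj ?mulr0.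
by rewrite -!evZ -!evD; apply: eq_bigr => k _; congr (_ * _); rewrite /y; ring.
Qed.

(** The same polynomials have two uniform limits: zero by [resid_lim], and the left-hand side term
    by term through [ev_y]. The nonlinearity is still in the form [w u^perp], with [w] the curl of
    [v]. *)
Lemma momentum_lim (v vt : 'I_2 -> spacetime R -> R) (D : 'I_2 -> 'I_2 -> spacetime R -> R)
    (L P : 'I_2 -> spacetime R -> R) (j : 'I_2) (z : spacetime R) :
  (forall j, ulim (fun n => ev Om (4 ^ n) (vj j n)) (v j)) ->
  (forall i j, ulim (fun n => ev Om (4 ^ n) (dcoef Om (dX R i) (vj j n))) (D i j)) ->
  (forall j, ulim (fun n => ev Om (4 ^ n) (dcoef Om (dT R) (vj j n))) (vt j)) ->
  (forall j, ulim (fun n z => eps * ev Om (4 ^ n) (fun k => ksq R k * vj j n k) z)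
    (fun z => - (eps * L j z))) ->
  (forall j, ulim (fun n => ev Om (S n) (dcoef Om (dX R j) (pc n))) (P j)) ->
  vt j z + (if j == 0 then - (v 1 z * (D 0 1 z - D 1 0 z)) else v 0 z * (D 0 1 z - D 1 0 z))
  - eps * L j z + al * v j z - F z 0 j + P j z = 0.
Proof.
move=> Hv HD Ht HL HP.
have Hx : ulim (fun n => ev Om (4 ^ n) (x n)) (fun z => D 0 1 z - D 1 0 z).
  apply: ulim_congr (ulimD (HD 0 1) (ulimZ (- 1) (HD 1 0))) => [n z'|z']; last by rewrite mulN1r.
  rewrite -evZ -evD; apply: eq_bigr => k _; congr (_ * _).
  have xk : x n k = (k1 k ^+ 2 + k2 k ^+ 2) / ksq R k * x n k by rewrite -ksqE -x_mult.
  by rewrite !dXE [RHS]xk /kj /vm /=; ring.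
have bv i z' : `|v i z'| <= 2 * (2 * M).
  by apply: (ulim_bound (Hv i)) => n z''; apply: ev_le; exact: bnd_vj.
have bx z' : `|D 0 1 z' - D 1 0 z'| <= 2 * M.
  by apply: (ulim_bound Hx) => n z''; apply: ev_le; exact: bnd_x.
have HN : ulim (fun n z => if j == 0 then - (ev Om (4 ^ n) (vj 1 n) z * ev Om (4 ^ n) (x n) z)
     else ev Om (4 ^ n) (vj 0 n) z * ev Om (4 ^ n) (x n) z)
   (fun z => if j == 0 then - (v 1 z * (D 0 1 z - D 1 0 z)) else v 0 z * (D 0 1 z - D 1 0 z)).
  case: (j == 0); last exact: ulimM (bv 0) bx (Hv 0) Hx.
  by apply: ulim_congr (ulimZ (- 1) (ulimM (bv 1) bx (Hv 1) Hx)) => [n z'|z']; rewrite mulN1r.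
have H := ulimD (ulimD (ulimD (ulimD (ulimD (Ht j) HN) (HL j)) (ulimZ al (Hv j)))
  (ulimZ (- 1) (F_lim j))) (HP j).
have H' := ulim_ext (fun n z => ev_y j n z) (@resid_lim j).
by rewrite -(ulim_unique H H' z); ring.
Qed.

Lemma lim_d2 i j : 0 < eps -> l1c (fun n => dcoef Om (dX R i) (dcoef Om (dX R i) (vj j n))).
Proof.
move=> ep.
apply: l1c_ext (lim_l1_visc (g := fun k => - (kj i k * kj i k * vm j k / ksq R k)) (c := 2) ep opp_I _ _)
  => // [n k|k]; first by rewrite d2XE.
rewrite normrN rwN -!mulrA normrM mulrA mulrC; apply: ler_pM => //.
  exact: hwksq_mult (kj_hw _ _) (vm_hw _ _).
exact: le_trans (kj_hw _ _) (hw_le_rw R k).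
Qed.

(** For [eps = 0] nothing is known about second derivatives, but the term is identically zero. *)
Lemma visc_lim (D2 : 'I_2 -> 'I_2 -> spacetime R -> R) j :
  (0 < eps -> forall i j, ulim (fun n => ev Om (4 ^ n) (dcoef Om (dX R i) (dcoef Om (dX R i) (vj j n)))) (D2 i j)) ->
  ulim (fun n z => eps * ev Om (4 ^ n) (fun k => ksq R k * vj j n k) z)
    (fun z => - (eps * (D2 0 j z + D2 1 j z))).
Proof.
move=> HD2; have [->|ne] := eqVneq eps 0.
  by apply: ulim_congr (ulim_cst (fun=> 0)) => [n z|z]; rewrite !mul0r ?oppr0.
have ep : 0 < eps by rewrite lt0r ne.
apply: ulim_congr (ulimZ (- eps) (ulimD (HD2 ep 0 j) (HD2 ep 1 j))) => [n z|z]; last by rewrite mulNr.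
rewrite -evD mulNr -mulrN; congr (_ * _); rewrite -mulN1r -evZ.
apply: eq_bigr => k _; congr (_ * _).
by rewrite !d2XE vjE [X in _ = X * _]ksqE /kj /=; ring.
Qed.

(** The corrected pressure [p0 - |v|^2 / 2] and its gradient. The factor [1 *] brings the sum into
    the shape of [is_deriveDZ_]. *)
Lemma bernoulli_weak (v : 'I_2 -> spacetime R -> R) (D : 'I_2 -> 'I_2 -> spacetime R -> R)
    (p0 : spacetime R -> R) (P : 'I_2 -> spacetime R -> R) j :
  (forall j, ulim (fun n => ev Om (4 ^ n) (vj j n)) (v j)) ->
  (forall i j, ulim (fun n => ev Om (4 ^ n) (dcoef Om (dX R i) (vj j n))) (D i j)) ->
  ulim (fun n => ev Om (S n) (pc n)) p0 ->
  ulim (fun n => ev Om (S n) (dcoef Om (dX R j) (pc n))) (P j) ->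
  weak_deriv T (dX R j) (fun z => p0 z + - 2^-1 * (v 0 z * v 0 z + 1 * (v 1 z * v 1 z)))
    (fun z => P j z - (v 0 z * D j 0 z + v 1 z * D j 1 z)).
Proof.
move=> Hv HD Hp HP.
have bv i z : `|v i z| <= 2 * (2 * M).
  by apply: (ulim_bound (Hv i)) => n z''; apply: ev_le; exact: bnd_vj.
have bD (i l : 'I_2) z : `|D i l z| <= 2 * (2 * M).
  by apply: (ulim_bound (HD i l)) => n z''; apply: ev_le; exact: bnd_dX.
pose A n k := pc n k + - 2^-1 * (conv (4 ^ n) (vj 0 n) (vj 0 n) k + 1 * conv (4 ^ n) (vj 1 n) (vj 1 n) k).
have AE n z : ev Om (S n) (A n) z = ev Om (S n) (pc n) z + - 2^-1 *
   (ev Om (4 ^ n) (vj 0 n) z * ev Om (4 ^ n) (vj 0 n) z + 1 * (ev Om (4 ^ n) (vj 1 n) z * ev Om (4 ^ n) (vj 1 n) z)).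
  by rewrite /A evD evZ evD evZ !ev_mul //; exact: supp_vj.
apply: (@weak_lim _ S A) (@intX j) _ _.
  apply: (ulim_ext (fun n z => esym (AE n z))).
  apply: ulimD Hp (ulimZ _ (ulimD _ (ulimZ _ _))); exact: ulimM.
(* The derivative of the polynomial is computed both from its coefficients and by the product rule;
   this spares differentiating the coefficients of [conv]. *)
have dA n z : ev Om (S n) (dcoef Om (dX R j) (A n)) z = ev Om (S n) (dcoef Om (dX R j) (pc n)) z +
    - 1 * (ev Om (4 ^ n) (vj 0 n) z * ev Om (4 ^ n) (dcoef Om (dX R j) (vj 0 n)) z +
    ev Om (4 ^ n) (vj 1 n) z * ev Om (4 ^ n) (dcoef Om (dX R j) (vj 1 n)) z).
  have d1 := ev_derive Om (S n) (A n) z (dX R j).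
  have d2 := is_deriveDZ_ (- 2^-1) (ev_derive Om (S n) (pc n) z (dX R j)) (is_deriveDZ_ 1
    (is_deriveM_ (ev_derive Om (4 ^ n) (vj 0 n) z (dX R j)) (ev_derive Om (4 ^ n) (vj 0 n) z (dX R j)))
    (is_deriveM_ (ev_derive Om (4 ^ n) (vj 1 n) z (dX R j)) (ev_derive Om (4 ^ n) (vj 1 n) z (dX R j)))).
  have fE : ev Om (S n) (A n) = _ := funext (AE n).
  by rewrite -(@derive_val _ _ _ _ _ _ _ d1) fE (@derive_val _ _ _ _ _ _ _ d2); field.
apply: (ulim_ext (fun n z => esym (dA n z))).
apply: (ulim_congr (fun n z => erefl) _ (ulimD HP (ulimZ (- 1)
  (ulimD (ulimM (bv 0) (bD j 0) (Hv 0) (HD j 0)) (ulimM (bv 1) (bD j 1) (Hv 1) (HD j 1)))))) => z.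
by rewrite mulN1r.
Qed.

(** Each velocity component is, up to sign, a spatial derivative of the stream function. *)
Lemma slice_mean i n t : \int[leb2]_(x in @torus R) ev Om (4 ^ n) (vj i n) (x, t) = 0.
Proof.
have [j [a aE]] : exists (j : 'I_2) a, vj i n = dcoef Om (dX R j) a.
  move: i; apply: ord2P.
    exists 1, (fun k => - stream (x n) k); apply/funext => k.
    by rewrite /dcoef phase_dX /vj /= /u1 /vel1 /kj /= mulrNN.
  by exists 0, (stream (x n)); apply/funext => k; rewrite /dcoef phase_dX.
rewrite aE /Rintegral.
have cont : continuous (fun x => ev Om (4 ^ n) (dcoef Om (dX R j) a) (x, t)).
  by apply: slice_continuous; exact: ev_continuous.
have tor : torus_fun (fun x => ev Om (4 ^ n) a (x, t)) by apply: slice_torus; exact: lim_per.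
have der z : is_derive z (dx R j) (fun x => ev Om (4 ^ n) a (x, t)) (ev Om (4 ^ n) (dcoef Om (dX R j) a) (z, t)).
  by apply: slice_is_derive; exact: ev_derive.
by rewrite (int_dx0 cont tor der).
Qed.

Lemma slice_weak i j (f g : spacetime R -> R) t :
  ulim (fun n => ev Om (4 ^ n) (vj i n)) f ->
  ulim (fun n => ev Om (4 ^ n) (dcoef Om (dX R j) (vj i n))) g ->
  weak_dx j (fun x => f (x, t)) (fun x => g (x, t)).
Proof.
move=> uf ug; apply: (weak_dx_ulim (u := fun n x => ev Om (4 ^ n) (vj i n) (x, t))
  (du := fun n x => ev Om (4 ^ n) (dcoef Om (dX R j) (vj i n)) (x, t))).
- by move=> n; apply: slice_continuous; exact: ev_continuous.
- by move=> n; apply: slice_continuous; exact: ev_continuous.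
- by move=> n; apply: slice_torus; exact: lim_per.
- by move=> n; apply: slice_torus; exact: lim_per.
- by move=> n z; apply: slice_is_derive; exact: ev_derive.
- exact: (ulim_comp (fun x => (x, t)) uf).
- exact: (ulim_comp (fun x => (x, t)) ug).
Qed.

Lemma lim_choice (N : nat -> nat) (A : 'I_2 -> nat -> Z3 -> R) : (forall j, l1c (A j)) ->
  (forall j n, supp (N n) (A j n)) ->
  exists f : 'I_2 -> spacetime R -> R, forall j, ulim (fun n => ev Om (N n) (A j n)) (f j).
Proof. 
move=> HA sA; suff /choice[f Hf] : forall j, exists f, ulim (fun n => ev Om (N n) (A j n)) f by exists f.
by move=> j; exact: l1c_ulim.
Qed.

Lemma flow_of_iterates : exists v : spacetime R -> 'rV[R]_2,
  regular_solution al eps T F v /\ (Loo_W1oo_norm v <= (12 * M)%:E)%E.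
Proof.
have M0 : 0 <= M by apply: bnd_ge0 (bnd_x 0%N).
have [v Hv] := lim_choice lim_vj supp_vj.
have [vt Ht] := lim_choice lim_dT (fun j n => supp_dcoef _ _ (@supp_vj j n)).
have /choice[D HD] : forall i, exists f : 'I_2 -> spacetime R -> R,
    forall j, ulim (fun n => ev Om (4 ^ n) (dcoef Om (dX R i) (vj j n))) (f j).
  by move=> i; apply: lim_choice (lim_dX i) _ => j n; apply: supp_dcoef; exact: supp_vj.
have [D2 HD2] : exists D2 : 'I_2 -> 'I_2 -> spacetime R -> R, 0 < eps -> forall i j,
    ulim (fun n => ev Om (4 ^ n) (dcoef Om (dX R i) (dcoef Om (dX R i) (vj j n)))) (D2 i j).
  (* Without viscosity no second derivative is asked for, and zero is a placeholder. *)
  have [ep|_] := ltP 0 eps; last by exists (fun _ _ _ => 0).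
  suff /choice[D2 H] : forall i, exists f : 'I_2 -> spacetime R -> R, forall j,
    ulim (fun n => ev Om (4 ^ n) (dcoef Om (dX R i) (dcoef Om (dX R i) (vj j n)))) (f j) by exists D2.
  by move=> i; apply: lim_choice (fun j => lim_d2 i j ep) _ => j n; do 2 apply: supp_dcoef; exact: supp_vj.
have [p0 Hp] := l1c_ulim Om lim_pc supp_pc.
have [P HP] := lim_choice lim_dpc (fun j n => supp_dcoef _ _ (@supp_pc n)).
pose row (f : 'I_2 -> spacetime R -> R) (z : spacetime R) : 'rV[R]_2 := \row_i f i z.
have rowE f i : (fun z => row f z 0 i) = f i by apply/funext => z; rewrite mxE.
exists (row v); split.
  exists (row vt), (fun j => row (D j)), (fun j => row (D2 j)),
    (fun z => p0 z + - 2^-1 * (v 0 z * v 0 z + 1 * (v 1 z * v 1 z))),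
    (row (fun j z => P j z - (v 0 z * D j 0 z + v 1 z * D j 1 z))).
  split; [| | | |split].
  - by move=> i; rewrite !rowE; exact: weak_lim intT (Hv i) (Ht i).
  - by move=> j i; rewrite !rowE; exact: weak_lim (@intX j) (Hv i) (HD j i).
  - by move=> ep j i; rewrite !rowE; exact: weak_lim (@intX j) (HD j i) (HD2 ep j i).
  - by move=> j; rewrite rowE; exact: bernoulli_weak.
  (* The terms [v_i * d_j v_i] in the pressure gradient reduce [v.grad v_j] to the [j]-th component
     of [w u^perp]. *)
  - apply: aeW => z; apply/rowP; apply: ord2P.
      have := momentum_lim 0 z Hv HD Ht (fun j => visc_lim j HD2) HP.
      by rewrite !sum2 !mxE /= => H; rewrite -[RHS]addr0 -[X in _ = _ + X]H; ring.
    have := momentum_lim 1 z Hv HD Ht (fun j => visc_lim j HD2) HP.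
    by rewrite !sum2 !mxE /= => H; rewrite -[RHS]addr0 -[X in _ = _ + X]H; ring.
  - apply: aeW => z; rewrite sum2 !mxE.
    have H : ulim (fun n => ev Om (4 ^ n) (fun k => 0 : R)) (fun z => D 0 0 z + D 1 1 z).
      apply: ulim_ext (ulimD (HD 0 0) (HD 1 1)) => n z'.
      by rewrite -evD; apply: eq_bigr => k _; rewrite !dXE /kj /vm /=; congr (_ * _); ring.
    apply: (ulim_unique H (ulim_ext _ (ulim_cst (fun=> 0))) z) => n z'.
    by rewrite /ev big1 // => k _; rewrite mul0r.
  - move=> t i; rewrite (_ : (fun x => row v (x, t) 0 i) = fun x => v i (x, t)); last first.
      by apply/funext => z; rewrite mxE.
    have ci n : leb2.-integrable (@torus R) (EFin \o (fun x => ev Om (4 ^ n) (vj i n) (x, t))).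
      by apply: cont_integrable2; apply: slice_continuous; exact: ev_continuous.
    apply: Rint_approx0; [exact: measurable_torus|exact: leb2_torus_fin| |].
      apply: cont_integrable2; apply: slice_continuous.
      by apply: ulim_continuous (Hv i) _ => n; exact: ev_continuous.
    move=> e ee; have [n Hn] := Hv i e ee.
    exists (fun x => ev Om (4 ^ n) (vj i n) (x, t)); split=> //; first exact: slice_mean.
    by move=> z _; rewrite distrC; exact: Hn.
(* Basis functions are bounded by [2], the l^1 norms of the coefficients of velocity and gradient by
   [2 * M], and the W^1_oo norm has [3] terms. *)
have -> : 12 * M = 3 * (2 * (2 * M)) by ring.
apply: ess_le => [|t]; first by rewrite !mulr_ge0.
apply: (W1oo_le (Du := fun j x => row (D j) (x, t))); first by rewrite !mulr_ge0.
- move=> j i; have := slice_weak t (Hv i) (HD j i); by rewrite -(rowE v i) -(rowE (D j) i).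
- move=> z i; rewrite mxE; apply: (ulim_bound (Hv i)) => n z''; apply: ev_le; exact: bnd_vj.
- move=> j z i; rewrite mxE; apply: (ulim_bound (HD j i)) => n z''; apply: ev_le; exact: bnd_dX.
Qed.

End Limit.

(** * The flow driven by a force with given coefficients *)

Section ForcedFlow.
Variable R : realType.
Local Notation k1 k := ((k : Z3).1.1%:~R : R).
Local Notation k2 k := ((k : Z3).1.2%:~R : R).

Lemma forced_flow : exists2 D : R, 1 <= D &
  forall (al eps Om r0 g0 FM : R) (w0 Fc1 Fc2 : Z3 -> R) (F : spacetime R -> 'rV[R]_2),
  0 <= al -> 0 <= eps -> 0 < al + eps -> 0 < Om -> 0 < r0 -> 0 <= g0 -> 3 * g0 <= r0 ->
  r0 * D <= al + eps ->
  bnd (fun k => `|Fc1 k|) FM -> bnd (fun k => `|Fc2 k|) FM ->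
  (forall k, k.1 = 0 -> Fc1 k = 0) -> (forall k, k.1 = 0 -> Fc2 k = 0) ->
  ulim (fun n => ev Om n Fc1) (fun z => F z 0 0) ->
  ulim (fun n => ev Om n Fc2) (fun z => F z 0 1) ->
  (forall k, hw R k = 0 -> w0 k = 0) ->
  (forall k, - Om * k.2%:~R * w0 (- k) = k2 k * Fc1 (- k) - k1 k * Fc2 (- k)) ->
  bnd (fun k => (hw R k * (rw R k ^+ 2 * w0 k)) ^+ 2) (g0 ^+ 2) ->
  exists v : spacetime R -> 'rV[R]_2,
    regular_solution al eps (2 * pi / Om) F v /\ (Loo_W1oo_norm v <= (r0 * D)%:E)%E.
Proof.
have [D D1 HD] := @galerkin_seq R; have [C C0 HC] := @l1_of_l2w R.
(* [D] is the smallness constant of the iteration and [12 * C] the ratio of the W^1_oo bound to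
   [r0]; their sum serves both purposes. *)
exists (D + 12 * C); first lra.
move=> al eps Om r0 g0 FM w0 Fc1 Fc2 F al0 e0 nu0 Om0 r00 g00 gr rD F1b F2b F10 F20 F1u F2u w00 w0E w0b.
have rC : 0 <= r0 * (12 * C) by rewrite !mulr_ge0 // ltW.
have rD' : r0 * D <= al + eps by move: rD rC; rewrite mulrDr; lra.
have [w [B B0 [xs xb xd xe xc]]] := HD al eps Om
  (fun k => k2 k * Fc1 (- k) - k1 k * Fc2 (- k)) w0 r0 g0 al0 e0 nu0 r00 g00 gr rD' w00 w0E w0b.
have xl n := HC (w n) r0 r00 (xb n).
have [v [rv nv]] := flow_of_iterates al0 e0 B0 xs xb xd xe xc xl F1b F2b F10 F20 Om0 F1u F2u.
exists v; split => //; apply: le_trans nv _; rewrite lee_fin.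
rewrite mulrDr; have : 0 <= r0 * D by apply: mulr_ge0; [exact: ltW|exact: le_trans D1].
lra.
Qed.

End ForcedFlow.

Notation Z2 := (int * int)%type.

(** * Fourier series on the torus *)

Section PlaneFourier.
Variable R : realType.
Implicit Types (k q p : Z2) (f g h : plane R -> R) (x y : plane R).
Local Notation leb := (@lebesgue_measure R).
Local Notation leb2 := (leb \x leb)%E.
Local Notation I f := (\int[leb2]_(x in @torus R) f x).
Local Notation A := ((2 * pi) ^+ 2 : R).

Lemma area_gt0 : 0 < A. Proof. by rewrite exprn_gt0 // mulr_gt0 // pi_gt0. Qed.

Lemma fine_torus : fine (leb2 (@torus R)) = A.
Proof.
have itv : leb `[0, 2 * pi]%classic = (2 * pi)%:E.
  by rewrite lebesgue_measure_itv /= lte_fin mulr_gt0 ?pi_gt0 // -EFinB subr0.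
rewrite /torus product_measure1E; [|exact: measurable_itv..].
rewrite (_ : (_ * _)%E = ((2 * pi)%:E * (2 * pi)%:E)%E) ?expr2 //.
by congr (_ * _)%E; exact: itv.
Qed.

Lemma int_cst c : I (fun=> c) = c * A.
Proof. by rewrite Rintegral_cst ?fine_torus //; exact: measurable_torus. Qed.

Lemma intD f g : continuous f -> continuous g -> I (fun x => f x + g x) = I f + I g.
Proof. by move=> cf cg; apply: RintegralD; [exact: measurable_torus|exact: cont_integrable2..]. Qed.

Lemma intZ c f : continuous f -> I (fun x => c * f x) = c * I f.
Proof. by move=> cf; apply: RintegralZl; [exact: measurable_torus|exact: cont_integrable2]. Qed.

Lemma int_le f g : continuous f -> continuous g -> (forall x, f x <= g x) -> I f <= I g.
Proof. by move=> cf cg fg; apply: le_Rintegral; [exact: measurable_torus|exact: cont_integrable2..|]. Qed.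

Lemma int_norm f c : continuous f -> (forall x, `|f x| <= c) -> `|I f| <= c * A.
Proof.
move=> cf fc; apply: le_trans (le_normr_Rintegral _ (cont_integrable2 cf)) _; first exact: measurable_torus.
rewrite -int_cst; apply: int_le => //; last exact: cst_continuous.
by move=> x; apply: cvg_norm; exact: cf.
Qed.

Lemma continuous_sum (s : seq Z2) (F : Z2 -> plane R -> R) : (forall k, continuous (F k)) ->
  continuous (fun x => \sum_(k <- s) F k x).
Proof.
move=> cF; elim: s => [|k s IH].
  rewrite (_ : (fun _ => _) = cst 0); first exact: cst_continuous.
  by apply/funext => x; rewrite big_nil.
rewrite (_ : (fun _ => _) = fun x => F k x + \sum_(k <- s) F k x); first exact: continuousD_.
by apply/funext => x; rewrite big_cons.
Qed.

Lemma int_sum (s : seq Z2) (F : Z2 -> plane R -> R) : (forall k, continuous (F k)) ->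
  I (fun x => \sum_(k <- s) F k x) = \sum_(k <- s) I (F k).
Proof.
move=> cF; elim: s => [|k s IH].
  rewrite big_nil (_ : (fun _ => _) = fun=> 0); first by rewrite int_cst mul0r.
  by apply/funext => x; rewrite big_nil.
rewrite big_cons -IH -intD //; last exact: continuous_sum.
by congr Rintegral; apply/funext => x; rewrite big_cons.
Qed.

Lemma int_dx j psi g : continuous g -> torus_fun psi ->
  (forall x, is_derive x (dx R j) psi (g x)) -> I g = 0.
Proof. by move=> cg tp dp; rewrite /Rintegral (int_dx0 cg tp dp). Qed.

Definition dot k x : R := k.1%:~R * x.1 + k.2%:~R * x.2.
Definition c2 k x : R := cos (dot k x) + sin (dot k x).
Definition kc (j : 'I_2) k : R := if j == 0 then k.1%:~R else k.2%:~R.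

(** The planar basis is the case [Om = 0] of the space-time one, from which its properties are
    transferred. *)
Lemma c2_cas k x : c2 k x = cas 0 (k, 0) (x, 0).
Proof. by rewrite /cas /phase /= !mul0r addr0. Qed.

Lemma dotN k x : dot (- k) x = - dot k x.
Proof. by rewrite /dot /= !mulrNz; ring. Qed.

Lemma c2_continuous k : continuous (c2 k).
Proof.
rewrite (_ : c2 k = fun x => cas 0 (k, 0) (x, 0)); last by apply/funext => x; rewrite c2_cas.
by apply: slice_continuous; exact: cas_continuous.
Qed.

Lemma c2_torus k : torus_fun (c2 k).
Proof.
move=> j x; rewrite !c2_cas -(@cas_shift R 0 (k, 0) (x, 0) ((2 * pi) *: dX R j) (if j == 0 then k.1 else k.2)).
  by congr cas; congr pair; rewrite /= scaler0 addr0.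
by rewrite /phase /dX /dx; case: ifP => _ /=; rewrite -![_ *: _]/(_ * _); ring.
Qed.

Lemma c2_derive k x j : is_derive x (dx R j) (c2 k) (kc j k * c2 (- k) x).
Proof.
rewrite (_ : c2 k = fun x => cas 0 (k, 0) (x, 0)); last by apply/funext => z; rewrite c2_cas.
have := slice_is_derive (cas_derive 0 (k, 0) (x, 0) (dX R j)).
rewrite c2_cas (_ : phase 0 (k, 0) (dX R j) = kc j k) //.
by rewrite /phase /dX /dx /kc; case: ifP => _ /=; ring.
Qed.

Lemma c2_le k x : `|c2 k x| <= 2.
Proof. by rewrite c2_cas; exact: cas_le2. Qed.

Lemma c2_mul k q x : c2 k x * c2 q x =
  2^-1 * (c2 (k - q) x + c2 (q - k) x + c2 (k + q) x - c2 (- k - q) x).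
Proof. by rewrite !c2_cas; exact: (cas_mul 0 (k, 0) (q, 0) (x, 0)). Qed.

Lemma c2_shift k x y : c2 k (x + y) = cos (dot k y) * c2 k x + sin (dot k y) * c2 (- k) x.
Proof.
have dD : dot k (x + y) = dot k x + dot k y by rewrite /dot /=; ring.
by rewrite /c2 dD dotN cosN sinN cosD sinD; ring.
Qed.

Lemma c20 x : c2 0 x = 1.
Proof. by rewrite /c2 /dot /= !mul0r addr0 cos0 sin0 addr0. Qed.

Lemma int_c2 k : I (c2 k) = (k == 0)%:R * A.
Proof.
have [->|k0] := eqVneq k 0.
  by rewrite mul1r -[RHS]mul1r -int_cst; congr Rintegral; apply/funext => x; rewrite c20.
rewrite mul0r; have [j kj0] : exists j, kc j k != 0.
  case: k k0 => a b; rewrite xpair_eqE negb_and => /orP[a0|b0].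
    by exists 0; rewrite /kc /= intr_eq0.
  by exists 1; rewrite /kc /= intr_eq0.
apply: (@int_dx j (fun x => (- (kc j k)^-1) * c2 (- k) x)).
- exact: c2_continuous.
- by move=> i x; rewrite c2_torus.
- move=> x; have := is_deriveZ (- (kc j k)^-1) (c2_derive (- k) x j).
  rewrite opprK (_ : kc j (- k) = - kc j k); last by rewrite /kc; case: ifP => _; rewrite /= mulrNz.
  by rewrite (_ : _ *: (_ * _) = c2 k x) // /GRing.scale /=; field.
Qed.

Lemma c2_orth k q : I (fun x => c2 k x * c2 q x) = (k == q)%:R * A.
Proof.
have cc := c2_continuous.
have cN (p : Z2) : continuous (fun x => - 1 * c2 p x).
  by apply: continuousM_ => //; exact: cst_continuous.
rewrite (_ : (fun x => _) = fun x => 2^-1 * (c2 (k - q) x + c2 (q - k) x + c2 (k + q) x + - 1 * c2 (- k - q) x)); last first.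
  by apply/funext => x; rewrite c2_mul mulN1r.
have c1 : continuous (fun x => c2 (k - q) x + c2 (q - k) x) by apply: continuousD_.
have c2' : continuous (fun x => c2 (k - q) x + c2 (q - k) x + c2 (k + q) x) by apply: continuousD_.
rewrite intZ; last exact: continuousD_.
rewrite (intD c2' (cN _)) (intD c1 (cc _)) (intD (cc _) (cc _)) (intZ _ (cc _)) !int_c2 !subr_eq0 [q == k]eq_sym addr_eq0 eqr_oppLR.
by field.
Qed.

(** Sum of the cosine and sine coefficients, that is, the real part minus the imaginary part of the
    complex Fourier coefficient. *)
Definition fh f k : R := A^-1 * I (fun x => f x * c2 k x).

Lemma cont_fc f k : continuous f -> continuous (fun x => f x * c2 k x).
Proof. by move=> cf; apply: continuousM_ => //; exact: c2_continuous. Qed.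

Lemma kcN j k : kc j (- k) = - kc j k.
Proof. by rewrite /kc; case: ifP => _; rewrite /= mulrNz. Qed.

Lemma fh_derive j f g k : continuous f -> continuous g -> torus_fun f ->
  (forall x, is_derive x (dx R j) f (g x)) -> fh g k = - kc j k * fh f (- k).
Proof.
move=> cf cg tf df.
have H : I (fun x => f x * (kc j k * c2 (- k) x) + g x * c2 k x) = 0.
  apply: (@int_dx j (fun x => f x * c2 k x)).
  - apply: continuousD_; last exact: cont_fc.
    by apply: continuousM_ => //; apply: continuousM_; [exact: cst_continuous|exact: c2_continuous].
  - by move=> i; apply: periodicM; [exact: tf|exact: c2_torus].
  - by move=> x; exact: is_deriveM_ (df x) (c2_derive k x j).
rewrite /fh mulrCA; congr (_ * _).
apply/eqP; rewrite mulNr -addr_eq0 -H; apply/eqP.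
rewrite intD; [|by apply: continuousM_ => //; apply: continuousM_; [exact: cst_continuous|exact: c2_continuous]|exact: cont_fc].
rewrite addrC -intZ; last exact: cont_fc.
by congr (_ + _); congr Rintegral; apply/funext => x; ring.
Qed.

Lemma fhB f g k : continuous f -> continuous g -> fh (fun x => f x - g x) k = fh f k - fh g k.
Proof.
move=> cf cg; rewrite /fh -mulrBr; congr (_ * _).
rewrite -mulN1r -intZ -?intD; try exact: cont_fc.
  by congr Rintegral; apply/funext => x; ring.
by apply: continuousM_; [exact: cst_continuous|exact: cont_fc].
Qed.

Lemma bessel f (c : R) : continuous f -> (forall x, `|f x| <= c) ->
  bnd (fun k => fh f k ^+ 2) (c ^+ 2).
Proof.
move=> cf fc s us; pose P x := \sum_(k <- s) fh f k * c2 k x.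
have ct k : continuous (fun x => fh f k * c2 k x).
  by apply: continuousM_; [exact: cst_continuous|exact: c2_continuous].
have cP : continuous P by exact: continuous_sum.
have Ff k : I (fun x => f x * c2 k x) = A * fh f k.
  by rewrite /fh mulrA divff ?mul1r // gt_eqF // area_gt0.
set Q := \sum_(k <- s) _.
have fP : I (fun x => f x * P x) = A * Q.
  rewrite (_ : (fun x => _) = fun x => \sum_(k <- s) f x * (fh f k * c2 k x)); last first.
    by apply/funext => x; rewrite mulr_sumr.
  rewrite int_sum => [|k]; last exact: continuousM_.
  rewrite mulr_sumr; apply: eq_bigr => k _.
  rewrite (_ : (fun x => _) = fun x => fh f k * (f x * c2 k x)); last by apply/funext => x; ring.
  by rewrite intZ ?Ff; [ring|exact: cont_fc].
have PP : I (fun x => P x * P x) = A * Q.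
  rewrite (_ : (fun x => _) = fun x => \sum_(k <- s) P x * (fh f k * c2 k x)); last first.
    by apply/funext => x; rewrite -mulr_sumr.
  rewrite int_sum => [|k]; last exact: continuousM_.
  rewrite mulr_sumr; apply: eq_big_seq => k ks.
  rewrite (_ : (fun x => _) = fun x => fh f k * \sum_(q <- s) fh f q * (c2 q x * c2 k x)); last first.
    by apply/funext => x; rewrite /P mulrCA mulr_suml; congr (_ * _); apply: eq_bigr => q _; rewrite mulrA.
  have cc q : continuous (fun x => c2 q x * c2 k x) by exact/cont_fc/c2_continuous.
  have cqq q : continuous (fun x => fh f q * (c2 q x * c2 k x)).
    by apply: continuousM_ => //; exact: cst_continuous.
  rewrite intZ; last exact: continuous_sum.
  rewrite int_sum // (bigD1_seq k) //= big1 => [|q qk].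
    by rewrite intZ // c2_orth eqxx addr0 mul1r; ring.
  by rewrite intZ // c2_orth (negPf qk) mul0r mulr0.
have cf2 : continuous (fun x => f x * f x) by exact: continuousM_.
have cfP : continuous (fun x => f x * P x) by exact: continuousM_.
have cPP : continuous (fun x => P x * P x) by exact: continuousM_.
have cZ (r : R) g : continuous g -> continuous (fun x => r * g x).
  by move=> cg; apply: continuousM_ => //; exact: cst_continuous.
have H : 0 <= I (fun x => (f x * f x + - 2 * (f x * P x)) + P x * P x).
  have <- : I (fun=> 0) = 0 by rewrite int_cst mul0r.
  apply: int_le; [exact: cst_continuous| |].
    by apply: continuousD_ => //; apply: continuousD_ => //; exact: cZ.
  by move=> x; have := sqr_ge0 (f x - P x); nra.
have ff : I (fun x => f x * f x) <= c ^+ 2 * A.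
  rewrite -int_cst; apply: int_le => //; first exact: cst_continuous.
  by move=> x; rewrite -expr2 -real_normK ?num_real //; exact: expr_le.
move: H; rewrite intD //; last by apply: continuousD_ => //; exact: cZ.
rewrite intD //; last exact: cZ.
rewrite intZ // fP PP => H.
have : A * Q <= A * c ^+ 2 by move: H ff; lra.
by rewrite ler_pM2l // area_gt0.
Qed.

End PlaneFourier.

(** * Completeness of the trigonometric system on the torus *)

Section Completeness.
Variable R : realType.
Implicit Types (k q p : Z2) (f g h : plane R -> R) (x y : plane R).
Local Notation leb := (@lebesgue_measure R).
Local Notation leb2 := (leb \x leb)%E.
Local Notation I f := (\int[leb2]_(x in @torus R) f x).
Local Notation A := ((2 * pi) ^+ 2 : R).

(** A trigonometric polynomial with values in [[0, 1]], equal to [1] exactly where [dot p x] is [t]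
    modulo [2 pi]; powers of a product of two of them concentrate at a point. *)
Definition bump p (t : R) x : R := 2^-1 * (1 + cos (dot p x - t)).

Lemma dot_continuous p : continuous (dot (R := R) p).
Proof.
move=> x; apply: cvgD; apply: cvgM; try exact: cvg_cst; [exact: cvg_fst|exact: cvg_snd].
Qed.

Lemma bump_continuous p t : continuous (bump p t).
Proof.
move=> x; apply: cvgM; first exact: cvg_cst.
apply: cvgD; first exact: cvg_cst.
apply: (@continuous_comp _ _ _ (fun x => dot p x - t) cos); last exact: continuous_cos.
by apply: cvgB; [exact: dot_continuous|exact: cvg_cst].
Qed.

Lemma bump_ge0 p t x : 0 <= bump p t x.
Proof. by rewrite /bump; have := cos_geN1 (dot p x - t); lra. Qed.

Lemma bump_mul p t k x : bump p t x * c2 k x = 2^-1 * c2 k x +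
  4^-1 * (cos t * c2 (k + p) x + cos t * c2 (k - p) x + sin t * c2 (- (k - p)) x
    + - sin t * c2 (- (k + p)) x).
Proof.
have dD q1 q2 : dot (q1 + q2) x = dot q1 x + dot q2 x by rewrite /dot /= !intrD; ring.
rewrite /bump /c2 !(dotN, dD) !(cosN, sinN, cosD, sinD, dotN).
by field.
Qed.

(** A bump times a basis function is a combination of basis functions, so orthogonality to all of
    them is inherited. *)
Lemma orth_bump h g p t : continuous h -> continuous g ->
  (forall k, I (fun x => h x * g x * c2 k x) = 0) ->
  forall k, I (fun x => h x * (g x * bump p t x) * c2 k x) = 0.
Proof.
move=> ch cg H k; pose G k x := h x * g x * c2 k x.
have cG q : continuous (G q) by apply: continuousM_ (@c2_continuous _ _); exact: continuousM_.
have cZ (r : R) f : continuous f -> continuous (fun x => r * f x).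
  by move=> cf; apply: continuousM_ => //; exact: cst_continuous.
have -> : (fun x => h x * (g x * bump p t x) * c2 k x) = fun x => 2^-1 * G k x + 4^-1 *
    (cos t * G (k + p) x + cos t * G (k - p) x + sin t * G (- (k - p)) x + - sin t * G (- (k + p)) x).
  apply/funext => x; transitivity (h x * g x * (bump p t x * c2 k x)); first by ring.
  by rewrite bump_mul /G; ring.
have c1 : continuous (fun x => cos t * G (k + p) x + cos t * G (k - p) x).
  by apply: continuousD_; exact: cZ.
have c2' : continuous (fun x => cos t * G (k + p) x + cos t * G (k - p) x + sin t * G (- (k - p)) x).
  by apply: continuousD_ => //; exact: cZ.
have c3 : continuous (fun x => cos t * G (k + p) x + cos t * G (k - p) x + sin t * G (- (k - p)) x + - sin t * G (- (k + p)) x).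
  by apply: continuousD_ => //; exact: cZ.
rewrite (intD (cZ _ _ (cG _)) (cZ _ _ c3)) (intZ _ (cG _)) (intZ _ c3).
rewrite (intD c2' (cZ _ _ (cG _))) (intD c1 (cZ _ _ (cG _))) (intD (cZ _ _ (cG _)) (cZ _ _ (cG _))).
have iG (r : R) q : I (fun x => r * G q x) = 0 by rewrite (intZ _ (cG q)) (H q : I (G q) = 0) mulr0.
by rewrite !iG (H k : I (G k) = 0) !addr0 !mulr0 addr0.
Qed.

Let md0 : Z2 := (1, 0).
Let md1 : Z2 := (0, 1).

Lemma dotmd0 x : dot md0 x = x.1. Proof. by rewrite /dot /= mul0r addr0 mul1r. Qed.
Lemma dotmd1 x : dot md1 x = x.2. Proof. by rewrite /dot /= mul0r add0r mul1r. Qed.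

Definition kern y x : R := bump md0 y.1 x * bump md1 y.2 x.

Lemma kern_continuous y n : continuous (fun x => kern y x ^+ n).
Proof.
elim: n => [|n IH]; first exact: cst_continuous.
rewrite (_ : (fun x => _) = fun x => kern y x * kern y x ^+ n); last by apply/funext => x; rewrite exprS.
by apply: continuousM_ => //; apply: continuousM_; exact: bump_continuous.
Qed.

Lemma orth_kern h y n : continuous h -> (forall k, fh h k = 0) ->
  I (fun x => h x * kern y x ^+ n) = 0.
Proof.
move=> ch h0; suff H k : I (fun x => h x * kern y x ^+ n * c2 k x) = 0.
  by rewrite -(H 0); congr Rintegral; apply/funext => x; rewrite c20 mulr1.
elim: n k => [|n IH] k.
  have /eqP := h0 k; rewrite /fh mulf_eq0 invr_eq0 gt_eqF ?area_gt0 //= => /eqP <-.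
  by congr Rintegral; apply/funext => x; rewrite expr0 mulr1.
have := orth_bump md1 y.2 ch _ (orth_bump md0 y.1 ch (@kern_continuous y n) IH) k.
move=> <-; last by apply: continuousM_; [exact: kern_continuous|exact: bump_continuous].
by congr Rintegral; apply/funext => x; rewrite exprSr /kern; ring.
Qed.

(* For [a] a coordinate of [x - y]: where [kern y x] is not small, [x] is close to [y] modulo
   the periods. *)
Lemma cos_near (a d : R) : 0 < d -> d <= pi -> cos d < cos a ->
  exists m : int, `|a + m%:~R * (2 * pi)| < d.
Proof.
move=> d0 dpi ca; have p0 : 0 < pi :> R by exact: pi_gt0.
pose m := Num.floor ((a + pi) / (2 * pi)); exists (- m).
set b := a + _.
have cb : cos b = cos a by rewrite /b; apply: trig_periodz; exact: cosD2pi.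
have [h1 h2] : - pi <= b /\ b < pi.
  have p2 : 0 < 2 * pi :> R by rewrite mulr_gt0.
  have := floor_le ((a + pi) / (2 * pi)); rewrite -/m ler_pdivlMr // => h1.
  have /andP[_] := floor_itv ((a + pi) / (2 * pi)); rewrite -/m ltr_pdivrMr // intrD => h2.
  by rewrite /b mulrNz; split; nra.
rewrite ltNge; apply/negP => db.
have cb' : cos `|b| = cos a by rewrite -cb; case: (ger0P b) => // _; rewrite cosN.
have bpi : `|b| <= pi by rewrite ler_norml h1 ltW.
have : cos `|b| <= cos d.
  rewrite leNgt ltr_cos -?leNgt //; rewrite in_itv /=; first by rewrite normr_ge0.
  by rewrite ltW.
by rewrite cb' leNgt ca.
Qed.

Lemma geom_absurd (a b p q : R) : 0 < a -> 0 <= q -> q < p ->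
  ~ (forall n, a * p ^+ n <= b * q ^+ n).
Proof.
move=> a0 q0 qp H; have p0 : 0 < p by exact: le_lt_trans qp.
have z1 : `|q / p| < 1 by rewrite ger0_norm ?divr_ge0 ?(ltW p0) // ltr_pdivrMr // mul1r.
have e0 : 0 < a / (`|b| + 1) by apply: divr_gt0 => //; have := normr_ge0 b; lra.
have /cvgrPdist_lt /(_ _ e0) [N _ HN] := cvg_expr z1.
have := HN N (leqnn N) => /=.
rewrite sub0r normrN ger0_norm ?exprn_ge0 ?divr_ge0 ?(ltW p0) // expr_div_n ltr_pdivlMr; last first.
  by have := normr_ge0 b; lra.
have pn : 0 < p ^+ N by rewrite exprn_gt0.
rewrite mulrAC ltr_pdivrMr // => h2; have := H N.
have : b * q ^+ N <= q ^+ N * (`|b| + 1).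
  by rewrite mulrC ler_wpM2l ?exprn_ge0 //; have := ler_norm b; lra.
lra.
Qed.

Lemma torus_period h x (m1 m2 : int) : torus_fun h ->
  h (x.1 + m1%:~R * (2 * pi), x.2 + m2%:~R * (2 * pi)) = h x.
Proof.
move=> th; case: x => a b /=.
have -> : h (a + m1%:~R * (2 * pi), b + m2%:~R * (2 * pi)) = h (a, b + m2%:~R * (2 * pi)).
  apply: (trig_periodz (f := fun s => h (s, b + m2%:~R * (2 * pi)))) => s.
  rewrite -(th 0 (s, _)); congr h; congr pair; rewrite /dx /= -[_ *: _]/(_ * _) -?[_ *: _]/(_ * _); ring.
apply: (trig_periodz (f := fun s => h (a, s))) => s.
by rewrite -(th 1 (a, s)); congr h; congr pair; rewrite /dx /= -[_ *: _]/(_ * _) -?[_ *: _]/(_ * _); ring.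
Qed.

Lemma torus_repr x : exists m1 m2 : int, [/\ 0 <= x.1 + m1%:~R * (2 * pi) < 2 * pi
  & 0 <= x.2 + m2%:~R * (2 * pi) < 2 * pi].
Proof.
have p2 : 0 < 2 * pi :> R by rewrite mulr_gt0 // pi_gt0.
have H (a : R) : exists m : int, 0 <= a + m%:~R * (2 * pi) < 2 * pi.
  exists (- Num.floor (a / (2 * pi))); have /andP[] := floor_itv (a / (2 * pi)).
  rewrite ler_pdivlMr // ltr_pdivrMr // intrD mulrNz => h1 h2.
  by apply/andP; split; nra.
by have [m1 H1] := H x.1; have [m2 H2] := H x.2; exists m1, m2.
Qed.

Lemma int_lower f (y1 y2 r e : R) : continuous f -> (forall x, torus x -> 0 <= f x) ->
  0 < r -> 0 <= y1 -> y1 + r <= 2 * pi -> 0 <= y2 -> y2 + r <= 2 * pi -> 0 <= e ->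
  (forall x, y1 <= x.1 <= y1 + r -> y2 <= x.2 <= y2 + r -> e <= f x) ->
  e * (r * r) <= I f.
Proof.
move=> cf f0 r0 a0 a1 b0 b1 e0 fe.
pose B : set (plane R) := `[y1, y1 + r]%classic `*` `[y2, y2 + r]%classic.
have mB : measurable B by apply: measurableX; exact: measurable_itv.
have itv (a : R) : leb `[a, a + r]%classic = r%:E.
  by rewrite lebesgue_measure_itv /= lte_fin ltrDl r0 -EFinB addrAC subrr add0r.
have mu : leb2 B = (r * r)%:E.
  rewrite /B product_measure1E; [|exact: measurable_itv..].
  rewrite (_ : (_ * _)%E = (r%:E * r%:E)%E) //; congr (_ * _)%E; exact: itv.
have mf : measurable_fun setT (EFin \o f) by apply/measurable_EFinP; exact: cont_measurable2.
have fB x : B x -> e <= f x.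
  by move=> [/=]; rewrite !in_itv /= => h1 h2; exact: fe.
have Bt : B `<=` @torus R.
  move=> x [/=]; rewrite !in_itv /= => /andP[h1 h2] /andP[h3 h4]; split; rewrite /= in_itv /=.
    by apply/andP; split; lra.
  by apply/andP; split; lra.
rewrite -lee_fin /Rintegral fineK; last first.
  by apply: integrable_fin_num (cont_integrable2 cf); exact: measurable_torus.
apply: (@le_trans _ _ (\int[leb2]_(x in B) (f x)%:E)%E).
  rewrite EFinM -mu -integral_cst //; apply: ge0_le_integral => //.
  by apply: measurable_funS mf.
apply: ge0_subset_integral => //; first exact: measurable_torus.
by apply: measurable_funS mf.
Qed.

(** If [h y0 > 0], the vanishing integral of [h * kern^n] becomes impossible for large [n]: near the
    peak it gains a multiple of [s^(2 n)], whereas [kern <= q < s^2] wherever [h] may be small or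
    negative. *)
Lemma fourier_complete_le0 h y0 : continuous h -> torus_fun h -> (forall k, fh h k = 0) ->
  h y0 <= 0.
Proof.
move=> ch th h0; rewrite leNgt; apply/negP => hy0.
have [m1 [m2 []]] := torus_repr y0; set y1 := _ + _; set y2 := _ + _ => /andP[y10 y11] /andP[y20 y21].
pose y : plane R := (y1, y2).
have hy : h y = h y0 by exact: torus_period.
pose c := h y / 2; have c0 : 0 < c by rewrite /c hy; apply: divr_gt0.
have [d1 d10 Hd1] : exists2 d : R, 0 < d & forall x, `|x.1 - y1| < d -> `|x.2 - y2| < d -> c <= h x.
  have /cvgrPdist_lt /(_ _ c0) /nbhs_ballP [d /= d0 Hd] := ch y.
  exists d => // x x1 x2; have /Hd : ball y d x by split; rewrite /ball /= distrC.
  by rewrite /= ltr_norml => /andP[_]; rewrite /c; lra.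
pose d := Num.min d1 pi.
have d0 : 0 < d by rewrite lt_min d10 pi_gt0.
have dpi : d <= pi by rewrite ge_min lexx orbT.
have dd1 : d <= d1 by rewrite ge_min lexx.
(* [q] bounds a bump at distance at least [d] from its peak. The arithmetic mean [s] of [1] and [q]
   exceeds their geometric mean, which is [q < s^2]. *)
pose q := (1 + cos d) / 2; pose s := (1 + q) / 2.
have q0 : 0 <= q by rewrite /q; have := cos_geN1 d; lra.
have cd1 : cos d < 1.
  rewrite -(@cos0 R) ltr_cos // in_itv /=; last by rewrite ltW.
  by rewrite lexx pi_ge0.
have q1 : q < 1 by rewrite /q; lra.
have qs : q < s ^+ 2 by rewrite /s; nra.
have s0 : 0 < s by rewrite /s; lra.
have sq : q < s by rewrite /s; lra.
have [r1 r10 Hr1] : exists2 r : R, 0 < r & forall a, `|a| < r -> s <= 2^-1 * (1 + cos a).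
  have e0 : 0 < 2 * (1 - s) by rewrite /s; lra.
  have /cvgrPdist_lt /(_ _ e0) /nbhs_ballP [r /= r0 Hr] := @continuous_cos R 0.
  exists r => // a ar; have /Hr : ball (0 : R) r a by rewrite /ball /= sub0r normrN.
  by rewrite /= cos0 ltr_norml => /andP[_]; lra.
(* The square with lower left corner [y] is used, not one centred at [y], because [y] may lie on the
   edge of the cell; [r] keeps it inside. *)
pose r := Num.min (r1 / 2) (Num.min (2 * pi - y1) (2 * pi - y2)).
have r0 : 0 < r by rewrite !lt_min divr_gt0 // !subr_gt0 y11 y21.
have rr1 : r < r1.
  by apply: (@le_lt_trans _ _ (r1 / 2)); [rewrite ge_min lexx|lra].
have ry1 : y1 + r <= 2 * pi.
  have : r <= 2 * pi - y1 by rewrite !ge_min lexx ?orbT.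
  lra.
have ry2 : y2 + r <= 2 * pi.
  have : r <= 2 * pi - y2 by rewrite !ge_min lexx ?orbT.
  lra.
have [M0 HM0] := cont_compact_bounded (@compact_torus R) ch; pose M := `|M0|.
have HM x : torus x -> `|h x| <= M by move=> /HM0 /le_trans; apply; exact: ler_norm.
have M0' : 0 <= M by exact: normr_ge0.
have far x : ~~ ((cos d < cos (x.1 - y1)) && (cos d < cos (x.2 - y2))) -> kern y x <= q.
  rewrite negb_and -!leNgt /kern /bump dotmd0 dotmd1 /= => /orP[h1|h1].
    apply: (@le_trans _ _ (2^-1 * (1 + cos (x.1 - y1)) * 1)); last by rewrite /q; lra.
    apply: ler_wpM2l; first by have := cos_geN1 (x.1 - y1); lra.
    by have := cos_le1 (x.2 - y2); lra.
  apply: (@le_trans _ _ (1 * (2^-1 * (1 + cos (x.2 - y2))))); last by rewrite /q; lra.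
  apply: ler_wpM2r; first by have := cos_geN1 (x.2 - y2); lra.
  by have := cos_le1 (x.1 - y1); lra.
have near x : (cos d < cos (x.1 - y1)) && (cos d < cos (x.2 - y2)) -> c <= h x.
  move=> /andP[/(cos_near d0 dpi)[a Ha] /(cos_near d0 dpi)[b Hb]].
  rewrite -(torus_period x a b th); apply: Hd1 => /=.
    by rewrite addrAC; apply: lt_le_trans Ha dd1.
  by rewrite addrAC; apply: lt_le_trans Hb dd1.
have K0 x : 0 <= kern y x by apply: mulr_ge0; exact: bump_ge0.
apply: (@geom_absurd (c * (r * r)) (M * A) (s ^+ 2) q _ q0 qs).
  exact: mulr_gt0 c0 (mulr_gt0 r0 r0).
(* The added constant makes [f] nonnegative on the whole torus, so that its integral may be
   restricted to the square. *)
move=> n; pose f x := h x * kern y x ^+ n + M * q ^+ n.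
have cK : continuous (fun x => h x * kern y x ^+ n) by apply: continuousM_ => //; exact: kern_continuous.
have cc : continuous (fun _ : plane R => M * q ^+ n) by exact: cst_continuous.
have If : I f = M * q ^+ n * A by rewrite (intD cK cc) orth_kern // int_cst add0r.
rewrite [leRHS](_ : _ = I f); last by rewrite If; ring.
rewrite mulrAC; apply: (@int_lower f y1 y2); rewrite ?(ltW y10) //.
- exact: continuousD_.
- move=> x tx; rewrite /f; have [nr|fr] := boolP ((cos d < cos (x.1 - y1)) && (cos d < cos (x.2 - y2))).
    have hc := near x nr; apply: addr_ge0; apply: mulr_ge0 => //; rewrite ?exprn_ge0 //; lra.
  have h1 : `|h x * kern y x ^+ n| <= M * q ^+ n.
    rewrite normrM; apply: ler_pM => //; first exact: HM.
    by rewrite ger0_norm ?exprn_ge0 //; apply: expr_le => //; exact: far.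
  by move: h1; rewrite ler_norml => /andP[]; lra.
- by rewrite mulr_ge0 ?(ltW c0) // !exprn_ge0 ?(ltW s0).
- move=> x /andP[a1 a2] /andP[b1 b2].
  have A1 : s <= 2^-1 * (1 + cos (x.1 - y1)).
    by apply: Hr1; rewrite ger0_norm ?subr_ge0 //; lra.
  have A2 : s <= 2^-1 * (1 + cos (x.2 - y2)).
    by apply: Hr1; rewrite ger0_norm ?subr_ge0 //; lra.
  have nr : (cos d < cos (x.1 - y1)) && (cos d < cos (x.2 - y2)).
    by move: sq; rewrite /q => sq; apply/andP; split; lra.
  have hc := near x nr; rewrite /f.
  have kp : s ^+ 2 <= kern y x.
    by rewrite /kern /bump dotmd0 dotmd1 expr2; apply: ler_pM => //; exact: ltW.
  have : c * s ^+ 2 ^+ n <= h x * kern y x ^+ n.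
    apply: ler_pM => //; [exact: ltW|by rewrite exprn_ge0 // exprn_ge0 // ltW|].
    by apply: expr_le => //; rewrite exprn_ge0 // ltW.
  have : 0 <= M * q ^+ n by rewrite mulr_ge0 // exprn_ge0.
  lra.
Qed.

Lemma fourier_complete h : continuous h -> torus_fun h -> (forall k, fh h k = 0) ->
  forall x, h x = 0.
Proof.
move=> ch th h0 x; apply/le_anti; rewrite fourier_complete_le0 //=.
have c0 : continuous (fun _ : plane R => 0 : R) by exact: cst_continuous.
rewrite -oppr_le0 -[leLHS]sub0r; apply: (@fourier_complete_le0 (fun x => 0 - h x)).
- by move=> z; apply: cvgB; [exact: cvg_cst|exact: ch].
- by move=> j z; rewrite th.
- move=> k; rewrite fhB // h0 subr0 /fh (_ : (fun x => _) = fun=> 0) ?int_cst ?mul0r ?mulr0 //.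
  by apply/funext => z; rewrite mul0r.
Qed.

End Completeness.

(** * Decay of coefficients and Fourier inversion *)

Section Decay.
Variable R : realType.
Implicit Types (k q p : Z2) (f g h : plane R -> R) (x y : plane R) (a b : Z2 -> R).
Local Notation leb := (@lebesgue_measure R).
Local Notation leb2 := (leb \x leb)%E.
Local Notation I f := (\int[leb2]_(x in @torus R) f x).
Local Notation A := ((2 * pi) ^+ 2 : R).

Lemma derive_torus j f : torus_fun f -> torus_fun (fun x : plane R => 'D_(dx R j) f x).
Proof.
move=> tf i x; rewrite /derive tf.
have -> : f \o shift (x + (2 * pi) *: dx R i) = f \o shift x; last by [].
by apply/funext => t; rewrite /shift /= addrA tf.
Qed.

Lemma Ck_derive (V : normedModType R) n (f : V -> R) (e : V) : Ck n.+1 f ->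
  [/\ continuous f, Ck n (fun z : V => 'D_e f z) & forall z : V, is_derive z e f ('D_e f z)].
Proof.
move=> [cf /(_ e)[df Cf]]; split => // x; apply: DeriveDef => //; exact: df.
Qed.

Lemma Ck_cont (V : normedModType R) n (f : V -> R) : Ck n f -> continuous f.
Proof. by case: n => [|n] []. Qed.

Lemma iter_torus n j f : torus_fun f -> torus_fun (iter n (fun h x => 'D_(dx R j) h x) f).
Proof. by move=> tf; elim: n => [|n IH] //=; exact: derive_torus. Qed.

(** Each derivative exchanges the coefficients at [k] and [- k]; the sum of their squares is simply
    multiplied by [kc^2]. *)
Lemma fh_iter n j f k : Ck n f -> torus_fun f ->
  let d := iter n (fun h x => 'D_(dx R j) h x) f in
  continuous d /\ fh d k ^+ 2 + fh d (- k) ^+ 2 = kc R j k ^+ (n + n) * (fh f k ^+ 2 + fh f (- k) ^+ 2).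
Proof.
elim: n f => [|n IH] f Cf tf d; rewrite {}/d; first by split; [exact: Ck_cont Cf|rewrite expr0 mul1r].
have [cf Cd df] := Ck_derive (dx R j) Cf.
have cd : continuous (fun x => 'D_(dx R j) f x) := Ck_cont Cd.
have td : torus_fun (fun x => 'D_(dx R j) f x) by exact: derive_torus.
have [c1 E1] := IH _ Cd td; rewrite iterSr; split; first exact: c1.
rewrite [LHS]E1 !(fh_derive _ cf cd tf df) kcN !opprK addSn addnS.
by rewrite [kc R j k ^+ (n + n).+2]exprS [kc R j k ^+ (n + n).+1]exprS; ring.
Qed.

Definition hz k : R := hw R (k, 0).

Lemma hzE k : hz k = `|k.1%:~R| + `|k.2%:~R|.
Proof. by rewrite /hz /hw /= !intr_norm. Qed.

Lemma hzN k : hz (- k) = hz k.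
Proof. by rewrite !hzE /= !mulrNz !normrN. Qed.

(** Convexity of the sixth power with [32 = 2 ^ 5], obtained as a square followed by a cube. *)
Lemma hz6_le k : hz k ^+ 6 <= 32 * (kc R 0 k ^+ 6 + kc R 1 k ^+ 6).
Proof.
rewrite hzE /kc /=; set u := k.1%:~R; set v := k.2%:~R.
have e6 (z : R) : z ^+ 6 = `|z| ^+ 6.
  by rewrite -normrX ger0_norm // (exprM z 2 3) exprn_ge0 // sqr_ge0.
rewrite (e6 u) (e6 v); have u0 := normr_ge0 u; have v0 := normr_ge0 v.
move: `|u| `|v| u0 v0 => {e6} {}u {}v u0 v0.
have H2 (z w : R) : (z + w) ^+ 2 <= 2 * (z ^+ 2 + w ^+ 2) by have := sqr_ge0 (z - w); nra.
have H3 (z w : R) : 0 <= z -> 0 <= w -> (z + w) ^+ 3 <= 4 * (z ^+ 3 + w ^+ 3).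
  move=> z0 w0; have := mulr_ge0 (addr_ge0 z0 w0) (sqr_ge0 (z - w)).
  by nra.
rewrite !(exprM _ 2 3); apply: (@le_trans _ _ ((2 * (u ^+ 2 + v ^+ 2)) ^+ 3)).
  by apply: expr_le; rewrite ?sqr_ge0.
rewrite exprMn; have := H3 _ _ (sqr_ge0 u) (sqr_ge0 v).
lra.
Qed.

(* Bessel's inequality for the two pure third derivatives. *)
Lemma decay f (G : R) : Ck 3 f -> torus_fun f ->
  (forall x, `|partials 3 0 f x| <= G) -> (forall x, `|partials 0 3 f x| <= G) ->
  bnd (fun k => hz k ^+ 6 * fh f k ^+ 2) (128 * G ^+ 2).
Proof.
move=> Cf tf b0 b1.
have H j : (forall x, `|iter 3 (fun h x => 'D_(dx R j) h x) f x| <= G) ->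
    bnd (fun k => kc R j k ^+ 6 * fh f k ^+ 2) (G ^+ 2 + G ^+ 2).
  move=> bj; have cd := (fh_iter j 0 Cf tf).1.
  have bs := bessel cd bj.
  have bs' := bnd_inj (@oppr_inj _) bs.
  apply: bnd_le (bndD bs bs') => k /=; rewrite (fh_iter j k Cf tf).2.
  have e6 : 0 <= kc R j k ^+ 6 by rewrite (exprM _ 2 3) exprn_ge0 // sqr_ge0.
  by rewrite ler_wpM2l // lerDl sqr_ge0.
have := bndZ (ler0n R 32) (bndD (H 0 b0) (H 1 b1)).
have -> : 32%:R * (G ^+ 2 + G ^+ 2 + (G ^+ 2 + G ^+ 2)) = 128 * G ^+ 2 by ring.
apply: bnd_le => k; rewrite -mulrDl [leRHS]mulrA; apply: ler_wpM2r; first exact: sqr_ge0.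
exact: hz6_le.
Qed.

Lemma hz_ge1 k : k != 0 -> 1 <= hz k.
Proof. by move=> k0; apply: hw_ge1; rewrite hw_eq0. Qed.

Lemma hz_ge0 k : 0 <= hz k. Proof. exact: hw_ge0. Qed.

Lemma hz0 : hz 0 = 0. Proof. by rewrite hzE /= normr0 addr0. Qed.

Lemma bnd_hz : exists2 C : R, 0 <= C & bnd (fun k => (hz k ^+ 6)^-1) C.
Proof.
have [C C0 HC] := @tau2_lb R; exists (C * (16 * 16)); first by rewrite !mulr_ge0.
have b1 : bnd (fun n : int => tau R `|n|%N) 16.
  by rewrite (_ : 16 = 8 + 8); [apply: bnd_int (@bnd_tau R); exact: tau_ge0|ring].
have t0 (n : int) : 0 <= tau R `|n|%N by exact: tau_ge0.
apply: bnd_le (bndZ C0 (bnd_prod t0 t0 b1 b1)) => k.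
have [->|k0] := eqVneq k 0.
  by rewrite hz0 expr0n invr0 !mulr_ge0.
have h1 := hz_ge1 k0; apply: le_trans (HC (k, 0) h1); rewrite -/(hz k).
have r1 := root4_ge1 h1; have r0 : 0 < root4 (hz k) by lra.
rewrite lef_pV2 ?posrE ?exprn_gt0 //; last by lra.
rewrite -{2}(root4K (hz_ge0 k)) -exprM; exact: ler_weXn2l.
Qed.

(** [|a| <= hz^(-6) + hz^6 a^2], and [hz^(-6)] is summable over the planar lattice. *)
Lemma l1_of_decay a (B : R) : a 0 = 0 -> bnd (fun k => hz k ^+ 6 * a k ^+ 2) B ->
  exists B' : R, bnd (fun k => `|a k|) B'.
Proof.
move=> a0 aB; have [C C0 HC] := bnd_hz; exists (1 * (C + B)).
apply: bnd_le (bndZ ler01 (bndD HC aB)) => k; rewrite mul1r.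
have [->|k0] := eqVneq k 0; first by rewrite a0 normr0 hz0 expr0n invr0 mul0r addr0.
have h1 := hz_ge1 k0; have h6 : 0 < hz k ^+ 6 by rewrite exprn_gt0 //; lra.
rewrite -[a k ^+ 2]real_normK ?num_real //; have := normr_ge0 (a k); set z := `|a k| => z0.
have i0 : 0 < (hz k ^+ 6)^-1 by rewrite invr_gt0.
have : hz k ^+ 6 * (hz k ^+ 6)^-1 = 1 by rewrite divff // gt_eqF.
move: i0 h6; set u := hz k ^+ 6; set v := u^-1 => v0 u0 uv.
have : 0 <= u * (z - v) ^+ 2 by rewrite mulr_ge0 ?sqr_ge0 // ltW.
have -> : u * (z - v) ^+ 2 = u * z ^+ 2 - 2 * (u * v) * z + (u * v) * v by ring.
rewrite uv; lra.
Qed.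

(** Planar coefficients placed on the graph [k |-> (k, l k)] in space-time. Both kinds of forces
    live on such graphs: [l k = k.1] for translation, [l = 1] and [l = - 1] for oscillation. *)
Definition gr (l : Z2 -> int) a (k : Z3) : R := if k.2 == l k.1 then a k.1 else 0.

Lemma bnd_gr l a C : (forall k, 0 <= a k) -> bnd a C -> bnd (gr l a) C.
Proof.
move=> a0 aC s us; pose t := [seq k <- s | k.2 == l k.1].
rewrite (bigID (fun k : Z3 => k.2 == l k.1)) /= [X in _ + X]big1 ?addr0 => [|k]; last first.
  by rewrite /gr => /negPf ->.
rewrite -big_filter -/t (eq_big_seq (fun k : Z3 => a k.1)); last first.
  by move=> k; rewrite mem_filter /gr => /andP[->].
rewrite -(big_map (fun k : Z3 => k.1) predT a); apply: aC.
rewrite map_inj_in_uniq ?filter_uniq // => -[p u] [q v].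
by rewrite !mem_filter /= => /andP[/eqP -> _] /andP[/eqP -> _] ->.
Qed.

Lemma normr_gr l a (k : Z3) : `|gr l a k| = gr l (fun p => `|a p|) k.
Proof. by rewrite /gr; case: ifP => // _; rewrite normr0. Qed.

Lemma ev_gr Om n l a z : (forall k, k \in box2 n -> (`|l k| <= n)%N) ->
  ev Om n (gr l a) z = \sum_(k <- box2 n) a k * cas Om (k, l k) z.
Proof.
move=> ln; rewrite /ev /box3 big_allpairs_dep; apply: eq_big_seq => k kn /=.
rewrite (bigD1_seq (l k)) ?mem_range ?ln // ?range_uniq //= {1}/gr /= eqxx.
by rewrite big1 ?addr0 // => u uk; rewrite /gr /= (negPf uk) mul0r.
Qed.

Definition psum a n x : R := \sum_(k <- box2 n) a k * c2 k x.

Lemma fh_sum s a q : uniq s -> fh (fun x => \sum_(k <- s) a k * c2 k x) q =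
  if q \in s then a q else 0.
Proof.
move=> us; rewrite /fh.
rewrite (_ : (fun x => _) = fun x => \sum_(k <- s) a k * (c2 k x * c2 q x)); last first.
  by apply/funext => x; rewrite mulr_suml; apply: eq_bigr => k _; rewrite mulrA.
have cc k : continuous (fun x => c2 k x * c2 q x) by exact/cont_fc/c2_continuous.
rewrite int_sum => [|k]; last by apply: continuousM_ => //; exact: cst_continuous.
have H k : I (fun x => a k * (c2 k x * c2 q x)) = a k * ((k == q)%:R * A).
  by rewrite (intZ _ (cc k)) c2_orth.
case: ifP => qs.
  rewrite (bigD1_seq q) //= big1 => [|k kq]; rewrite H ?eqxx ?(negPf kq) ?mul0r ?mulr0 //.
  by rewrite mul1r addr0 mulrCA mulVf ?mulr1 // gt_eqF // area_gt0.
rewrite big_seq big1 ?mulr0 // => k ks; rewrite H (_ : k == q = false) ?mul0r ?mulr0 //.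
by apply: contraFF qs => /eqP <-.
Qed.

Lemma psum_continuous a n : continuous (psum a n).
Proof.
by apply: continuous_sum => k; apply: continuousM_; [exact: cst_continuous|exact: c2_continuous].
Qed.

Lemma fh_ulim a f k : continuous f -> ulim (psum a) f -> fh f k = a k.
Proof.
move=> cf uf; apply/eqP; rewrite -subr_eq0 -normr_le0.
apply/ler_addgt0Pr => e e0; rewrite add0r.
have e2 : 0 < e / 2 by apply: divr_gt0.
have [n0 Hn] := uf _ e2; have [N HN] := seq_box [:: (k, 0) : Z3].
pose n := maxn n0 N; have kn : k \in box2 n.
  have /HN : (k, 0) \in [:: (k, 0) : Z3] by rewrite inE.
  rewrite mem_box3 mem_box2 => /and3P[h1 h2 _]; apply/andP; split.
    by apply: leq_trans h1 _; exact: leq_maxr.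
  by apply: leq_trans h2 _; exact: leq_maxr.
have ak : fh (psum a n) k = a k by rewrite fh_sum ?kn // box2_uniq.
have cp := @psum_continuous a n.
rewrite -ak -fhB // /fh normrM ger0_norm ?invr_ge0 ?(ltW (area_gt0 R)) //.
rewrite mulrC ler_pdivrMr ?area_gt0 //; apply: int_norm.
  by apply: cont_fc => x; apply: cvgB; [exact: cf|exact: cp].
move=> x; rewrite normrM (_ : e = e / 2 * 2); last by field.
by apply: ler_pM => //; [rewrite distrC; apply: Hn; exact: leq_maxl|exact: c2_le].
Qed.

(** The series converges uniformly to a continuous [S0] with the coefficients of [f], and
    completeness identifies the two. The convergence is imported from space-time sums on the graph
    [l = 0]. *)
Lemma fourier_inversion f (B : R) : continuous f -> torus_fun f ->
  bnd (fun k => `|fh f k|) B -> ulim (psum (fh f)) f.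
Proof.
move=> cf tf fB; pose a := gr (fun=> 0) (fh f).
have aB : bnd (fun k : Z3 => `|a k|) B.
  by apply: bnd_le (bnd_gr (fun=> 0) _ fB) => // k; rewrite normr_gr.
have psE n x t : ev 0 n a (x, t) = psum (fh f) n x.
  rewrite ev_gr //; apply: eq_bigr => k _; congr (_ * _).
  by rewrite c2_cas /cas /phase /= !mul0r.
have [S HS] := l1c_ulim 0 (l1c_trunc (S := id) (@leqnn) aB) (fun n => @supp_trunc _ n a).
pose S0 x := S (x, 0).
have uS : ulim (psum (fh f)) S0.
  apply: ulim_ext (ulim_comp (fun x : plane R => (x, 0 : R)) HS) => n x /=.
  by rewrite ev_trunc psE.
have cS : continuous S0 by exact: ulim_continuous uS (fun n => @psum_continuous _ n).
have tS : torus_fun S0.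
  move=> j; apply: ulim_periodic uS _ => n x; apply: eq_bigr => k _.
  by rewrite c2_torus.
suff d0 : forall x, f x - S0 x = 0.
  have E : S0 = f by apply/funext => x; have := d0 x; lra.
  by rewrite -{2}E.
apply: fourier_complete.
- by move=> x; apply: cvgB; [exact: cf|exact: cS].
- by move=> j x; rewrite tf tS.
by move=> k; rewrite fhB // (fh_ulim k cS uS) subrr.
Qed.

End Decay.

(** * The coefficients of the forces *)

Section Forces.
Variable R : realType.
Implicit Types (f g h : plane R -> R) (x y : plane R) (a b : Z2 -> R).
Local Notation K1 k := ((k : Z3).1.1%:~R : R).
Local Notation K2 k := ((k : Z3).1.2%:~R : R).

Lemma torus_bounded f : continuous f -> torus_fun f -> exists M : R, forall x, `|f x| <= M.
Proof.
move=> cf tf; have [M HM] := cont_compact_bounded (@compact_torus R) cf.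
exists M => x; have [m1 [m2 [/andP[a1 a2] /andP[b1 b2]]]] := torus_repr x.
rewrite -(torus_period x m1 m2 tf); apply: HM.
by split; rewrite /= in_itv /=; apply/andP; split => //; exact: ltW.
Qed.

Lemma row_torus (F : plane R -> 'rV[R]_2) i : torus_fun F -> torus_fun (fun x => F x 0 i).
Proof. by move=> tF j x; rewrite tF. Qed.

(** Absolute summability is drawn from three derivatives; this is the smoothness [m = 3] of the
    theorem. *)
Lemma field_coefs (F : plane R -> 'rV[R]_2) i (f := fun x => F x 0 i) : torus_field 3 F ->
  [/\ fh f 0 = 0, exists B : R, bnd (fun k => `|fh f k|) B & ulim (psum (fh f)) f].
Proof.
move=> [tF CF mF]; have tf : torus_fun f by exact: row_torus.
have Cf : Ck 3 f by exact: CF.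
have f0 : fh f 0 = 0.
  rewrite /fh (_ : (fun x => f x * c2 0 x) = f) ?mF ?mulr0 //.
  by apply/funext => x; rewrite c20 mulr1.
have bd j : exists M : R, forall x, `|iter 3 (fun h x => 'D_(dx R j) h x) f x| <= M.
  by apply: torus_bounded; [exact: (fh_iter j 0 Cf tf).1|exact: iter_torus].
have [M0 H0] := bd 0; have [M1 H1] := bd 1; pose M := Num.max M0 M1.
have le0 : M0 <= M by rewrite le_max lexx.
have le1 : M1 <= M by rewrite le_max lexx orbT.
have dec := decay Cf tf (fun x => le_trans (H0 x) le0) (fun x => le_trans (H1 x) le1).
have [B HB] := l1_of_decay f0 dec.
split => //; first by exists B.
exact: fourier_inversion (Ck_cont Cf) tf HB.
Qed.

Lemma is_derive_inj (V : normedModType R) (f : V -> R) (z e : V) (c d : R) :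
  is_derive z e f c -> is_derive z e f d -> c = d.
Proof. by move=> fc fd; rewrite -(@derive_val _ _ _ _ _ _ _ fc) (@derive_val _ _ _ _ _ _ _ fd). Qed.

Lemma field_derive (F : plane R -> 'rV[R]_2) i j n : torus_fun F ->
  (forall i, Ck n.+1 (fun x => F x 0 i)) ->
  [/\ continuous (fun x => F x 0 i), continuous (fun x => 'D_(dx R j) (fun y => F y 0 i) x) &
   forall x, is_derive x (dx R j) (fun y => F y 0 i) ('D_(dx R j) (fun y => F y 0 i) x)].
Proof.
move=> tF CF; have [c1 c2' c3] := Ck_derive (dx R j) (CF i).
by split => //; exact: Ck_cont c2'.
Qed.

Lemma fh_rot (F : plane R -> 'rV[R]_2) n k : torus_fun F -> (forall i, Ck n.+1 (fun x => F x 0 i)) ->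
  fh (rot2 F) k = - k.1%:~R * fh (fun x => F x 0 1) (- k) + k.2%:~R * fh (fun x => F x 0 0) (- k).
Proof.
move=> tF CF; have [c1 d1 e1] := field_derive 1 0 tF CF; have [c0 d0 e0] := field_derive 0 1 tF CF.
rewrite /rot2 fhB // (fh_derive _ c1 d1 (row_torus 1 tF) e1) (fh_derive _ c0 d0 (row_torus 0 tF) e0).
by rewrite /kc /=; ring.
Qed.

Lemma Ck_normP f G : (Ck_norm 3 f <= G%:E)%E ->
  Ck 3 f /\ forall (a b : nat) x, (a + b <= 3)%N -> `|partials a b f x| <= G.
Proof.
rewrite /Ck_norm; case: asboolP => [Cf H|_]; last by rewrite leye_eq.
split => // a b x ab; rewrite -lee_fin; apply: le_trans H; apply: ereal_sup_ubound.
by exists a, b, x.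
Qed.

(* [Fc1] and [Fc2] are the coefficients of [F], and [d_t w0 = rot F]. *)
Definition forced_coefs (Om g0 : R) (F : spacetime R -> 'rV[R]_2) : Prop :=
  exists (FM : R) (w0 Fc1 Fc2 : Z3 -> R),
  [/\ bnd (fun k => `|Fc1 k|) FM /\ bnd (fun k => `|Fc2 k|) FM,
      (forall k, k.1 = 0 -> Fc1 k = 0) /\ (forall k, k.1 = 0 -> Fc2 k = 0),
      ulim (fun n => ev Om n Fc1) (fun z => F z 0 0) /\
      ulim (fun n => ev Om n Fc2) (fun z => F z 0 1),
      (forall k, hw R k = 0 -> w0 k = 0) /\
      (forall k, - Om * k.2%:~R * w0 (- k) = K2 k * Fc1 (- k) - K1 k * Fc2 (- k)) &
      bnd (fun k => (hw R k * (rw R k ^+ 2 * w0 k)) ^+ 2) (g0 ^+ 2)].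

(** [w0] is [rot F] divided by its time frequency [Om l], which requires that the force has no modes
    constant in time. *)
Lemma forced_coefsI (Om g0 : R) (F : spacetime R -> 'rV[R]_2) (B1 B2 : R) (Fc1 Fc2 : Z3 -> R) : 0 < Om ->
  bnd (fun k => `|Fc1 k|) B1 -> bnd (fun k => `|Fc2 k|) B2 ->
  (forall k, k.1 = 0 -> Fc1 k = 0) -> (forall k, k.1 = 0 -> Fc2 k = 0) ->
  (forall k, k.2 = 0 -> Fc1 k = 0) -> (forall k, k.2 = 0 -> Fc2 k = 0) ->
  ulim (fun n => ev Om n Fc1) (fun z => F z 0 0) ->
  ulim (fun n => ev Om n Fc2) (fun z => F z 0 1) ->
  bnd (fun k => (hw R k * (rw R k ^+ 2 * ((K1 k * Fc2 k - K2 k * Fc1 k) / (Om * k.2%:~R)))) ^+ 2)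
    (g0 ^+ 2) -> forced_coefs Om g0 F.
Proof.
move=> Om0 b1 b2 z1 z2 l1 l2 u1 u2 bw.
exists (Num.max B1 B2), (fun k => (K1 k * Fc2 k - K2 k * Fc1 k) / (Om * k.2%:~R)), Fc1, Fc2.
split => //.
- by split; [apply: bndW b1|apply: bndW b2]; rewrite le_max lexx ?orbT.
split => [k /hw0_k[-> ->]|k]; first by rewrite !mul0r subrr mul0r.
have [l0|l0] := eqVneq k.2 0.
  by rewrite l0 mulr0 mul0r l1 ?l2 ?mulr0 ?subrr //= l0 oppr0.
have -> : (- k).2%:~R = - k.2%:~R :> R by exact: mulrNz.
rewrite k1N k2N; field.
by rewrite intr_eq0 l0 gt_eqF.
Qed.

Lemma sum_box2N n (F : Z2 -> R) : \sum_(k <- box2 n) F (- k) = \sum_(k <- box2 n) F k.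
Proof.
rewrite -(big_map (fun k : Z2 => - k) predT F); apply: perm_big; apply: uniq_perm.
- by rewrite map_inj_uniq ?box2_uniq //; exact: oppr_inj.
- exact: box2_uniq.
move=> k; apply/mapP/idP => [[q qn ->]|kn].
  by move: qn; rewrite !mem_box2 /= !abszN.
by exists (- k); rewrite ?opprK //; move: kn; rewrite !mem_box2 /= !abszN.
Qed.

Lemma gr_ge0 l a (k : Z3) : (forall k, 0 <= a k) -> 0 <= gr l a k.
Proof. by move=> a0; rewrite /gr; case: ifP. Qed.

(** * Oscillating forces *)

Section Oscillating.
Variables (Om : R) (F : plane R -> 'rV[R]_2).
Hypothesis tF : torus_field 3 F.

(** From [2 sin s cas_k = cas_(-k,1) - cas_(-k,-1)], where the second index is the frequency in [s];
    this explains the reflected coefficient. *)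
Definition osc i (k : Z3) : R :=
  2^-1 * gr (fun=> 1) (fun p => fh (fun x => F x 0 i) (- p)) k +
  - 2^-1 * gr (fun=> - 1) (fun p => fh (fun x => F x 0 i) (- p)) k.

Lemma osc_bnd i : exists B : R, bnd (fun k => `|osc i k|) B.
Proof.
have [_ [B HB] _] := field_coefs i tF.
have HB' := bnd_inj (@oppr_inj _) HB.
have nn (k : Z2) : 0 <= `|fh (fun x => F x 0 i) (- k)| by [].
have h (l : Z2 -> int) := bndZ (ler0n R 1) (bnd_gr l nn HB').
exists (1 * B + 1 * B); apply: bnd_le (bndD (h (fun=> 1)) (h (fun=> - 1))) => k.
rewrite /osc !mul1r; apply: le_trans (ler_normD _ _) _; rewrite !normrM !normr_gr normrN.
by rewrite ger0_norm ?invr_ge0 //; apply: lerD; rewrite ler_piMl ?invf_le1 ?ler1n //;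
  rewrite /gr; case: ifP.
Qed.

Lemma osc_mean i k : k.1 = 0 -> osc i k = 0.
Proof.
have [f0 _ _] := field_coefs i tF.
by move=> k0; rewrite /osc /gr k0 oppr0 f0; do 2 case: ifP; rewrite !mulr0 addr0.
Qed.

Lemma osc_lim i : ulim (fun n => ev Om n (osc i)) (fun z => force_oscillating F Om z 0 i).
Proof.
have [_ _ ul] := field_coefs i tF => e e0; have [n0 Hn] := ul e e0.
exists n0.+1 => n nn z; have n1 : (0 < n)%N by apply: leq_trans nn.
have -> : ev Om n (osc i) z = sin (Om * z.2) * psum (fh (fun x => F x 0 i)) n z.1.
  rewrite /osc evD !evZ !ev_gr; try by move=> k _; rewrite /= ?abszN.
  rewrite /psum -[X in _ = _ * X]sum_box2N !mulr_sumr -big_split /=; apply: eq_bigr => k _.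
  have ph (l : int) : phase Om (k, l) z = dot k z.1 + Om * l%:~R * z.2 by [].
  rewrite /cas /c2 !ph dotN mulrNz mulr1 mulrN1 !mulNr !(cosD, sinD, cosN, sinN).
  by field.
rewrite /force_oscillating mxE -mulrBr normrM -[e]mul1r; apply: ler_pM => //.
  by rewrite ler_norml sin_geN1 sin_le1.
by apply: Hn; exact: ltnW.
Qed.

(** On both graphs [rw = hz + 1 <= 2 * hz], and [w0] carries a factor [1/2], so the square is at
    most [4 * hz^6 * (rot F)^2 / Om^2] in coefficients; [32 ^ 2 = 2 * 4 * 128]. *)
Lemma osc_coefs G : 0 < Om -> (Ck_norm 3 (rot2 F) <= G%:E)%E ->
  forced_coefs Om (32 * (`|G| / Om)) (force_oscillating F Om).
Proof.
move=> Om0 /Ck_normP[Cr rG]; have [tf Cf _] := tF.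
have tr : torus_fun (rot2 F).
  move=> j x; rewrite /rot2; congr (_ - _).
    exact: (derive_torus 0 (row_torus 1 tf)).
  exact: (derive_torus 1 (row_torus 0 tf)).
have dec := decay Cr tr (fun x => rG 3 0 x isT) (fun x => rG 0 3 x isT).
have [B1 b1] := osc_bnd 0; have [B2 b2] := osc_bnd 1.
apply: (forced_coefsI Om0 b1 b2 (osc_mean 0) (osc_mean 1) _ _ (osc_lim 0) (osc_lim 1)).
- by move=> k k0; rewrite /osc /gr k0 !mulr0 addr0.
- by move=> k k0; rewrite /osc /gr k0 !mulr0 addr0.
pose c : R := 4 / Om ^+ 2; have c0 : 0 <= c by rewrite divr_ge0 // sqr_ge0.
have decc := bndZ c0 dec.
have nn k : 0 <= c * (hz R k ^+ 6 * fh (rot2 F) k ^+ 2).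
  exact: mulr_ge0 c0 (mulr_ge0 (exprn_ge0 6 (hz_ge0 R k)) (sqr_ge0 _)).
have -> : (32 * (`|G| / Om)) ^+ 2 = c * (128 * G ^+ 2) + c * (128 * G ^+ 2).
  by rewrite !exprMn real_normK ?num_real // exprVn /c; field; rewrite gt_eqF.
apply: bnd_le (bndD (bnd_gr (fun=> 1) nn decc) (bnd_gr (fun=> - 1) nn decc)) => k.
rewrite /osc; case: k => k l.
have [k0|k0] := eqVneq k 0.
  rewrite k0 /hw /= normr0 addr0 !mul0r expr0n.
  by apply: addr_ge0; apply: gr_ge0.
have h1 := hz_ge1 R k0.
have key (sg : R) (l' : int) : sg ^+ 2 = 1 -> l'%:~R ^+ 2 = 1 :> R -> `|l'%:~R| = 1 :> R ->
  (hw R (k, l') * (rw R (k, l') ^+ 2 * ((k.1%:~R * (sg * 2^-1 * fh (fun x => F x 0 1) (- k))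
    - k.2%:~R * (sg * 2^-1 * fh (fun x => F x 0 0) (- k))) / (Om * l'%:~R)))) ^+ 2 <=
  c * (hz R k ^+ 6 * fh (rot2 F) k ^+ 2).
  move=> s1 l1 l1'; set r := fh (rot2 F) k.
  have rE : k.1%:~R * (sg * 2^-1 * fh (fun x => F x 0 1) (- k))
    - k.2%:~R * (sg * 2^-1 * fh (fun x => F x 0 0) (- k)) = - (sg * 2^-1 * r).
    by rewrite /r (fh_rot _ tf Cf); ring.
  rewrite rE; have -> : hw R (k, l') = hz R k by [].
  have rwE : rw R (k, l') = hz R k + 1 by rewrite /rw /= intr_norm l1'.
  have l0 : l'%:~R != 0 :> R by rewrite -normr_eq0 l1' oner_eq0.
  have o0 : Om != 0 by rewrite gt_eqF.
  rewrite rwE (_ : _ ^+ 2 = hz R k ^+ 2 * ((hz R k + 1) ^+ 4 * (4^-1 * r ^+ 2 / Om ^+ 2)) *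
    (sg ^+ 2 / l'%:~R ^+ 2)); last by field; rewrite o0 l0.
  rewrite s1 l1 divr1 mulr1.
  have le : (hz R k + 1) ^+ 4 <= (2 * hz R k) ^+ 4 by apply: expr_le; lra.
  have -> : c * (hz R k ^+ 6 * r ^+ 2) = hz R k ^+ 2 * ((2 * hz R k) ^+ 4 * (4^-1 * r ^+ 2 / Om ^+ 2)).
    by rewrite /c; field.
  apply: ler_wpM2l; first exact: sqr_ge0.
  apply: ler_wpM2r => //.
  by rewrite divr_ge0 ?sqr_ge0 // mulr_ge0 ?sqr_ge0 // invr_ge0.
have [->|l1] := eqVneq l 1.
  rewrite /gr /= !mulr0 !addr0.
  by have := key 1 1; rewrite !mul1r; apply; rewrite ?expr1n ?normr1.
have [->|l2] := eqVneq l (- 1).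
  rewrite /gr /= !mulr0 !add0r.
  by have := key (- 1) (- 1); rewrite !mulN1r; apply; rewrite ?mulrNz ?sqrrN ?expr1n ?normrN ?normr1.
by rewrite /gr /= (negPf l1) (negPf l2) !(mulr0, addr0, oppr0, mul0r) expr0n.
Qed.

End Oscillating.

End Forces.

(** * Averaging over translations *)

Section Averaging.
Variable R : realType.

Lemma is_derive_comp_affine (f : R -> R) (c d t : R) (m : R) :
  is_derive (c * t + d) 1 f m -> is_derive t 1 (fun s => f (c * s + d)) (c * m).
Proof.
move=> fm.
have h : is_derive t (1 : R) (fun s : R => c * s + d) c.
  have := is_deriveD (is_deriveZ c (is_derive_id t 1)) (is_derive_cst d t (1 : R)).
  by rewrite addr0 [c *: 1]mulr1.
have H := @is_derive1_comp R f (fun s => c * s + d) t m c fm h.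
by rewrite mulrC.
Qed.

(* Mean value theorem for a primitive of the difference over a period. *)
Lemma average_cos (T : Type) (t : seq T) (a : T -> R) (n : T -> int) (B : R) :
  (forall k, n k = 0 -> a k = 0) ->
  (forall s : R, \sum_(k <- t) a k * (2 - 2 * cos ((n k)%:~R * s)) <= B) ->
  \sum_(k <- t) 2 * a k <= B.
Proof.
move=> a0 H; have p2 : 0 < 2 * pi :> R by rewrite mulr_gt0 // pi_gt0.
pose P s : R := \sum_(k <- t) a k * (2 * s - 2 * (sin ((n k)%:~R * s) / (n k)%:~R)).
pose dP s : R := \sum_(k <- t) a k * (2 - 2 * cos ((n k)%:~R * s)).
have dPP (s : R) : is_derive s 1 P (dP s).
  apply: is_derive_sum_ => k.
  have [n0|n0] := eqVneq (n k) 0.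
    rewrite a0 // mul0r (_ : (fun _ => _) = cst 0); first exact: is_derive_cst.
    by apply/funext => y; rewrite mul0r.
  have d1 : is_derive s 1 (fun s : R => sin ((n k)%:~R * s)) ((n k)%:~R * cos ((n k)%:~R * s)).
    have := @is_derive_comp_affine sin (n k)%:~R 0 s (cos ((n k)%:~R * s)).
    rewrite addr0 => /(_ (is_derive_sin _)).
    by rewrite (_ : (fun s0 : R => sin ((n k)%:~R * s0 + 0)) = fun s0 => sin ((n k)%:~R * s0)) //;
      apply/funext => y; rewrite addr0.
  have := is_deriveZ (a k) (is_deriveD (is_deriveZ 2 (is_derive_id s (1 : R))) (is_deriveZ (- 2 / (n k)%:~R) d1)).
  rewrite (_ : a k \*: _ = fun s0 => a k * (2 * s0 - 2 * (sin ((n k)%:~R * s0) / (n k)%:~R))); last first.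
    by apply/funext => y; rewrite -[LHS]/(a k * (2 * y + - 2 / (n k)%:~R * sin ((n k)%:~R * y))); ring.
  rewrite (_ : a k *: _ = a k * (2 - 2 * cos ((n k)%:~R * s))) //.
  rewrite -[LHS]/(a k * (2 * 1 + - 2 / (n k)%:~R * ((n k)%:~R * cos ((n k)%:~R * s)))).
  by field; rewrite intr_eq0.
have [c _ E] := MVT p2 (fun s _ => dPP s) (derivable_within_continuous (fun s _ => @ex_derive _ _ _ _ _ _ _ (dPP s))).
have P0 : P 0 = 0 by rewrite /P big1 // => k _; rewrite !mulr0 sin0 mul0r mulr0 subr0 mulr0.
have P2 : P (2 * pi) = (\sum_(k <- t) 2 * a k) * (2 * pi).
  rewrite mulr_suml; apply: eq_bigr => k _.
  have -> : sin ((n k)%:~R * (2 * pi)) = 0 :> R.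
    by rewrite -[X in sin X]add0r (trig_periodz _ _ (@sinD2pi R)) sin0.
  by rewrite mul0r mulr0 subr0; ring.
move: E; rewrite P0 P2 !subr0 => E.
have : (\sum_(k <- t) 2 * a k) * (2 * pi) <= B * (2 * pi).
  by rewrite E ler_wpM2r ?(ltW p2) //; exact: H.
by rewrite ler_pM2r.
Qed.

End Averaging.

(** * Translated forces *)

Section Translated.
Variable R : realType.
Implicit Types (f h : plane R -> R) (x y : plane R).
Local Notation leb := (@lebesgue_measure R).
Local Notation leb2 := (leb \x leb)%E.
Local Notation I f := (\int[leb2]_(x in @torus R) f x).

Lemma fh_fourier f (k : Z2) : continuous f -> fourier_coef f k = 0 -> fh f k = 0.
Proof.
move=> cf /eqP; rewrite /fourier_coef eq_complex /= oppr_eq0 => /andP[/eqP h1 /eqP h2].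
have cc : continuous (fun x => f x * cos (dot k x)).
  apply: continuousM_ => // x; apply: (@continuous_comp _ _ _ (dot k) cos); last exact: continuous_cos.
  exact: dot_continuous.
have cs : continuous (fun x => f x * sin (dot k x)).
  apply: continuousM_ => // x; apply: (@continuous_comp _ _ _ (dot k) sin); last exact: continuous_sin.
  exact: dot_continuous.
rewrite /fh (_ : (fun x => f x * c2 k x) = fun x => f x * cos (dot k x) + f x * sin (dot k x)).
  by rewrite intD // mulrDr h1 h2 addr0.
by apply/funext => x; rewrite /c2 mulrDr.
Qed.

Definition tr (s : R) f x : R := f (x.1 + s, x.2).

Lemma trE s f : tr s f = fun x => f (x + (s, 0)).
Proof. by apply/funext => -[a b]; rewrite /tr /=; congr (f (_, _)); rewrite addr0. Qed.

Lemma tr_continuous s f : continuous f -> continuous (tr s f).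
Proof.
move=> cf; rewrite trE => x; apply: (@continuous_comp _ _ _ (fun x => x + (s, 0)) f); last exact: cf.
by apply: cvgD; [exact: cvg_id|exact: cvg_cst].
Qed.

Lemma tr_torus s f : torus_fun f -> torus_fun (tr s f).
Proof. by move=> tf j x; rewrite trE addrAC tf. Qed.

Lemma tr_derive s f df e : (forall x, is_derive x e f (df x)) ->
  forall x, is_derive x e (tr s f) (tr s df x).
Proof.
move=> H x; rewrite [tr s df]trE; apply: is_derive_of_line; rewrite trE.
have := @is_derive_line R _ f (x + (s, 0)) e 0 (df (x + (s, 0))).
rewrite scale0r addr0 => /(_ (H _)).
by rewrite (_ : (fun t : R => f (x + (s, 0) + t *: e)) = (fun t : R => f (x + t *: e + (s, 0)))) //;
  apply/funext => t; rewrite addrAC.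
Qed.

(** Read off from the uniformly convergent series, each basis function being shifted by the addition
    formula; no change of variables in the integral is made. *)
Lemma fh_tr s f (k : Z2) : continuous f -> ulim (psum (fh f)) f ->
  fh (tr s f) k = cos (k.1%:~R * s) * fh f k - sin (k.1%:~R * s) * fh f (- k).
Proof.
move=> cf uf.
rewrite (@fh_ulim R (fun k : Z2 => cos (k.1%:~R * s) * fh f k - sin (k.1%:~R * s) * fh f (- k))) //.
  exact: tr_continuous.
apply: ulim_ext (ulim_comp (fun x : plane R => (x.1 + s, x.2)) uf) => n x /=.
have sE (q : Z2) : c2 q (x.1 + s, x.2) = cos (q.1%:~R * s) * c2 q x + sin (q.1%:~R * s) * c2 (- q) x.
  have -> : (x.1 + s, x.2) = x + (s, 0) by case: (x) => u v; congr (_, _); rewrite /= addr0.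
  by rewrite c2_shift /dot /= mulr0 addr0.
rewrite /psum (eq_bigr (fun q : Z2 => cos (q.1%:~R * s) * fh f q * c2 q x +
  sin (q.1%:~R * s) * fh f q * c2 (- q) x)) => [|q _]; last by rewrite sE; ring.
rewrite big_split /= -[X in _ + X]sum_box2N -big_split /=; apply: eq_bigr => q _.
by rewrite mulrNz mulNr sinN opprK; ring.
Qed.

Section Data.
Variables (G : R) (F : plane R -> 'rV[R]_2) (g : plane R -> R -> R).
Hypothesis tF : torus_field 3 F.
Hypothesis F0 : forall (k2 : int) i, fourier_coef (fun x => F x 0 i) (0, k2) = 0.
Hypothesis tg : forall s, torus_fun (fun x => g x s).
Hypothesis dg : forall x (t : R), is_derive t 1 (g x) (rot2 F (x.1 + t, x.2)).
Hypothesis Cg : forall s, (Ck_norm 3 (fun x => g x s) <= G%:E)%E.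

Let r := fh (rot2 F).
Let f0 x := F x 0 0.
Let f1 x := F x 0 1.

Lemma cont_f i : continuous (fun x => F x 0 i).
Proof. by have [_ CF _] := tF; exact: Ck_cont (CF i). Qed.

Lemma r_formula k : r k = - k.1%:~R * fh f1 (- k) + k.2%:~R * fh f0 (- k).
Proof. by have [tf CF _] := tF; exact: fh_rot tf CF. Qed.

Lemma cont_rot : continuous (rot2 F).
Proof.
have [tf CF _] := tF; have [_ d1 _] := field_derive 1 0 tf CF; have [_ d0 _] := field_derive 0 1 tf CF.
by move=> x; apply: cvgB; [exact: d1|exact: d0].
Qed.

(** The components of [F] are C^3 and have convergent Fourier series; for [rot F], with one
    derivative less, inversion is not at hand. The translation is therefore applied to the
    components before taking the curl. *)
Lemma fh_tr_rot s k : fh (tr s (rot2 F)) k = cos (k.1%:~R * s) * r k - sin (k.1%:~R * s) * r (- k).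
Proof.
have [tf CF _] := tF; have [c1 d1 e1] := field_derive 1 0 tf CF; have [c0 d0 e0] := field_derive 0 1 tf CF.
have [_ _ u1] := field_coefs 1 tF; have [_ _ u0] := field_coefs 0 tF.
rewrite (_ : tr s (rot2 F) = fun x => tr s ('D_(dx R 0) f1) x - tr s ('D_(dx R 1) f0) x) //.
rewrite fhB; try exact: tr_continuous.
rewrite (fh_derive (f := tr s f1) (j := 0) k (tr_continuous c1) (tr_continuous d1)
  (tr_torus s (row_torus 1 tf)) (tr_derive s e1)).
rewrite (fh_derive (f := tr s f0) (j := 1) k (tr_continuous c0) (tr_continuous d0)
  (tr_torus s (row_torus 0 tf)) (tr_derive s e0)).
rewrite !fh_tr // !r_formula /kc /= !mulrNz !mulNr cosN sinN [- - k]opprK.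
by ring.
Qed.

(** [g x s] and [g (0, x.2) (x.1 + s)] have the same derivative in [s]; thus [g (0, x.2)] is the
    primitive [H]. *)
Lemma g_shift x s : g x s - g x 0 = g (0, x.2) (x.1 + s) - g (0, x.2) x.1.
Proof.
pose d (s : R) := g x s - g (0, x.2) (x.1 + s).
suff : d s = d 0 by rewrite /d addr0; lra.
apply: is_derive_0_is_cst => t.
have h : is_derive t 1 (fun s : R => g (0, x.2) (1 * s + x.1)) (1 * rot2 F (0 + (1 * t + x.1), x.2)).
  by apply: is_derive_comp_affine; exact: dg.
have := is_deriveB (dg x t) h.
rewrite mul1r add0r mul1r [t + _]addrC subrr.
rewrite (_ : (g x - _ : R -> R) = d) //.
apply/funext => u; rewrite -[LHS]/(g x u - g (0, x.2) (1 * u + x.1)) /d.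
by rewrite mul1r [u + _]addrC.
Qed.

(** [g] is determined by its equation only up to a function of [x], so nothing is known about its
    own derivative in [x.1]. That of a difference is known, because it is an increment of [H]. *)
Lemma g_derive x s : 'D_(dx R 0) (fun z => g z s) x - 'D_(dx R 0) (fun z => g z 0) x =
  tr s (rot2 F) x - rot2 F x.
Proof.
have D u : is_derive x (dx R 0) (fun z => g z u) ('D_(dx R 0) (fun z => g z u) x).
  by have [Cu _] := Ck_normP (Cg u); have [_ _] := Ck_derive (dx R 0) Cu; apply.
apply: is_derive_inj (is_deriveB (D s) (D 0)) _.
apply: is_derive_of_line.
have h u : is_derive (0 : R) 1 (fun t : R => g (0, x.2) (1 * t + (x.1 + u)))
    (1 * rot2 F (0 + (1 * 0 + (x.1 + u)), x.2)).
  by apply: is_derive_comp_affine; exact: dg.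
have := is_deriveB (h s) (h 0).
rewrite !mul1r !add0r addr0 -[(x.1, x.2)]surjective_pairing.
rewrite (_ : (_ - _ : R -> R) = fun t : R => g (x + t *: dx R 0) s - g (x + t *: dx R 0) 0) //.
apply/funext => t; rewrite g_shift /= [_ *: (1 : R)]mulr1 [_ *: (0 : R)]mulr0 !addr0.
rewrite -[LHS]/(g (0, x.2) (1 * t + (x.1 + s)) - g (0, x.2) (1 * t + x.1)).
by congr (g _ _ - g _ _); ring.
Qed.

Let gh s := fh (fun x => g x s).

Lemma shift_coef s k : - k.1%:~R * (gh s (- k) - gh 0 (- k)) =
  cos (k.1%:~R * s) * r k - sin (k.1%:~R * s) * r (- k) - r k.
Proof.
have C u := Ck_derive (dx R 0) (Ck_normP (Cg u)).1.
have cD u : continuous ('D_(dx R 0) (fun z => g z u)) by have [_ /Ck_cont] := C u.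
have E u : fh ('D_(dx R 0) (fun z => g z u)) k = - k.1%:~R * gh u (- k).
  by have [cu _ du] := C u; rewrite (fh_derive (j := 0) k cu (cD u) (tg u) du).
rewrite mulrBr -!E -fhB // -fh_tr_rot -fhB; [|apply: tr_continuous; exact: cont_rot|exact: cont_rot].
by congr fh; apply/funext => x; exact: g_derive.
Qed.

(** Modes with [k.1 = 0] get the value zero from division by zero; the force has no such modes. *)
Let av (k : Z2) : R := hz R k ^+ 6 * ((r k ^+ 2 + r (- k) ^+ 2) / k.1%:~R ^+ 2).

Lemma average_le s k : av k * (2 - 2 * cos (k.1%:~R * s)) <=
  hz R k ^+ 6 * ((gh s k - gh 0 k) ^+ 2 + (gh s (- k) - gh 0 (- k)) ^+ 2).
Proof.
have h6 : 0 <= hz R k ^+ 6 by rewrite exprn_ge0 // hz_ge0.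
rewrite /av -mulrA; apply: ler_wpM2l => //.
have [k0|k0] := eqVneq k.1 0.
  by rewrite k0 expr0n invr0 mulr0 mul0r addr_ge0 ?sqr_ge0.
have kp : 0 < k.1%:~R ^+ 2 :> R by rewrite exprn_even_gt0 // intr_eq0.
rewrite mulrAC ler_pdivrMr //.
have E1 := shift_coef s k; have := shift_coef s (- k).
rewrite /= !mulrNz !mulNr cosN sinN !opprK => E2.
have -> : ((gh s k - gh 0 k) ^+ 2 + (gh s (- k) - gh 0 (- k)) ^+ 2) * k.1%:~R ^+ 2 =
  (k.1%:~R * (gh s k - gh 0 k)) ^+ 2 + (- k.1%:~R * (gh s (- k) - gh 0 (- k))) ^+ 2 by ring.
rewrite E1 E2; have := cos2Dsin2 (k.1%:~R * s).
set C := cos _; set S := sin _ => CS.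
have -> : (C * r (- k) - - S * r k - r (- k)) ^+ 2 + (C * r k - S * r (- k) - r k) ^+ 2 =
  ((C ^+ 2 + S ^+ 2) + 1 - 2 * C) * (r k ^+ 2 + r (- k) ^+ 2) by ring.
by rewrite CS; rewrite le_eqVlt; apply/orP; left; apply/eqP; ring.
Qed.

(** [512 = 2 * (128 + 128)] comes from the decay of [g] at [s] and at [0]. Adding [k] and [- k]
    doubles it, and the mean value [2] of [2 - 2 cos] undoes the doubling. *)
Lemma average_bnd : bnd (fun k => hz R k ^+ 6 * (r (- k) / k.1%:~R) ^+ 2) (512 * G ^+ 2).
Proof.
move=> t ut.
have dec s : bnd (fun k => hz R k ^+ 6 * gh s k ^+ 2) (128 * G ^+ 2).
  have [Cs bs] := Ck_normP (Cg s).
  exact: decay Cs (tg s) (fun x => bs 3 0 x isT) (fun x => bs 0 3 x isT).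
have dd s : bnd (fun k => hz R k ^+ 6 * (gh s k - gh 0 k) ^+ 2) (512 * G ^+ 2).
  have -> : 512 * G ^+ 2 = 2 * (128 * G ^+ 2 + 128 * G ^+ 2) by ring.
  apply: bnd_le (bndZ (ler0n R 2) (bndD (dec s) (dec 0))) => k.
  rewrite [leRHS](_ : _ = hz R k ^+ 6 * (2 * (gh s k ^+ 2 + gh 0 k ^+ 2))); last by ring.
  apply: ler_wpM2l; first by rewrite exprn_ge0 // hz_ge0.
  by have := sqr_ge0 (gh s k + gh 0 k); lra.
have avg : \sum_(k <- t) 2 * av k <= 512 * G ^+ 2 + 512 * G ^+ 2.
  apply: (average_cos (n := fun k : Z2 => k.1)) => [k k0|s].
    by rewrite /av k0 expr0n invr0 !mulr0.
  apply: le_trans (ler_sum _ _) _ => [k _|]; first exact: average_le.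
  have := bndD (dd s) (bnd_inj (@oppr_inj _) (dd s)) ut.
  apply: le_trans; apply: ler_sum => k _ /=.
  by rewrite hzN mulrDr.
have : \sum_(k <- t) 2 * (hz R k ^+ 6 * (r (- k) / k.1%:~R) ^+ 2) <= \sum_(k <- t) 2 * av k.
  apply: ler_sum => k _; apply: ler_wpM2l => //; apply: ler_wpM2l; first by rewrite exprn_ge0 // hz_ge0.
  by rewrite expr_div_n; apply: ler_wpM2r; rewrite ?invr_ge0 ?sqr_ge0 // lerDr sqr_ge0.
rewrite -mulr_sumr; lra.
Qed.

(** Replacing [x_1] by [x_1 + Om t] turns the planar mode [k] into [(k, k.1)]. *)
Definition trc i (k : Z3) : R := gr (fun p => p.1) (fh (fun x => F x 0 i)) k.

Lemma trc_bnd i : exists B : R, bnd (fun k => `|trc i k|) B.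
Proof.
have [_ [B HB] _] := field_coefs i tF; exists B.
by apply: bnd_le (bnd_gr (fun p => p.1) _ HB) => // k; rewrite normr_gr.
Qed.

Lemma trc_lim Om i : ulim (fun n => ev Om n (trc i)) (fun z => force_translated F Om z 0 i).
Proof.
have [_ _ ul] := field_coefs i tF.
apply: ulim_ext (ulim_comp (fun z : spacetime R => (z.1.1 + Om * z.2, z.1.2)) ul) => n z /=.
rewrite ev_gr; last by move=> k; rewrite mem_box2 => /andP[].
apply: eq_bigr => k _; congr (_ * _).
have ph : phase Om (k, k.1) z = dot k (z.1.1 + Om * z.2, z.1.2) by rewrite /phase /dot /=; ring.
by rewrite /cas /c2 ph.
Qed.

(** On the graph [l = k.1] one has [rw <= 2 * hz], so the weight is at most [16 * hz^6], and
    [16 * 512 <= 100 ^ 2]. *)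
Lemma translated_coefs Om : 0 < Om -> forced_coefs Om (100 * (`|G| / Om)) (force_translated F Om).
Proof.
move=> Om0; have z0 i (k2 : int) : fh (fun x => F x 0 i) (0, k2) = 0.
  by apply: fh_fourier; [exact: cont_f|exact: F0].
have zero i (k : Z3) : k.1.1 = 0 -> trc i k = 0.
  by case: k => -[a b] l /= ->; rewrite /trc /gr /= z0; case: ifP.
have [B1 b1] := trc_bnd 0; have [B2 b2] := trc_bnd 1.
(* On the graph a mode constant in time has [k.1 = 0]: here the vanishing of the Fourier
   coefficients at [(0, k2)] is decisive. *)
have zl i (k : Z3) : k.2 = 0 -> trc i k = 0.
  by case: k => -[a b] l /= ->; rewrite /trc /gr /=; case: eqP => // <-; exact: z0.
apply: (forced_coefsI Om0 b1 b2 _ _ (zl 0) (zl 1) (trc_lim Om 0) (trc_lim Om 1)).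
- by move=> k k0; apply: zero; rewrite k0.
- by move=> k k0; apply: zero; rewrite k0.
pose c : R := 16 / Om ^+ 2; have c0 : 0 <= c by rewrite divr_ge0 // sqr_ge0.
have nn (k : Z2) : 0 <= c * (hz R k ^+ 6 * (r (- k) / k.1%:~R) ^+ 2).
  exact: mulr_ge0 c0 (mulr_ge0 (exprn_ge0 6 (hz_ge0 R k)) (sqr_ge0 _)).
have le : c * (512 * G ^+ 2) <= (100 * (`|G| / Om)) ^+ 2.
  rewrite !exprMn real_normK ?num_real // exprVn /c.
  have : 0 <= G ^+ 2 / Om ^+ 2 by rewrite divr_ge0 ?sqr_ge0.
  by rewrite [16 / _]mulrC; lra.
apply: bndW le _; apply: bnd_le (bnd_gr (fun p => p.1) nn (bndZ c0 average_bnd)) => -[k l].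
rewrite /trc /gr /=; case: eqP => [->|_]; last by rewrite !mulr0 subrr mul0r !mulr0 expr0n.
have -> : k.1%:~R * fh (fun x => F x 0 1) k - k.2%:~R * fh (fun x => F x 0 0) k = r (- k).
  by rewrite r_formula /= !mulrNz opprK [- - k]opprK /f0 /f1; ring.
have [k0|k0] := eqVneq k.1 0.
  have := nn k; have -> : k.1%:~R = 0 :> R by rewrite k0.
  by rewrite !(mulr0, invr0) expr0n /=; rewrite !mulr0.
have -> : hw R (k, k.1) = hz R k by [].
have rwE : rw R (k, k.1) <= 2 * hz R k.
  rewrite /rw /= intr_norm (_ : hw R (k, k.1) = hz R k) // hzE.
  by have := normr_ge0 (k.2%:~R : R); lra.
have kn : k.1%:~R != 0 :> R by rewrite intr_eq0.
have on : Om != 0 by rewrite gt_eqF.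
have -> : (hz R k * (rw R (k, k.1) ^+ 2 * (r (- k) / (Om * k.1%:~R)))) ^+ 2 =
  rw R (k, k.1) ^+ 4 * (hz R k ^+ 2 * (r (- k) / k.1%:~R) ^+ 2 / Om ^+ 2).
  by field; rewrite kn on.
have -> : c * (hz R k ^+ 6 * (r (- k) / k.1%:~R) ^+ 2) =
  (2 * hz R k) ^+ 4 * (hz R k ^+ 2 * (r (- k) / k.1%:~R) ^+ 2 / Om ^+ 2).
  by rewrite /c; field; rewrite kn on.
apply: ler_wpM2r; last by apply: expr_le => //; exact: rw_ge0.
by rewrite divr_ge0 ?sqr_ge0 // mulr_ge0 ?sqr_ge0.
Qed.

End Data.
End Translated.

(** * Choice of the frequency threshold and conclusion *)

Lemma translated_forced (R : realType) (G Om : R) (F : plane R -> 'rV[R]_2) : 0 < Om ->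
  translated_data 3 G F -> forced_coefs Om (100 * (`|G| / Om)) (force_translated F Om).
Proof.
move=> Om0 [tF F0 [g [tg dg Cg]]].
have dg1 x (t : R) : is_derive t 1 (g x) (rot2 F (x.1 + t, x.2)).
  (* Frequency [1] shows that [g x] is a primitive of the translated [rot F]. *)
  have [d1] := dg 1 x t ltr01; rewrite (_ : (fun tau : R => g x (1 * tau)) = g x) in d1 *.
    by rewrite invr1 !mul1r derive1E => <-; exact: DeriveDef.
  by apply/funext => u; rewrite mul1r.
have Cg' s : (Ck_norm 3 (fun x => g x s) <= G%:E)%E.
  by apply: le_trans Cg; apply: ereal_sup_ubound; exists s.
exact: (translated_coefs tF F0 tg dg1 Cg' Om0).
Qed.

(** [300 = 3 * 100]: the larger constant of the two kinds of forces times the factor in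
    [3 * g0 <= r0]. *)
Lemma small_ratio (R : realType) (c G r Om : R) : 0 <= c -> c <= 100 -> 0 < r -> 0 < Om ->
  300 * `|G| / r + 1 <= Om -> 0 <= c * (`|G| / Om) /\ 3 * (c * (`|G| / Om)) <= r.
Proof.
move=> c0 c1 r0 Om0 h; have G0 := normr_ge0 G.
have q0 : 0 <= `|G| / Om by rewrite divr_ge0 // ltW.
split; first exact: mulr_ge0.
apply: (@le_trans _ _ (300 * (`|G| / Om))).
  by have := ler_wpM2r q0 c1; lra.
rewrite mulrA ler_pdivrMr // [r * _]mulrC -ler_pdivrMr //.
by lra.
Qed.

Theorem theorem1 (R : realType) :
  exists (a : R) (m : nat), 0 < a /\
  forall alpha eps : R, 0 <= alpha -> 0 <= eps -> 0 < Num.max alpha eps ->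
  forall G delta : R, 0 < delta -> delta <= 4^-1 * (alpha + a * eps) ->
  exists Omega0 : R, 0 < Omega0 /\
  forall force : R -> spacetime R -> 'rV[R]_2,
    ((exists2 F, translated_data m G F & force = force_translated F) \/
     (exists2 f, oscillating_data m G f & force = force_oscillating f)) ->
  forall Omega : R, Omega0 <= Omega ->
  exists v : spacetime R -> 'rV[R]_2,
    regular_solution alpha eps (2 * pi / Omega) (force Omega) v /\
    (Loo_W1oo_norm v <= delta%:E)%E.
Proof.
have [D D1 HD] := @forced_flow R.
exists 1, 3%N; split=> // al eps al0 e0 _ G delta d0 dle.
have nu0 : 0 < al + eps by move: dle; rewrite mul1r; lra.
have D0 : 0 < D by lra.
(* This turns the norm bound [r0 * D] into [delta] and the smallness condition of [forced_flow] into
   [delta <= al + eps]. *)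
pose r0 := delta / D; have r00 : 0 < r0 by exact: divr_gt0.
have rD : r0 * D = delta by rewrite /r0 divfK // gt_eqF.
have q0 : 0 <= 300 * `|G| / r0 by exact: divr_ge0 (mulr_ge0 (ler0n R 300) (normr_ge0 G)) (ltW r00).
(* [+ 1] makes the threshold positive also for [G = 0]. *)
exists (300 * `|G| / r0 + 1); split; first lra.
move=> force hforce Om Omle; have Om0 : 0 < Om by lra.
suff [c [c0 c1 [FM [w0 [Fc1 [Fc2 [[b1 b2] [z1 z2] [u1 u2] [w00 w0E] bw]]]]]]] : exists c : R,
    [/\ 0 <= c, c <= 100 & forced_coefs Om (c * (`|G| / Om)) (force Om)].
  have [g0 g1] := small_ratio c0 c1 r00 Om0 Omle.
  have rle : r0 * D <= al + eps by move: dle; rewrite rD mul1r; lra.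
  have := HD al eps Om r0 _ FM w0 Fc1 Fc2 (force Om) al0 e0 nu0 Om0 r00 g0 g1 rle b1 b2 z1 z2 u1 u2 w00 w0E bw.
  by rewrite rD.
case: hforce => [[F dF ->]|[f [tf rf] ->]].
  by exists 100; split => //; exact: translated_forced.
by exists 32; split => //; [lra|exact: osc_coefs].
Qed.
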